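(* Suppose that $H^2_\beta$ is a weighted Hardy space of polynomial growth and $B(z)$ is a finite Blaschke product with order $m$. Then the Hermitian holomorphic vector bundle $E_{B(S_\beta)}$ is similar to $\bigoplus_{j=1}^mE_{S_\beta}$ (over $\mathbb{D}$).
   Context: $\mathbb{D}$ is the open unit disk. A finite Blaschke product of order $m\ge1$ is $B(z)=e^{i\theta}\prod_{j=1}^m\frac{z_j-z}{1-\overline{z_j}z}$ with $\theta\in\mathbb{R}$, $z_j\in\mathbb{D}$. $\beta=\{\beta_k\}_{k\ge0}$ is a sequence of positive numbers with $\beta_0=1$, $w_k=\beta_k/\beta_{k-1}$ ($k\ge1$), with $w_k\to1$. $H^2_\beta=\{f(z)=\sum_{k\ge0}\widehat f(k)z^k:\ \sum_k|\widehat f(k)|^2\beta_k^2<\infty\}$ with $\langle f,g\rangle=\sum_k\beta_k^2\,\widehat f(k)\overline{\widehat g(k)}$. It is of polynomial growth if $\sup_k(k+1)|w_k-1|<\infty$. $S_\beta$ is the bounded operator on $H^2_\beta$ given by $S_\beta f(z)=(f(z)-f(0))/z$; its spectrum is $\overline{\mathbb{D}}$, and $B(S_\beta)$ is defined by the holomorphic functional calculus. $E_{S_\beta}$ and $E_{B(S_\beta)}$ are the Hermitian holomorphic vector bundles over $\mathbb{D}$ in $H^2_\beta$ with fibres $\mathrm{Ker}(S_\beta-\omega\mathbf{I})$ and $\mathrm{Ker}(B(S_\beta)-\omega\mathbf{I})$, $\omega\in\mathbb{D}$. $\bigoplus_{j=1}^mE_{S_\beta}$ is the bundle in $\bigoplus_{j=1}^mH^2_\beta$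 with fibres $\bigoplus_{j=1}^m\mathrm{Ker}(S_\beta-\omega\mathbf{I})$. Bundles $E,\widetilde E$ over $\mathbb{D}$ in Hilbert spaces $\mathcal{H},\widetilde{\mathcal{H}}$ are similar if there is a bounded invertible linear operator $X:\mathcal{H}\to\widetilde{\mathcal{H}}$ with $XE(\omega)=\widetilde E(\omega)$ for all $\omega\in\mathbb{D}$. *)

(* Defs.v *)
From HB Require Import structures.
From mathcomp Require Import all_boot all_order all_algebra.
From mathcomp Require Import all_classical all_reals all_analysis.
From mathcomp Require Import complex.
From mathcomp Require Import ring lra.

Set Implicit Arguments.
Unset Strict Implicit.
Unset Printing Implicit Defensive.

Import Order.TTheory GRing.Theory Num.Theory.
Import numFieldNormedType.Exports.
Import Normc.

Local Open Scope classical_set_scope.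
Local Open Scope complex_scope.
Local Open Scope ring_scope.

Section l2_norms.
Variable R : realType.

Lemma normcE_real (z : R[i]) : `|z| = (normc z)%:C.
Proof. by case: z. Qed.

Lemma normc_ge0 (z : R[i]) : 0 <= normc z.
Proof. by case: z => a b; exact: sqrtr_ge0. Qed.

Lemma sqr_young (s t x y z : R) : 0 < s -> 0 < t -> 0 <= x -> 0 <= y ->
  0 <= z -> z <= x + y ->
  z ^+ 2 <= (1 + t / s) * x ^+ 2 + (1 + s / t) * y ^+ 2.
Proof.
move=> s0 t0 x0 y0 z0 h; apply: (le_trans (y := (x + y) ^+ 2)).
  by rewrite ler_pXn2r ?nnegrE ?addr_ge0.
rewrite -subr_ge0.
have -> : (1 + t / s) * x ^+ 2 + (1 + s / t) * y ^+ 2 - (x + y) ^+ 2 =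
          (t * x - s * y) ^+ 2 / (s * t).
  by field; rewrite !gt_eqF.
by rewrite divr_ge0 ?sqr_ge0 ?mulr_ge0 ?ltW.
Qed.

Lemma normcD_sq (s t : R) (x y : R[i]) : 0 < s -> 0 < t ->
  normc (x + y) ^+ 2 <=
    (1 + t / s) * normc x ^+ 2 + (1 + s / t) * normc y ^+ 2.
Proof.
move=> s0 t0; apply: sqr_young; rewrite ?normc_ge0//.
by have := ler_normD x y; rewrite !normcE_real -rmorphD /= lecR.
Qed.

Lemma sqrt_minkowski (A B D : R) : 0 <= A -> 0 <= B ->
  (forall s t, 0 < s -> 0 < t -> D <= (1 + t / s) * A + (1 + s / t) * B) ->
  Num.sqrt D <= Num.sqrt A + Num.sqrt B.
Proof.
move=> A0 B0 h.
set a := Num.sqrt A; set b := Num.sqrt B.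
have a0 : 0 <= a := sqrtr_ge0 A.
have b0 : 0 <= b := sqrtr_ge0 B.
have eA : A = a ^+ 2 by rewrite sqr_sqrtr.
have eB : B = b ^+ 2 by rewrite sqr_sqrtr.
suff : forall e, 0 < e -> Num.sqrt D <= a + b + e.
  by move=> H; apply/ler_addgt0Pr => e e0; exact: H.
move=> e e0.
have s0 : 0 < a + e / 2 by rewrite ltr_wpDl// divr_gt0.
have t0 : 0 < b + e / 2 by rewrite ltr_wpDl// divr_gt0.
have {}h := h _ _ s0 t0.
have as0 : a < a + e / 2 by rewrite ltrDl divr_gt0.
have bt0 : b < b + e / 2 by rewrite ltrDl divr_gt0.
have -> : a + b + e = (a + e / 2) + (b + e / 2) by field.
move: (a + e / 2) (b + e / 2) s0 t0 as0 bt0 h => s t s0 t0 as0 bt0 h.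
have st0 : 0 <= s + t by rewrite addr_ge0// ltW.
rewrite -[leRHS](ger0_norm st0) -sqrtr_sqr.
apply: ler_wsqrtr; apply: (le_trans h).
have -> : (s + t) ^+ 2 = (1 + t / s) * s ^+ 2 + (1 + s / t) * t ^+ 2.
  by field; rewrite !gt_eqF.
have s0' := ltW s0; have t0' := ltW t0.
have h1 : a ^+ 2 <= s ^+ 2 by rewrite ler_pXn2r ?nnegrE// ltW.
have h2 : b ^+ 2 <= t ^+ 2 by rewrite ler_pXn2r ?nnegrE// ltW.
by rewrite eA eB lerD// ler_wpM2l// addr_ge0// divr_ge0.
Qed.

Lemma cvg_real_complex (u : nat -> R) (l : R) :
  u @ \oo --> l -> ((u k)%:C : R[i]^o) @[k --> \oo] --> (l%:C : R[i]^o).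
Proof.
move=> ul; apply/cvgrPdist_lt => e e0.
have [e1 ee] : exists e1, e = e1%:C.
  by apply/complex_realP; rewrite gtr0_real.
move: e0; rewrite ee ltcR => e0.
have /cvgrPdist_lt/(_ _ e0) := ul.
apply: filterS => n; rewrite -rmorphB normcE_real ltcR /=.
by rewrite expr0n /= addr0 sqrtr_sqr.
Qed.

End l2_norms.

(* For k = 0 this is the junk value beta_0 / beta_0; only k > 0 is ever used. *)
Definition ratio (R : realType) (beta : nat -> R) (k : nat) : R :=
  beta k / beta k.-1.

Record weight (R : realType) := Weight {
  wt :> nat -> R;
  wt_gt0 : forall k, 0 < wt k;
  wt0 : wt 0 = 1;
  wt_ratio : ratio wt k @[k --> \oo] --> (1 : R) }.

Definition polynomial_growth (R : realType) (beta : weight R) : Prop :=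
  exists M : R, forall k, (0 < k)%N -> k.+1%:R * `|ratio beta k - 1| <= M.

Definition H2_pred (R : realType) (beta : weight R) : {pred nat -> R[i]} :=
  mem [set f : nat -> R[i] |
       cvgn (series (fun k => normc (f k) ^+ 2 * beta k ^+ 2))].

(* A power series is encoded by its coefficient sequence: as beta_k / beta_(k-1)
   tends to 1, the series converges on the unit disk and f there determines its
   coefficients. *)
Record H2 (R : realType) (beta : weight R) := MkH2 {
  coef :> nat -> R[i];
  coefP : coef \in H2_pred beta }.

HB.instance Definition _ (R : realType) (beta : weight R) :=
  [isSub for @coef R beta].
HB.instance Definition _ (R : realType) (beta : weight R) :=
  [Choice of H2 beta by <:].

Section H2_module.
Variables (R : realType) (beta : weight R).

Lemma H2_submod_closed : submod_closed (H2_pred beta).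
Proof.
split.
  rewrite inE /=.
  have -> : (fun k => normc ((0 : nat -> R[i]) k) ^+ 2 * beta k ^+ 2) = cst 0.
    by apply/funext => k /=; rewrite !expr0n /= addr0 sqrtr0 expr0n /= mul0r.
  rewrite (_ : series _ = cst 0); first exact: is_cvg_cst.
  by apply/funext => n; rewrite /series /= big1.
move=> a f g; rewrite !inE /= => cf cg.
apply: (@series_le_cvg _ _ (fun k => (2 * normc a ^+ 2) *
   (normc (f k) ^+ 2 * beta k ^+ 2) + 2 * (normc (g k) ^+ 2 * beta k ^+ 2))).
- by move=> k; rewrite mulr_ge0 ?sqr_ge0.
- by move=> k; apply: addr_ge0; repeat apply: mulr_ge0; rewrite ?ler0n ?normc_ge0 ?(ltW (wt_gt0 beta k)).
- move=> k.
  have := normcD_sq (a * f k) (g k) (@ltr01 R) (@ltr01 R).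
  rewrite divr1 normcM exprMn => h.
  rewrite -[X in normc X]/(a * f k + g k).
  apply: (le_trans (ler_wpM2r (sqr_ge0 _) h)).
  by rewrite le_eqVlt; apply/orP; left; apply/eqP; ring.
- apply: is_cvg_seriesD; exact: is_cvg_seriesZ.
Qed.

HB.instance Definition _ :=
  GRing.isSubmodClosed.Build _ _ (H2_pred beta) H2_submod_closed.
HB.instance Definition _ := [SubChoice_isSubLmodule of H2 beta by <:].

Definition H2_dot (f g : H2 beta) : R[i] :=
  limn (series (fun k => ((beta k ^+ 2)%:C * (f k * (g k)^*%C) : R[i]^o))).

Definition H2_norm (f : H2 beta) : R[i] := sqrtC (H2_dot f f).

Let u (f : H2 beta) : R ^nat := fun k => normc (f k) ^+ 2 * beta k ^+ 2.
Let S (f : H2 beta) : R := limn (series (u f)).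

Let cu (f : H2 beta) : cvgn (series (u f)).
Proof. by have := coefP f; rewrite inE. Qed.

Let u_ge0 f k : 0 <= u f k.
Proof. by rewrite mulr_ge0 ?sqr_ge0. Qed.

Let S_ge0 f : 0 <= S f.
Proof.
apply: limr_ge; first exact: cu.
by apply: nearW => n; apply: sumr_ge0 => k _; exact: u_ge0.
Qed.

Let H2_dotE f : H2_dot f f = (S f)%:C.
Proof.
apply: (cvg_lim (@norm_hausdorff R[i] R[i]^o)).
have -> : series (fun k => (beta k ^+ 2)%:C * (f k * (f k)^*%C) : R[i]^o) =
  fun n => (series (u f) n)%:C.
  apply/funext => n; rewrite /series /= rmorph_sum /=.
  apply: eq_bigr => k _.
  by rewrite -sqr_normc normcE_real -!rmorphXn -rmorphM /= mulrC.
exact/cvg_real_complex/cu.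
Qed.

Let H2_normE f : H2_norm f = (Num.sqrt (S f))%:C.
Proof.
rewrite /H2_norm H2_dotE -[in LHS](sqr_sqrtr (S_ge0 f)).
by rewrite rmorphXn /= sqrCK // ler0c sqrtr_ge0.
Qed.

Lemma ler_H2_normD f g : H2_norm (f + g) <= H2_norm f + H2_norm g.
Proof.
rewrite !H2_normE -rmorphD lecR; apply: sqrt_minkowski => // s t s0 t0.
have cZ c h : cvgn (series (c *: u h)) by apply: is_cvg_seriesZ; exact: cu.
rewrite /S -[_ * limn (series (u f))]lim_seriesZ ?cu//.
rewrite -[_ * limn (series (u g))]lim_seriesZ ?cu// -lim_seriesD//.
apply: lim_series_le; [exact: cu|exact: is_cvg_seriesD|move=> k].
rewrite -[leRHS]/((1 + t / s) * u f k + (1 + s / t) * u g k) /u /=.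
have := ler_wpM2r (sqr_ge0 (beta k)) (normcD_sq (f k) (g k) s0 t0).
by rewrite mulrDl -!(mulrA (1 + _)).
Qed.

Lemma H2_normZ (a : R[i]) f : H2_norm (a *: f) = `|a| * H2_norm f.
Proof.
rewrite !H2_normE normcE_real -rmorphM /=; congr (_%:C).
rewrite -[in RHS](ger0_norm (normc_ge0 a)) -sqrtr_sqr -sqrtrM ?sqr_ge0//.
congr Num.sqrt; rewrite /S -[RHS]lim_seriesZ ?cu//.
congr (limn (series _)); apply/funext => k.
rewrite /u -[LHS]/(normc (a * f k) ^+ 2 * beta k ^+ 2).
by rewrite normcM exprMn -mulrA.
Qed.

Lemma H2_norm0_eq0 f : H2_norm f = 0 -> f = 0.
Proof.
rewrite H2_normE => /complexI/eqP; rewrite sqrtr_eq0 => Sf0.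
apply/val_inj/funext => k /=; apply: eq0_normc.
have : u f k <= 0.
  apply: le_trans Sf0; apply: (le_trans (y := series (u f) k.+1)).
    by rewrite /series /= big_nat_recr//= lerDr sumr_ge0.
  apply: nondecreasing_cvgn_le; last exact: cu.
  by apply/nondecreasing_seqP => n; rewrite /series /= big_nat_recr//= lerDl.
rewrite /u pmulr_lle0 ?exprn_gt0 ?wt_gt0// => h.
by apply/eqP; rewrite -sqrf_eq0 eq_le h sqr_ge0.
Qed.

HB.instance Definition _ := Lmodule_isNormed.Build R[i] (H2 beta)
  ler_H2_normD H2_normZ H2_norm0_eq0.

Lemma H2_normP (f : H2 beta) : `|f| = sqrtC (H2_dot f f).
Proof. by []. Qed.

Lemma shift_subproof (f : H2 beta) : (fun k => f k.+1) \in H2_pred beta.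
Proof.
rewrite inE /=.
have [M M0 HM] : exists2 M : R, 0 <= M & forall k, beta k <= M * beta k.+1.
  have cb : cvgn (fun k => (beta k.+1 / beta k)^-1).
    apply/cvg_ex; exists 1^-1.
    by apply: cvgV; [rewrite oner_eq0|have := wt_ratio beta; rewrite -cvg_shiftS].
  have /pinfty_ex_gt0[M M0 HM] := cvg_seq_bounded cb.
  exists M => [|k]; first exact: ltW.
  have b0 := wt_gt0 beta; have /= := HM k I.
  by rewrite invf_div ger0_norm ?ler_pdivrMr// divr_ge0// ltW.
apply: (@series_le_cvg _ _ (fun k => M ^+ 2 * u f k.+1)).
- by move=> k; rewrite mulr_ge0 ?sqr_ge0.
- by move=> k; rewrite mulr_ge0 ?sqr_ge0 ?u_ge0.
- move=> k; have b0 j : 0 <= beta j by rewrite ltW ?wt_gt0.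
  have hb : beta k ^+ 2 <= (M * beta k.+1) ^+ 2.
    by rewrite ler_pXn2r ?nnegrE ?mulr_ge0.
  rewrite exprMn in hb; rewrite /u [leRHS]mulrCA; exact: ler_wpM2l (sqr_ge0 _) _ _ hb.
apply: is_cvg_seriesZ.
have -> : series (fun k => u f k.+1) = fun n => series (u f) n.+1 - u f 0.
  apply/funext => n; by rewrite /series /= big_nat_recl//= addrC addKr.
have /cvg_ex[l ul] := @cu f; apply/cvg_ex; exists (l - u f 0).
by apply: cvgB; [rewrite cvg_shiftS|exact: cvg_cst].
Qed.

(* (f z - f 0) / z has k-th coefficient f_(k+1). *)
Definition bshift (f : H2 beta) : H2 beta := MkH2 (shift_subproof f).

End H2_module.

(* The Hilbert direct sum of m copies of H; it is kept distinct from the function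
   type, whose topology in the library is not the one of the l^2 norm. *)
Definition dsum (R : realType) (m : nat) (H : normedModType R[i]) : Type :=
  'I_m -> H.

Section dsum_module.
Variables (R : realType) (m : nat) (H : normedModType R[i]).

HB.instance Definition _ := GRing.Lmodule.on (dsum m H).

Definition dsum_norm (f : dsum m H) : R[i] := sqrtC (\sum_j `|f j| ^+ 2).

Let nr (x : H) : R := complex.Re `|x|.
Let nrE (x : H) : `|x| = (nr x)%:C.
Proof. by rewrite RRe_real ?normr_real. Qed.
Let nr_ge0 x : 0 <= nr x. Proof. by rewrite -ler0c -nrE. Qed.
Let S (f : dsum m H) : R := \sum_j nr (f j) ^+ 2.
Let S_ge0 f : 0 <= S f. Proof. by apply: sumr_ge0 => j _; exact: sqr_ge0. Qed.
Let normE f : dsum_norm f = (Num.sqrt (S f))%:C.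
Proof.
rewrite /dsum_norm; under eq_bigr do rewrite nrE -rmorphXn.
rewrite -rmorph_sum /= -/(S f) -[in LHS](sqr_sqrtr (S_ge0 f)).
by rewrite rmorphXn /= sqrCK // ler0c sqrtr_ge0.
Qed.

Lemma ler_dsum_normD f g : dsum_norm (f + g) <= dsum_norm f + dsum_norm g.
Proof.
rewrite !normE -rmorphD lecR; apply: sqrt_minkowski => // s t s0 t0.
rewrite !mulr_sumr -big_split /=; apply: ler_sum => j _.
have h : nr (f j + g j) <= nr (f j) + nr (g j).
  by have := ler_normD (f j) (g j); rewrite !nrE -rmorphD /= lecR.
by apply: sqr_young.
Qed.

Lemma dsum_normZ (a : R[i]) f : dsum_norm (a *: f) = `|a| * dsum_norm f.
Proof.
rewrite !normE normcE_real -rmorphM /=; congr (_%:C).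
rewrite -[in RHS](ger0_norm (normc_ge0 a)) -sqrtr_sqr -sqrtrM ?sqr_ge0//.
congr Num.sqrt; rewrite /S mulr_sumr; apply: eq_bigr => j _.
rewrite -exprMn; congr (_ ^+ 2); apply: (@complexI R).
by rewrite rmorphM /= -!nrE -normcE_real [(a *: f) j]/(a *: f j) normrZ.
Qed.

Lemma dsum_norm0_eq0 f : dsum_norm f = 0 -> f = 0.
Proof.
rewrite normE => /complexI/eqP; rewrite sqrtr_eq0 => Sf0.
apply/funext => j; apply/normr0_eq0; rewrite nrE.
suff : nr (f j) ^+ 2 <= 0.
  by move=> h; have /eqP -> // : nr (f j) == 0; rewrite -sqrf_eq0 eq_le h sqr_ge0.
by apply: le_trans Sf0; rewrite /S (bigD1 j)//= lerDl sumr_ge0// => i _; exact: sqr_ge0.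
Qed.

HB.instance Definition _ := Lmodule_isNormed.Build R[i] (dsum m H)
  ler_dsum_normD dsum_normZ dsum_norm0_eq0.

Lemma dsum_normP (f : dsum m H) : `|f| = sqrtC (\sum_j `|f j| ^+ 2).
Proof. by []. Qed.

End dsum_module.

Definition bounded_op (R : realType) (H K : normedModType R[i])
    (T : H -> K) : Prop :=
  linear T /\ exists M : R, forall x, `|T x| <= M%:C * `|x|.

Section functional_calculus.
Variables (R : realType) (H : normedModType R[i]).

Definition is_resolvent (T : H -> H) (z : R[i]) (G : H -> H) : Prop :=
  [/\ bounded_op G, forall x, G (z *: x - T x) = x
    & forall y, z *: G y - T (G y) = y].

Definition spectrum (T : H -> H) : set R[i] :=
  [set z | ~ exists G, is_resolvent T z G].

Definition resolvent (T : H -> H) (z : R[i]) : H -> H :=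
  xget (fun=> 0) [set G | is_resolvent T z G].

Definition expi (t : R) : R[i] := cos t +i* sin t.

Definition cintegral (a b : R) (F : R -> R[i]) : R[i] :=
  (\int[lebesgue_measure]_(t in `[a, b]) complex.Re (F t)) +i*
  (\int[lebesgue_measure]_(t in `[a, b]) complex.Im (F t)).

Definition circle_integral (r : R) (F : R[i] -> R[i]) : R[i] :=
  cintegral 0 (2 * pi) (fun t =>
    F (r%:C * expi t) * ('i%C * (r%:C * expi t))).

(* A = F(T) = (2 i pi)^-1 \oint F(z) (z - T)^-1 dz, the operator-valued
   (Riesz-Dunford) integral being read weakly, i.e. tested against every bounded
   linear functional.  Only contours |z| = r are considered, which is enough when
   F is holomorphic on a disk |z| < rho containing the spectrum; the value does
   not depend on r by Cauchy's theorem. *)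
Definition is_hol_calc (T : H -> H) (F : R[i] -> R[i]) (A : H -> H) : Prop :=
  bounded_op A /\ exists r rho : R,
  [/\ 0 < r < rho,
      spectrum T `<=` [set z | `|z| < r%:C],
      forall z : R[i]^o, `|z| < rho%:C -> derivable (F : R[i]^o -> R[i]^o) z 1
    & forall (phi : H -> R[i]^o) (x : H), bounded_op phi ->
        phi (A x) = (2 * pi%:C * 'i%C)^-1 *
          circle_integral r (fun z => F z * phi (resolvent T z x))].

(* The operator is unique when it exists; the default value is the zero map. *)
Definition hol_calc (T : H -> H) (F : R[i] -> R[i]) : H -> H :=
  xget (fun=> 0) [set A | is_hol_calc T F A].

End functional_calculus.

Definition blaschke (R : realType) (m : nat) (theta : R) (a : 'I_m -> R[i])
    (z : R[i]) : R[i] :=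
  expi theta * \prod_(j < m) ((a j - z) / (1 - (a j)^*%C * z)).

Section bundles.
Variable R : realType.

Definition unit_disk : set R[i] := [set z | `|z| < 1].

(* A Hermitian holomorphic vector bundle over the unit disk in H, given by its
   fibres: subspaces of H of a common dimension n, spanned near every point by a
   holomorphic frame.  The Hermitian metric is the one inherited from H and so is
   not part of the data. *)
Definition hol_bundle (H : normedModType R[i]) (E : R[i] -> set H) : Prop :=
  exists n : nat, forall w0, unit_disk w0 ->
  exists e : 'I_n -> R[i]^o -> H, \forall w \near (w0 : R[i]^o),
  [/\ forall i, derivable (e i) w 1,
      E w = [set \sum_i c i *: e i w | c in [set: 'I_n -> R[i]]]
    & forall c : 'I_n -> R[i], \sum_i c i *: e i w = 0 -> forall i, c i = 0].

Definition ker_bundle (H : normedModType R[i]) (T : H -> H) (w : R[i]) : set H :=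
  [set x | T x - w *: x = 0].

Definition dsum_bundle (m : nat) (H : normedModType R[i]) (E : R[i] -> set H)
    (w : R[i]) : set (dsum m H) :=
  [set f | forall j, E w (f j)].

Definition similar_bundles (H K : normedModType R[i])
    (E : R[i] -> set H) (E' : R[i] -> set K) : Prop :=
  [/\ hol_bundle E, hol_bundle E'
    & exists (X : H -> K) (Y : K -> H),
      [/\ bounded_op X, bounded_op Y, cancel X Y, cancel Y X
        & forall w, unit_disk w -> X @` E w = E' w]].

End bundles.

Arguments bshift {R} beta f.
Arguments dsum_bundle {R} m {H} E w.

(* Main.v *)
(** The idea.  Under the pairing <f, g> = sum f_n g_n the operator B(S) is the
    transpose of multiplication by B.  Let (e_j B^k), j < m, 0 <= k, be the
    Takenaka-Malmquist system of the periodically repeated zeros of B: it is an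
    orthonormal basis of the unweighted Hardy space (Wold decomposition), so the
    matrix of its Taylor coefficients u_(j,k)(n) is unitary.  Since B maps the
    circle to itself with derivative bounded above and below, u_(j,k)(n) decays
    exponentially unless n and k are comparable, and there polynomial growth makes
    beta_n and beta_k comparable; splitting into dyadic blocks, the matrix and its
    adjoint therefore stay bounded on the weighted spaces.  They are the required
    similarity: multiplying e_j B^k by B shifts k, so B(S) is carried to the
    direct sum of m copies of S.  That B(S), defined by a contour integral, is the
    operator so obtained is checked on monomials with Cauchy's formula for the
    Taylor coefficients of B, and then by density. *)

Require Import Defs.
From mathcomp Require Import all_boot all_order all_algebra.
From mathcomp Require Import all_classical all_reals all_analysis.
From mathcomp Require Import measurable_realfun complex.
From mathcomp Require Import ring lra zify.

Set Implicit Arguments.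
Unset Strict Implicit.
Unset Printing Implicit Defensive.

Import Order.TTheory GRing.Theory Num.Theory.
Import numFieldNormedType.Exports.
Import Normc.

Local Open Scope classical_set_scope.
Local Open Scope complex_scope.
Local Open Scope ring_scope.

(** * Takenaka-Malmquist functions as coefficient sequences *)

Section Toeplitz.
Variable R : realType.
Local Notation C := R[i].
Implicit Types (a : C) (f g : nat -> C) (s : nat -> C).

(** So they are proved as relations between coefficients, and boundedness is a separate estimate on
    finite sections of matrices, where passing to the adjoint is harmless.

    Localization is obtained on coefficients. A bound A t^n is roughly a bound on the disk of radius
    1/t, and one Blaschke factor with zero of modulus at most al multiplies A by at most al + 1/(t -
    al). For large t (a small disk about 0) this constant is below 1, so many factors force small
    coefficients when k dominates n. For t between al and 1 (a disk reaching beyond the unit circle)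
    it is merely finite, so the coefficients are small when n dominates k.

    Subexponential variation of beta is absorbed by these exponential tails; the rate 1/k in
    polynomial growth is what makes the weights comparable inside the cone.

    [hol_calc] is a choice among operators whose radii are existentially quantified, so uniqueness
    is proved for every admissible radius. Derivability has to exclude the poles, where division by
    zero still gives the Blaschke product a value. *)

Definition zshift f (n : nat) : C := if n is k.+1 then f k else 0.

Definition delta (i n : nat) : C := (n == i)%:R.

Definition toeplitz (L : (nat -> C) -> nat -> C) : Prop :=
  linear L /\ forall f, L (zshift f) = zshift (L f).

(** Writing f as its constant term plus a shift, coefficient n is reached after n steps; linearity
    and commutation with the shift alone turn [L] into a convolution. *)
Lemma toeplitzE L f n : toeplitz L ->
  L f n = \sum_(i < n.+1) f i * L (delta 0) (n - i)%N.
Proof.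
move=> [linL zL]; elim: n f => [|n IHn] f.
all: have -> : f = f 0%N *: delta 0 + zshift (fun k => f k.+1)
  by apply/funext => -[|k];
     rewrite -[RHS]/(f 0%N * delta 0 _ + _) /delta /= ?mulr1 ?mulr0 ?addr0 ?add0r.
all: rewrite linL zL -[LHS]/(f 0%N * L (delta 0) _ + _) big_ord_recl /=.
all: rewrite -[X in _ = X * _ + _]/(f 0%N * delta 0 0 + 0) /delta /= mulr1 subn0.
  by rewrite big_ord0 !addr0.
rewrite addr0; congr (_ + _); rewrite IHn; apply: eq_bigr => i _.
by rewrite -[X in _ = X * _]/(f 0%N * delta 0 i.+1 + f i.+1) /delta /= mulr0 add0r.
Qed.

Lemma toeplitz_delta L k n : toeplitz L ->
  L (delta k) n = if (k <= n)%N then L (delta 0) (n - k)%N else 0.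
Proof.
move=> tL; have [_ zL] := tL; elim: k n => [|k IHk] n; first by rewrite subn0.
have -> : delta k.+1 = zshift (delta k) by apply/funext => -[].
by rewrite zL; case: n => [//|n]; rewrite /= IHk.
Qed.

Lemma toeplitz_mat L f n N : toeplitz L -> (n < N)%N ->
  L f n = \sum_(k < N) f k * L (delta k) n.
Proof.
move=> tL nN; rewrite (toeplitzE _ _ tL).
rewrite (big_ord_widen _ (fun i => f i * L (delta 0) (n - i)%N) nN) big_mkcond.
apply: eq_bigr => k _ /=; rewrite (toeplitz_delta k _ tL) ltnS.
by case: ifP => // _; rewrite mulr0.
Qed.

Lemma toeplitz_id : toeplitz id.
Proof. by []. Qed.

Lemma toeplitz_comp L L' : toeplitz L -> toeplitz L' -> toeplitz (L \o L').
Proof.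
by move=> [l z] [l' z']; split => [c f g|f] /=; rewrite ?l' ?l ?z' ?z.
Qed.

(* With a bar for conjugation: division by 1 - abar z, and multiplication by the
   Blaschke factor (a - z) / (1 - abar z), on coefficient sequences. *)
Fixpoint geo a f (n : nat) : C := if n is k.+1 then f n + a^*%C * geo a f k else f 0%N.

Definition phi a f (n : nat) : C :=
  if n is k.+1 then a * geo a f n - geo a f k else a * geo a f 0%N.

Arguments phi : simpl never.

Lemma geo_linear a : linear (geo a).
Proof.
move=> c f g; apply/funext => n.
rewrite -[RHS]/(c * geo a f n + geo a g n).
elim: n => [//|n IHn] /=; rewrite IHn -[_ n.+1]/(c * f n.+1 + g n.+1); ring.
Qed.

Lemma geo_zshift a f n : geo a (zshift f) n = zshift (geo a f) n.
Proof.
elim: n => [//|n IHn] /=; rewrite IHn.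
by case: n IHn => [|n] _ /=; rewrite ?mulr0 ?addr0.
Qed.

Lemma phi_toeplitz a : toeplitz (phi a).
Proof.
split=> [c f g|f]; apply/funext => -[|n].
- rewrite -[RHS]/(c * phi a f 0%N + phi a g 0%N) /phi geo_linear.
  rewrite -[(_ + _) 0%N]/(c * geo a f 0%N + geo a g 0%N); ring.
- rewrite -[RHS]/(c * phi a f n.+1 + phi a g n.+1) /phi geo_linear.
  rewrite -[(_ + _) n.+1]/(c * geo a f n.+1 + geo a g n.+1).
  rewrite -[(_ + _) n]/(c * geo a f n + geo a g n); ring.
- by rewrite /phi geo_zshift /= mulr0.
- by rewrite /phi !geo_zshift; case: n => [|n] //=; rewrite subr0.
Qed.

Lemma phi_delta0 a n :
  phi a (delta 0) n.+1 = - (1 - a * a^*%C) * a^*%C ^+ n.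
Proof.
have gE k : geo a (delta 0) k = a^*%C ^+ k.
  by elim: k => [//|k IHk]; rewrite /= IHk /delta /= add0r exprS.
rewrite /phi !gE exprS; ring.
Qed.

Lemma phi_delta0J a n :
  (phi a (delta 0) n.+1)^*%C = - (1 - a * a^*%C) * a ^+ n.
Proof.
rewrite phi_delta0 rmorphM rmorphN rmorphB rmorph1 rmorphM rmorphXn /= conjcK; ring.
Qed.

Definition defect a : R := Num.sqrt (1 - normc a ^+ 2).

(** The normalized Szego kernel at [a]: a unit vector orthogonal to all multiples of the Blaschke
    factor when [a] lies in the disk. *)
Definition khat a (n : nat) : C := (defect a)%:C * a^*%C ^+ n.

Lemma khatJ a n : (khat a n)^*%C = (defect a)%:C * a ^+ n.
Proof.
rewrite [LHS]rmorphM; congr (_ * _); first exact: conjc_real.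
by rewrite [LHS]rmorphXn; congr (_ ^+ _); exact: conjcK.
Qed.

Lemma mulcJ a : a * a^*%C = (normc a ^+ 2)%:C.
Proof. by rewrite -sqr_normc normcE_real -rmorphXn. Qed.

Lemma defect_sq a : normc a < 1 -> (defect a)%:C ^+ 2 = 1 - a * a^*%C.
Proof.
move=> a1; rewrite mulcJ -rmorphXn /= sqr_sqrtr ?rmorphB//.
by rewrite subr_ge0 expr_le1// ?normc_ge0// ltW.
Qed.

(* M_phi M_phi^* = 1 - khat (x) khat^* *)
Lemma phi_rows a n n' N : normc a < 1 -> (n < N)%N ->
  \sum_(k < N) phi a (delta k) n * (phi a (delta k) n')^*%C =
  (n == n')%:R - khat a n * (khat a n')^*%C.
Proof.
move=> a1; have tP := phi_toeplitz a; have d2 := defect_sq a1.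
have kE i j : khat a i * (khat a j)^*%C = (1 - a * a^*%C) * (a^*%C ^+ i * a ^+ j).
  rewrite khatJ /khat -d2; ring.
have dS k j : phi a (delta k.+1) j.+1 = phi a (delta k) j.
  by rewrite (toeplitz_delta k.+1 _ tP) (toeplitz_delta k _ tP) ltnS subSS.
have dS0 k : phi a (delta k.+1) 0 = 0 by rewrite (toeplitz_delta k.+1 _ tP).
have d00 : phi a (delta 0) 0 = a by rewrite /phi /= /delta mulr1.
rewrite kE; elim: n n' N => [|n IHn] n' [//|N] nN; rewrite big_ord_recl /=.
  rewrite big1 ?addr0 => [|i _]; last by rewrite dS0 mul0r.
  rewrite d00; case: n' => [|n'] /=; first by rewrite d00 !expr0; ring.
  rewrite phi_delta0J exprS; ring.
case: n' => [|n'] /=.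
  rewrite big1 ?addr0 => [|i _]; last by rewrite dS0 conjc0 mulr0.
  rewrite d00 phi_delta0 exprS; ring.
(* Deleting row 0 and column 0 of a lower triangular Toeplitz matrix leaves the same matrix, so the
   inner sum is the claim for smaller indices. *)
under eq_bigr do rewrite !dS.
rewrite IHn// phi_delta0 phi_delta0J eqSS !exprS; ring.
Qed.

(** Multiplication by a partial Blaschke product. Peeling off [s 0] first lets inductions pass to
    the shifted sequence. *)
Fixpoint PHI s (P : nat) f : nat -> C :=
  if P is Q.+1 then phi (s 0%N) (PHI (fun k => s k.+1) Q f) else f.

(* The Takenaka-Malmquist functions of the sequence s. *)
Definition TM s (p : nat) : nat -> C := PHI s p (khat (s p)).

Lemma PHI_toeplitz s P : toeplitz (PHI s P).
Proof.
elim: P s => [|P IHP] s; first exact: toeplitz_id.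
exact: toeplitz_comp (phi_toeplitz _) (IHP _).
Qed.

Lemma PHI_add s P Q f : PHI s (P + Q) f = PHI s P (PHI (fun k => s (P + k)%N) Q f).
Proof. by elim: P s => [//|P IHP] s; rewrite addSn /= IHP. Qed.

Lemma TM_S s p : TM s p.+1 = phi (s 0%N) (TM (fun k => s k.+1) p).
Proof. by []. Qed.

(** A resolution of the identity: the projections onto the first P functions plus M M^*, with M the
    multiplication by the product of P factors. Conjugating the identity of the shifted sequence by
    the first factor and using [phi_rows] adds one projection. All matrices are lower triangular, so
    truncation at N is exact on these entries. *)
Lemma TM_rows s P n n' N : (forall k, normc (s k) < 1) -> (n < N)%N -> (n' < N)%N ->
  \sum_(p < P) TM s p n * (TM s p n')^*%C +
  \sum_(i < N) PHI s P (delta i) n * (PHI s P (delta i) n')^*%C = (n == n')%:R.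
Proof.
move=> hs; elim: P s hs n n' => [|P IHP] s hs n n' nN n'N.
  rewrite big_ord0 add0r (bigD1 (Ordinal nN)) //= big1 ?addr0 => [|i ni].
    by rewrite /delta eqxx mul1r eq_sym; case: eqP; rewrite ?conjc1 ?conjc0.
  by rewrite /delta eq_sym -val_eqE /= in ni *; rewrite (negbTE ni) mul0r.
have tP := phi_toeplitz (s 0%N).
have phE f g : phi (s 0%N) f n * (phi (s 0%N) g n')^*%C =
  \sum_(k < N) \sum_(k' < N) phi (s 0%N) (delta k) n *
    (phi (s 0%N) (delta k') n')^*%C * (f k * (g k')^*%C).
  rewrite (toeplitz_mat _ tP nN) (toeplitz_mat _ tP n'N) rmorph_sum /= mulr_suml.
  apply: eq_bigr => k _; rewrite mulr_sumr; apply: eq_bigr => k' _.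
  rewrite rmorphM /=; ring.
rewrite big_ord_recl /= -addrA.
rewrite [X in _ + X](_ : _ = \sum_(k < N) \sum_(k' < N) phi (s 0%N) (delta k) n *
    (phi (s 0%N) (delta k') n')^*%C * (k == k' :> nat)%:R).
  rewrite (_ : \sum_(k < N) _ = \sum_(k < N) phi (s 0%N) (delta k) n *
     (phi (s 0%N) (delta k) n')^*%C).
    by rewrite phi_rows// addrC subrK.
  apply: eq_bigr => k _; rewrite (bigD1 k)//= eqxx mulr1 big1 ?addr0// => k'.
  by rewrite -val_eqE eq_sym => /negbTE /= ->; rewrite mulr0.
under eq_bigr do rewrite /bump /= add1n !TM_S phE.
rewrite exchange_big /=.
under [X in _ + X]eq_bigr do rewrite phE.
rewrite [X in _ + X]exchange_big -big_split /=; apply: eq_bigr => k _.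
rewrite exchange_big [X in _ + X]exchange_big -big_split /=; apply: eq_bigr => k' _.
rewrite -!mulr_sumr -mulrDr; congr (_ * _).
by apply: IHP => // j; apply: hs.
Qed.

(* Telescoping form of the isometry property of multiplication by phi. *)
Lemma phi_dot a f g N :
  \sum_(n < N.+1) phi a f n * (phi a g n)^*%C =
  \sum_(n < N.+1) f n * (g n)^*%C
    - (1 - a * a^*%C) * (geo a f N * (geo a g N)^*%C).
Proof.
elim: N => [|N IHN].
  rewrite !big_ord_recl !big_ord0 /phi /= !rmorphM /=; ring.
rewrite big_ord_recr [in RHS]big_ord_recr /= IHN /phi /=.
rewrite !rmorphB !rmorphD !rmorphM /= !rmorphD !rmorphM /= conjcK; ring.
Qed.

(** In the limit this is the reproducing property: pairing with the kernel evaluates [phi a f] at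
    [a], where the Blaschke factor vanishes. The finite form telescopes. *)
Lemma khat_phi_dot a f N :
  \sum_(n < N.+1) phi a f n * (khat a n)^*%C =
  (defect a)%:C * (a ^+ N.+1 * geo a f N).
Proof.
elim: N => [|N IHN].
  by rewrite big_ord_recl big_ord0 khatJ /phi /= expr0 expr1; ring.
rewrite big_ord_recr IHN khatJ /phi /= !exprS; ring.
Qed.

Lemma khat_dot a N : normc a < 1 ->
  \sum_(n < N) khat a n * (khat a n)^*%C = 1 - (a * a^*%C) ^+ N.
Proof.
move=> a1; elim: N => [|N IHN]; first by rewrite big_ord0 expr0 subrr.
rewrite big_ord_recr IHN khatJ /khat /=.
rewrite mulrACA -expr2 defect_sq// -exprMn_comm; last exact: mulrC.
rewrite [X in X ^+ N]mulrC exprS mulrC; ring.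
Qed.

End Toeplitz.

(** * Complex limits through real moduli *)

Section ComplexSequences.
Variable R : realType.
Local Notation C := R[i].
Implicit Types (u v : nat -> C) (l : C).

Lemma normc_conj (z : C) : normc z^*%C = normc z.
Proof. by apply: (@complexI R); rewrite -!normcE_real normcJ. Qed.

Lemma normc_real (x : R) : normc x%:C = `|x|.
Proof. by rewrite /= expr0n /= addr0 sqrtr_sqr. Qed.

Lemma normcX (z : C) n : normc (z ^+ n) = normc z ^+ n.
Proof.
elim: n => [|n IHn]; first by rewrite !expr0 normc1.
by rewrite !exprS normcM IHn.
Qed.

Lemma ler_normcB (x y : C) : normc (x - y) <= normc x + normc y.
Proof. by rewrite -(normcN y); apply: le_normcD. Qed.

Lemma normc_distC (x y : C) : normc (x - y) = normc (y - x).
Proof. by rewrite -normcN opprB. Qed.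

Lemma ler_normc_sum (I : Type) (r : seq I) (P : pred I) (F : I -> C) :
  normc (\sum_(i <- r | P i) F i) <= \sum_(i <- r | P i) normc (F i).
Proof.
elim/big_rec2: _ => [|i x y _ IH]; first by rewrite normc0.
by apply: le_trans (le_normcD _ _) _; rewrite lerD2l.
Qed.

Lemma ccvgP u l : (u n : C^o) @[n --> \oo] --> (l : C^o) <->
  normc (u n - l) @[n --> \oo] --> (0 : R).
Proof.
split=> [/cvgrPdist_lt ul | /cvgrPdist_lt ul]; apply/cvgrPdist_lt => e e0.
  have ec : 0 < e%:C :> C by rewrite ltcR.
  apply: filterS (ul _ ec) => n; rewrite normcE_real ltcR.
  by rewrite sub0r normrN ger0_norm ?normc_ge0// normc_distC.
have [e1 ee] : exists e1, e = e1%:C by apply/complex_realP; rewrite gtr0_real.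
move: e0; rewrite ee ltcR => e0.
apply: filterS (ul _ e0) => n; rewrite normcE_real ltcR.
by rewrite sub0r normrN ger0_norm ?normc_ge0// normc_distC.
Qed.

Lemma ccvg_le u l (e : nat -> R) : (forall n, normc (u n - l) <= e n) ->
  e @ \oo --> (0 : R) -> (u n : C^o) @[n --> \oo] --> (l : C^o).
Proof.
move=> ue e0; apply/ccvgP; apply: (squeeze_cvgr _ (cvg_cst 0) e0).
by apply: nearW => n /=; rewrite normc_ge0 ue.
Qed.

Lemma cvg_normc u l : (u n : C^o) @[n --> \oo] --> (l : C^o) ->
  normc (u n) @[n --> \oo] --> normc l.
Proof.
move=> /ccvgP ul; apply/cvgrPdist_le => e e0.
move/cvgrPdist_le : ul => /(_ _ e0); apply: filterS => n.
rewrite sub0r normrN (ger0_norm (normc_ge0 _)); apply: le_trans.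
rewrite ler_norml lerBlDr lerNl opprB lerBlDr; apply/andP; split.
  by rewrite -{1}(subrK l (u n)); apply: le_normcD.
by rewrite normc_distC -{1}(subrK (u n) l); apply: le_normcD.
Qed.

Lemma ccvg_unique u l l' : (u n : C^o) @[n --> \oo] --> (l : C^o) ->
  (u n : C^o) @[n --> \oo] --> (l' : C^o) -> l = l'.
Proof. by move=> ul ul'; apply: (cvg_unique (@norm_hausdorff C C^o) ul ul'). Qed.

Lemma cvg_cgeometric (A t : R) : 0 <= t < 1 -> A * t ^+ n @[n --> \oo] --> (0 : R).
Proof.
move=> /andP[t0 t1]; rewrite -[0](mulr0 A); apply: cvgMr.
by apply: cvg_expr; rewrite ger0_norm.
Qed.

Lemma ccvgMr0 c u : (u n : C^o) @[n --> \oo] --> (0 : C^o) ->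
  (c * u n : C^o) @[n --> \oo] --> (0 : C^o).
Proof. by move=> /(@cvgMr C nat \oo _ u c 0); rewrite mulr0. Qed.

Lemma ccvg_conj u l : (u n : C^o) @[n --> \oo] --> (l : C^o) ->
  ((u n)^*%C : C^o) @[n --> \oo] --> (l^*%C : C^o).
Proof.
move=> /ccvgP ul; apply/ccvgP.
by under eq_cvg do rewrite -rmorphB normc_conj.
Qed.

Lemma csummable u : cvgn (series (fun k => normc (u k))) ->
  exists l, (\sum_(k < n) u k : C^o) @[n --> \oo] --> (l : C^o).
Proof.
move=> cu.
have [cRe cIm] : cvgn (series (fun k => complex.Re (u k))) /\
                 cvgn (series (fun k => complex.Im (u k))).
  split; apply: normed_cvg; apply: series_le_cvg cu => k //=; rewrite ?normc_ge0//.
    rewrite -lecR -normcE_real; exact: normc_ge_Re.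
  case: (u k) => x y /=; rewrite -sqrtr_sqr; apply: ler_wsqrtr.
  by rewrite lerDr sqr_ge0.
exists (limn (series (fun k => complex.Re (u k))) +i* limn (series (fun k => complex.Im (u k)))).
rewrite [X in _ --> X]complexE /=.
have -> : (fun n => \sum_(k < n) u k : C^o) = (fun n =>
    ((series (fun k => complex.Re (u k)) n)%:C : C^o) +
    'i%C * ((series (fun k => complex.Im (u k)) n)%:C : C^o)).
  apply/funext => n; rewrite !seriesEord /= !rmorph_sum /= mulr_sumr -big_split /=.
  by apply: eq_bigr => k _; rewrite [LHS]complexE.
apply: cvgD; first exact: cvg_real_complex.
by apply: cvgMr; exact: cvg_real_complex.
Qed.

End ComplexSequences.

(** * Exponential bounds, orthonormality and completeness of the Takenaka-Malmquist functions *)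

Section TakenakaMalmquistBounds.
Variable R : realType.
Local Notation C := R[i].
Implicit Types (a : C) (f g : nat -> C) (s : nat -> C) (A t al : R).

(** The factor t / (t - al) is the sum of the geometric series of ratio al / t. *)
Lemma geo_bound a f A al t : 0 <= A -> normc a <= al -> al < t ->
  (forall n, normc (f n) <= A * t ^+ n) ->
  forall n, normc (geo a f n) <= A * (t / (t - al)) * t ^+ n.
Proof.
move=> A0 aal alt hf.
have al0 : 0 <= al by apply: le_trans aal; apply: normc_ge0.
have t0 : 0 <= t by rewrite (le_trans al0)// ltW.
have d0 : 0 < t - al by rewrite subr_gt0.
elim=> [|n IHn] /=.
  apply: le_trans (hf 0%N) _; rewrite expr0 !mulr1 ler_peMr//.
  by rewrite ler_pdivlMr// mul1r lerBlDr lerDl.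
apply: le_trans (le_normcD _ _) _; rewrite normcM normc_conj.
apply: (@le_trans _ _ (A * t ^+ n.+1 + al * (A * (t / (t - al)) * t ^+ n))).
  by apply: lerD => //; apply: ler_pM; rewrite ?normc_ge0.
rewrite le_eqVlt; apply/orP; left; apply/eqP.
by rewrite exprS; field; rewrite gt_eqF.
Qed.

(** Since phi is [a] minus (1 - |a|^2) z / (1 - abar z), the second term lags by one index and gains
    a factor 1/t. This turns t / (t - al) into 1 / (t - al), which is what allows a constant below 1
    for large t. *)
Lemma phi_bound a f A al t : 0 <= A -> normc a <= al -> al < 1 -> al < t ->
  (forall n, normc (f n) <= A * t ^+ n) ->
  forall n, normc (phi a f n) <= A * (al + (t - al)^-1) * t ^+ n.
Proof.
move=> A0 aal al1 alt hf n.
have al0 : 0 <= al by apply: le_trans aal; apply: normc_ge0.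
have t0 : 0 <= t by rewrite (le_trans al0)// ltW.
have d0 : 0 < t - al by rewrite subr_gt0.
have hg := geo_bound A0 aal alt hf.
case: n => [|n].
  rewrite /phi /= normcM expr0 mulr1 mulrC.
  apply: ler_pM; rewrite ?normc_ge0//.
    by have := hf 0%N; rewrite expr0 mulr1.
  by rewrite (le_trans aal)// lerDl invr_ge0 ltW.
have -> : phi a f n.+1 = a * f n.+1 - (1 - a * a^*%C) * geo a f n.
  by rewrite /phi /=; ring.
apply: le_trans (ler_normcB _ _) _; rewrite !normcM.
have -> : normc (1 - a * a^*%C) = 1 - normc a ^+ 2.
  rewrite mulcJ -[1]/(1%:C) -rmorphB normc_real ger0_norm// subr_ge0.
  by rewrite expr_le1 ?normc_ge0// (le_trans aal)// ltW.
apply: (@le_trans _ _ (al * (A * t ^+ n.+1) + 1 * (A * (t / (t - al)) * t ^+ n))).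
  apply: lerD; apply: ler_pM; rewrite ?normc_ge0//.
    by rewrite subr_ge0 expr_le1 ?normc_ge0// (le_trans aal)// ltW.
  by rewrite lerBlDr lerDl sqr_ge0.
rewrite le_eqVlt; apply/orP; left; apply/eqP.
by rewrite exprS; field; rewrite gt_eqF.
Qed.

Lemma PHI_bound s P f A al t : 0 <= A -> (forall k, normc (s k) <= al) ->
  al < 1 -> al < t -> (forall n, normc (f n) <= A * t ^+ n) ->
  forall n, normc (PHI s P f n) <= A * (al + (t - al)^-1) ^+ P * t ^+ n.
Proof.
move=> A0 + al1 alt hf; elim: P s => [|P IHP] s sal n; first by rewrite expr0 mulr1.
have al0 : 0 <= al by apply: le_trans (sal 0%N); apply: normc_ge0.
rewrite exprSr mulrA /=; apply: phi_bound => //.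
  by rewrite mulr_ge0// exprn_ge0// addr_ge0// invr_ge0 subr_ge0 ltW.
by apply: IHP => k; apply: sal.
Qed.

Lemma khat_bound a al : normc a <= al -> al < 1 ->
  forall n, normc (khat a n) <= al ^+ n.
Proof.
move=> aal al1 n; rewrite /khat normcM normc_real normcX normc_conj.
rewrite -[leRHS]mul1r; apply: ler_pM; rewrite ?exprn_ge0 ?normc_ge0//.
  rewrite ger0_norm ?sqrtr_ge0// -[leRHS]sqrtr1; apply: ler_wsqrtr.
  by rewrite lerBlDr lerDl sqr_ge0.
by apply: lerXn2r; rewrite ?nnegrE ?normc_ge0// (le_trans _ aal)// normc_ge0.
Qed.

Lemma TM_bound s al t : (forall k, normc (s k) <= al) -> al < 1 -> al < t ->
  forall p n, normc (TM s p n) <= (al + (t - al)^-1) ^+ p * t ^+ n.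
Proof.
move=> sal al1 alt p n; have al0 : 0 <= al by apply: le_trans (sal 0%N); apply: normc_ge0.
rewrite -[X in X * _]mul1r; apply: PHI_bound => // k; rewrite mul1r.
apply: le_trans (khat_bound (sal p) al1 k) _.
by apply: lerXn2r; rewrite ?nnegrE// ltW// (le_lt_trans al0).
Qed.

(** On a small disk about 0 every factor is close to its value at 0, of modulus at most al. The
    choice T - al = 2 / (1 - al) makes the constant of [phi_bound] equal to (1 + al) / 2. *)
Lemma TM_decay s al : (forall k, normc (s k) <= al) -> al < 1 ->
  exists q T, [/\ 0 < q < 1, 1 <= T &
    forall p n, normc (TM s p n) <= q ^+ p * T ^+ n].
Proof.
move=> sal al1; have al0 : 0 <= al by apply: le_trans (sal 0%N); apply: normc_ge0.
have d0 : 0 < 1 - al by rewrite subr_gt0.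
exists ((1 + al) / 2), (al + 2 / (1 - al)); split; first by apply/andP; split; lra.
  rewrite (le_trans (y := 2 / (1 - al)))// ?lerDr//.
  by rewrite ler_pdivlMr// mul1r; lra.
have alt : al < al + 2 / (1 - al) by rewrite ltrDl divr_gt0.
move=> p n; have := TM_bound sal al1 alt p n; congr (_ <= _ ^+ _ * _).
by rewrite addrAC subrr add0r invf_div; field.
Qed.

(** Here t lies between al and 1: the disk of radius 1/t contains the closed unit disk and none of
    the poles, so each factor costs only a finite constant. *)
Lemma TM_growth s al : (forall k, normc (s k) <= al) -> al < 1 ->
  exists t L, [/\ 0 < t < 1, 1 <= L &
    forall p n, normc (TM s p n) <= L ^+ p * t ^+ n].
Proof.
move=> sal al1; have al0 : 0 <= al by apply: le_trans (sal 0%N); apply: normc_ge0.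
have d0 : 0 < 1 - al by rewrite subr_gt0.
exists ((1 + al) / 2), (al + ((1 + al) / 2 - al)^-1); split.
- by apply/andP; split; lra.
- rewrite (le_trans (y := ((1 + al) / 2 - al)^-1))// ?lerDr// -[leLHS]invr1.
  by rewrite lef_pV2 ?posrE; lra.
- by apply: TM_bound => //; lra.
Qed.

(** Geometric decay of f and g is what sends the boundary term of [phi_dot] to 0. *)
Lemma phi_dot_cvg a f g A t z : 0 <= A -> normc a < t -> t < 1 ->
  (forall n, normc (f n) <= A * t ^+ n) -> (forall n, normc (g n) <= A * t ^+ n) ->
  (\sum_(n < N) f n * (g n)^*%C : C^o) @[N --> \oo] --> (z : C^o) ->
  (\sum_(n < N) phi a f n * (phi a g n)^*%C : C^o) @[N --> \oo] --> (z : C^o).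
Proof.
move=> A0 at1 t1 hf hg hz; rewrite -cvg_shiftS /=.
under eq_cvg do rewrite phi_dot.
rewrite -(subr0 z); apply: cvgB; first by rewrite -cvg_shiftS in hz.
apply: ccvgMr0.
have gf := geo_bound A0 (lexx _) at1 hf.
have gg := geo_bound A0 (lexx _) at1 hg.
have t0 : 0 <= t by rewrite (le_trans (normc_ge0 a))// ltW.
set B := A * _ in gf gg.
have B0 : 0 <= B by rewrite mulr_ge0// divr_ge0// subr_ge0 ltW.
apply: (@ccvg_le _ _ _ (fun n => B * B * (t ^+ 2) ^+ n)); last first.
  by apply: cvg_cgeometric; rewrite sqr_ge0 expr_lt1.
move=> n; rewrite subr0 normcM normc_conj -exprM mulnC exprM expr2 mulrACA.
by apply: ler_pM; rewrite ?normc_ge0.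
Qed.

Lemma khat_phi_dot_cvg a f A t : 0 <= A -> normc a < t -> t < 1 ->
  (forall n, normc (f n) <= A * t ^+ n) ->
  (\sum_(n < N) phi a f n * (khat a n)^*%C : C^o) @[N --> \oo] --> (0 : C^o).
Proof.
move=> A0 at1 t1 hf; rewrite -cvg_shiftS /=.
under eq_cvg do rewrite khat_phi_dot.
apply: ccvgMr0.
have gf := geo_bound A0 (lexx _) at1 hf.
have t0 : 0 <= t by rewrite (le_trans (normc_ge0 a))// ltW.
set B := A * _ in gf.
have B0 : 0 <= B by rewrite mulr_ge0// divr_ge0// subr_ge0 ltW.
apply: (@ccvg_le _ _ _ (fun n => B * t ^+ n)); last by apply: cvg_cgeometric; rewrite t0.
move=> n; rewrite subr0 normcM -[leRHS]mul1r; apply: ler_pM; rewrite ?normc_ge0//.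
by rewrite normcX expr_le1 ?normc_ge0// (le_trans (ltW at1))// ltW.
Qed.

(** The isometry property strips the common first factor until one index is 0. What remains is the
    norm of a kernel, or the pairing of a kernel with a multiple of its own Blaschke factor. *)
Lemma TM_cols s al p q : (forall k, normc (s k) <= al) -> al < 1 ->
  (\sum_(n < N) TM s p n * (TM s q n)^*%C : C^o) @[N --> \oo] --> ((p == q)%:R : C^o).
Proof.
move=> + al1; pose t := (1 + al) / 2; pose L := al + (t - al)^-1.
move=> sal; have al0 : 0 <= al by apply: le_trans (sal 0%N); apply: normc_ge0.
have t1 : t < 1 by rewrite /t; lra.
have alt : al < t by rewrite /t; lra.
have t0 : 0 < t by rewrite /t; lra.
have L0 : 0 <= L by rewrite addr_ge0// invr_ge0 subr_ge0 ltW.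
have L1 : 1 <= L.
  rewrite (le_trans (y := (t - al)^-1))// ?lerDr// -[leLHS]invr1.
  by rewrite lef_pV2 ?posrE /t; lra.
have TMb s' p' n : (forall k, normc (s' k) <= al) -> normc (TM s' p' n) <= L ^+ p' * t ^+ n.
  by move=> s'al; apply: TM_bound.
elim: p q s sal => [|p IHp] [|q] s sal.
- have s1 : normc (s 0%N) < 1 by rewrite (le_lt_trans (sal _)).
  under eq_cvg do rewrite khat_dot//.
  rewrite eqxx -(subr0 (true%:R)); apply: cvgB; first exact: cvg_cst.
  apply: (@ccvg_le _ _ _ (fun n => 1 * (normc (s 0%N) ^+ 2) ^+ n)).
    by move=> n; rewrite subr0 normcX normcM normc_conj mul1r expr2.
  by apply: cvg_cgeometric; rewrite sqr_ge0 expr_lt1 ?normc_ge0.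
(* The Gram matrix is Hermitian, so this case is the conjugate of the next one. *)
- rewrite -[(0 == q.+1)%:R]conjc0.
  under eq_cvg => N.
    rewrite (_ : \sum_(_ < _) _ = (\sum_(n < N) TM s q.+1 n * (TM s 0 n)^*%C)^*%C); first over.
    by rewrite rmorph_sum; apply: eq_bigr => n _ /=; rewrite rmorphM /= conjcK mulrC.
  apply: ccvg_conj; apply: (@khat_phi_dot_cvg _ _ (L ^+ q) t) => //.
  + exact: exprn_ge0.
  + exact: le_lt_trans (sal _) alt.
  + by move=> n; apply: TMb.
- apply: (@khat_phi_dot_cvg _ _ (L ^+ p) t) => //.
  + exact: exprn_ge0.
  + exact: le_lt_trans (sal _) alt.
  + by move=> n; apply: TMb.
rewrite eqSS; apply: (@phi_dot_cvg _ _ _ (L ^+ (p + q)) t) => //.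
- exact: exprn_ge0.
- exact: le_lt_trans (sal _) alt.
- move=> n; apply: le_trans (TMb _ _ _ _) _ => //.
  by rewrite ler_wpM2r ?exprn_ge0 ?(ltW t0)// ler_weXn2l// leq_addr.
- move=> n; apply: le_trans (TMb _ _ _ _) _ => //.
  by rewrite ler_wpM2r ?exprn_ge0 ?(ltW t0)// ler_weXn2l// leq_addl.
- by apply: IHp => k; apply: sal.
Qed.

(** Completeness: the error left by [TM_rows] consists of finitely many products of coefficients of
    P-fold Blaschke products, each of order q^P with the constants of [TM_decay]. *)
Lemma TM_parseval s al n n' : (forall k, normc (s k) <= al) -> al < 1 ->
  (\sum_(p < P) TM s p n * (TM s p n')^*%C : C^o) @[P --> \oo] --> ((n == n')%:R : C^o).
Proof.
move=> sal al1; have al0 : 0 <= al by apply: le_trans (sal 0%N); apply: normc_ge0.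
pose N := (maxn n n').+1; pose T := al + 2 / (1 - al); pose q := (1 + al) / 2.
have d0 : 0 < 1 - al by rewrite subr_gt0.
have alT : al < T by rewrite ltrDl divr_gt0.
have T1 : 1 <= T.
  rewrite (le_trans (y := 2 / (1 - al)))// ?lerDr//.
  by rewrite ler_pdivlMr// mul1r; lra.
have T0 : 0 <= T by rewrite (le_trans _ T1).
have qE : al + (T - al)^-1 = q by rewrite /T /q addrAC subrr add0r invf_div; field.
have q0 : 0 <= q by rewrite /q; lra.
have q1 : q < 1 by rewrite /q; lra.
have Pb P i k : normc (PHI s P (delta R i) k) <= q ^+ P * T ^+ k.
  rewrite -[X in X * _]mul1r -qE; apply: PHI_bound => // j; rewrite mul1r.
  rewrite /delta; case: eqP => _; rewrite ?normc1 ?normc0 ?exprn_ge0//.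
  exact: exprn_ege1.
apply: (@ccvg_le _ _ _ (fun P => (T ^+ n * T ^+ n' *+ N) * (q ^+ 2) ^+ P)); last first.
  by apply: cvg_cgeometric; rewrite sqr_ge0 expr_lt1.
move=> P.
rewrite -(@TM_rows _ s P n n' N (fun k => le_lt_trans (sal k) al1)
  (leq_maxl _ _) (leq_maxr _ _)) opprD addrA subrr add0r normcN.
apply: le_trans (ler_normc_sum _ _ _) _.
apply: (@le_trans _ _ (\sum_(i < N) T ^+ n * T ^+ n' * (q ^+ 2) ^+ P)).
  apply: ler_sum => i _; rewrite normcM normc_conj.
  have -> : T ^+ n * T ^+ n' * (q ^+ 2) ^+ P = (q ^+ P * T ^+ n) * (q ^+ P * T ^+ n').
    by rewrite -exprM mulnC exprM; ring.
  by apply: ler_pM; rewrite ?normc_ge0.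
by rewrite sumr_const card_ord mulrnAl.
Qed.

End TakenakaMalmquistBounds.

(** * Weights of polynomial growth *)

Section Weights.
Variable R : realType.
Implicit Types (M s : R) (g : nat -> R).

(** One half of polynomial growth, stated for a general sequence so that it serves both for [beta]
    and for its inverse. *)
Definition slow M g : Prop :=
  (forall k, 0 < g k) /\ forall k, g k.+1 <= (1 + M / k.+1%:R) * g k.

(** From n to p there are at most c (n + 1) steps, each costing at most 1 + M / (n + 1), hence at
    most exp (M c) in total. *)
Lemma slow_near M g c : 0 <= M -> slow M g ->
  exists K : R, 0 < K /\
    forall n p, (n <= p)%N -> (p.+1 <= c * n.+1)%N -> g p <= K * g n.
Proof.
move=> M0 [g0 gS]; exists (expR (M * c%:R)); split=> [|n p np pc]; first exact: expR_gt0.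
pose x := M / n.+1%:R; have x0 : 0 <= x by rewrite divr_ge0.
have step d : g (n + d)%N <= (1 + x) ^+ d * g n.
  elim: d => [|d IHd]; first by rewrite addn0 expr0 mul1r.
  rewrite addnS exprS -mulrA; apply: le_trans (gS _) _.
  apply: ler_pM; rewrite ?addr_ge0 ?divr_ge0// ?(ltW (g0 _))//.
  rewrite lerD2l ler_wpM2l// lef_pV2 ?posrE ?ltr0n// ler_nat.
  by rewrite ltnS leq_addr.
rewrite -{1}(subnKC np); apply: le_trans (step _) _.
rewrite ler_wpM2r ?(ltW (g0 _))//.
apply: (@le_trans _ _ (expR x ^+ (p - n))).
  by apply: lerXn2r; rewrite ?nnegrE ?addr_ge0// ?expR_ge0// expR_ge1Dx.
rewrite -expRM_natl ler_expR /x mulrCA ler_wpM2l//.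
rewrite ler_pdivrMr ?ltr0n// -natrM ler_nat; lia.
Qed.

(** From index k0 on a step costs at most s; the at most k0 earlier steps cost at most 1 + M
    each. *)
Lemma slow_geometric M g s : 0 <= M -> slow M g -> 1 < s ->
  exists K : R, 0 < K /\ forall n l, g (n + l)%N <= K * s ^+ l * g n.
Proof.
move=> M0 [g0 gS] s1.
pose k0 := Num.truncn (M / (s - 1)).
have s0 : 0 <= s by rewrite (le_trans _ (ltW s1)).
have large k : (k0 <= k)%N -> 1 + M / k.+1%:R <= s.
  move=> kk; rewrite -lerBrDl ler_pdivrMr ?ltr0n// mulrC -ler_pdivrMr ?subr_gt0//.
  apply: ltW; apply: lt_le_trans (truncnS_gt _) _.
  by rewrite ler_nat ltnS.
have small k : 1 + M / k.+1%:R <= 1 + M.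
  by rewrite lerD2l ler_pdivrMr ?ltr0n// ler_peMr// ler1n.
exists ((1 + M) ^+ k0); split=> [|n l]; first by rewrite exprn_gt0// ltr_pwDl.
(* Counting only the early steps still ahead of n gives a bound that is stable under the induction,
   in which n moves. *)
suff : g (n + l)%N <= (1 + M) ^+ (k0 - n) * s ^+ l * g n.
  move/le_trans; apply; rewrite ler_wpM2r ?(ltW (g0 _))// ler_wpM2r ?exprn_ge0//.
  by rewrite ler_weXn2l ?leq_subr// lerDl.
elim: l n => [|l IHl] n.
  rewrite addn0 expr0 mulr1 ler_peMl ?(ltW (g0 _))//.
  by rewrite exprn_ege1// lerDl.
rewrite addnS -addSn; apply: le_trans (IHl _) _.
apply: (@le_trans _ _ ((1 + M) ^+ (k0 - n.+1) * s ^+ l * ((1 + M / n.+1%:R) * g n))).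
  by rewrite ler_wpM2l// mulr_ge0 ?exprn_ge0// addr_ge0.
rewrite mulrA ler_wpM2r ?(ltW (g0 _))//.
have [nk|kn] := ltnP n k0.
  have -> : (k0 - n = (k0 - n.+1).+1)%N by lia.
  rewrite [X in _ <= X * _]exprSr exprS -!mulrA ler_wpM2l ?exprn_ge0 ?addr_ge0//.
  rewrite mulrC; apply: ler_pM; rewrite ?exprn_ge0 ?addr_ge0 ?divr_ge0//.
  by rewrite ler_peMl ?exprn_ge0// ltW.
have -> : (k0 - n.+1 = 0)%N by lia.
have -> : (k0 - n = 0)%N by lia.
by rewrite expr0 !mul1r exprSr ler_wpM2l ?exprn_ge0// large.
Qed.

Lemma polynomial_growth_slow (beta : weight R) : polynomial_growth beta ->
  exists M, [/\ 0 <= M, slow M beta & slow M (fun k => (beta k)^-1)].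
Proof.
move=> [M hM].
have M0 : 0 <= M by apply: le_trans (hM 1%N isT); rewrite mulr_ge0.
have b0 k : 0 < beta k := wt_gt0 beta k.
(* [B] converts an estimate relative to [beta k] into one relative to [beta k.+1], as the inverse
   weight requires. *)
have [B B0 HB] : exists2 B : R, 0 < B & forall k, beta k <= B * beta k.+1.
  have cb : cvgn (fun k => (beta k.+1 / beta k)^-1).
    apply/cvg_ex; exists 1^-1.
    by apply: cvgV; [rewrite oner_eq0|have := wt_ratio beta; rewrite -cvg_shiftS].
  have /pinfty_ex_gt0[B B0 HB] := cvg_seq_bounded cb.
  exists B => [//|k]; have /= := HB k I.
  by rewrite invf_div ger0_norm ?ler_pdivrMr// divr_ge0// ltW.
have dM k : `|beta k.+1 - beta k| <= M / k.+1%:R * beta k.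
  rewrite -ler_pdivrMr// -{2}(ger0_norm (ltW (b0 k))) -normf_div mulrBl divff ?gt_eqF//.
  rewrite ler_pdivlMr ?ltr0n// mulrC; apply: le_trans (hM k.+1 isT).
  by rewrite ler_wpM2r// ler_nat.
exists (M * (1 + B)); split; first by rewrite mulr_ge0// addr_ge0// ltW.
  split=> [//|k]; rewrite mulrDl mul1r -lerBlDl; apply: le_trans (ler_norm _) _.
  apply: le_trans (dM k) _; rewrite ler_wpM2r ?(ltW (b0 k))// ler_wpM2r//.
  by rewrite ler_peMr// lerDl ltW.
split=> [k|k]; first by rewrite invr_gt0.
rewrite mulrDl mul1r -lerBlDl.
have -> : (beta k.+1)^-1 - (beta k)^-1 = (beta k - beta k.+1) / beta k.+1 / beta k.
  by field; rewrite !gt_eqF.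
rewrite ler_wpM2r ?invr_ge0 ?(ltW (b0 k))// ler_pdivrMr//.
apply: le_trans (ler_norm _) _; rewrite distrC; apply: le_trans (dM k) _.
apply: (@le_trans _ _ (M / k.+1%:R * (B * beta k.+1))).
  by rewrite ler_wpM2l// divr_ge0.
rewrite !mulrA ler_wpM2r ?(ltW (b0 _))// -!mulrA ler_wpM2l// mulrC ler_wpM2r//.
by rewrite lerDr.
Qed.

Variable beta : weight R.
Hypothesis hbeta : polynomial_growth beta.

Lemma wt_near c : exists K : R, 0 < K /\ forall n p,
  (n.+1 <= c * p.+1)%N -> (p.+1 <= c * n.+1)%N -> beta p <= K * beta n.
Proof.
have [M [M0 s1 s2]] := polynomial_growth_slow hbeta.
have [K1 [K10 h1]] := slow_near c M0 s1; have [K2 [K20 h2]] := slow_near c M0 s2.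
have b0 k : 0 < beta k := wt_gt0 beta k.
exists (Num.max K1 K2); split=> [|n p np pn]; first by rewrite lt_max K10.
have [le_np|/ltnW le_pn] := leqP n p.
  apply: le_trans (h1 _ _ le_np pn) _.
  by rewrite ler_wpM2r ?(ltW (b0 _))// le_max lexx.
have := h2 _ _ le_pn np.
rewrite ler_pdivlMr// mulrC ler_pdivrMr// => /le_trans; apply.
by rewrite ler_wpM2r ?(ltW (b0 _))// le_max lexx orbT.
Qed.

Lemma wt_geometric s : 1 < s -> exists K : R, 0 < K /\ forall n l,
  beta (n + l)%N <= K * s ^+ l * beta n /\ beta n <= K * s ^+ l * beta (n + l)%N.
Proof.
move=> s1; have s0 : 0 < s by rewrite (lt_trans _ s1).
have [M [M0 h h']] := polynomial_growth_slow hbeta.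
have [K1 [K10 h1]] := slow_geometric M0 h s1.
have [K2 [K20 h2]] := slow_geometric M0 h' s1.
have b0 k : 0 < beta k := wt_gt0 beta k.
exists (Num.max K1 K2); split=> [|n l]; first by rewrite lt_max K10.
split.
  apply: le_trans (h1 n l) _.
  by rewrite !ler_wpM2r ?(ltW (b0 _)) ?exprn_ge0 ?(ltW s0)// le_max lexx.
have := h2 n l; rewrite ler_pdivlMr// mulrC ler_pdivrMr// => /le_trans; apply.
by rewrite !ler_wpM2r ?(ltW (b0 _)) ?exprn_ge0 ?(ltW s0)// le_max lexx orbT.
Qed.

(** A wasteful bound in n + p, shaped to be multiplied with the tails t^(n + p) of a conic
    matrix. *)
Lemma wt_exp s : 1 < s -> exists K : R, 0 < K /\ forall n p,
  beta p <= K * s ^+ (n + p) * beta n.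
Proof.
move=> s1; have [K [K0 h]] := wt_geometric s1.
have b0 k : 0 < beta k := wt_gt0 beta k.
exists K; split=> // n p.
have mono l l' : (l <= l')%N -> K * s ^+ l * beta n <= K * s ^+ l' * beta n.
  by move=> ll; rewrite ler_wpM2r ?(ltW (b0 _))// ler_wpM2l ?(ltW K0)// ler_weXn2l ?(ltW s1).
have [le_np|/ltnW le_pn] := leqP n p.
  have [+ _] := h n (p - n)%N; rewrite subnKC// => /le_trans; apply; apply: mono; lia.
have [_ +] := h p (n - p)%N; rewrite subnKC// => /le_trans; apply; apply: mono; lia.
Qed.

End Weights.

(** * Finite sections of conic matrices *)

Section FiniteSections.
Variable R : realType.
Local Notation C := R[i].
Implicit Types (w : nat -> R) (T : nat -> nat -> C) (f : nat -> C).

Lemma sum_expr_le (N : nat) (t : R) : 0 <= t < 1 -> \sum_(n < N) t ^+ n <= (1 - t)^-1.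
Proof.
move=> /andP[t0 t1]; rewrite -[leRHS]mul1r ler_pdivlMr ?subr_gt0//.
have -> : (\sum_(n < N) t ^+ n) * (1 - t) = 1 - t ^+ N.
  elim: N => [|N IHN]; first by rewrite big_ord0 mul0r expr0 subrr.
  by rewrite big_ord_recr /= mulrDl IHN exprS; ring.
by rewrite lerBlDr lerDl exprn_ge0.
Qed.

(** Weighted Cauchy-Schwarz: the difference of the two sides is the double sum of k_i k_j (y_i -
    y_j)^2 / 2. *)
Lemma sqr_wsum_le (N : nat) (k y : nat -> R) : (forall n, 0 <= k n) ->
  (\sum_(n < N) k n * y n) ^+ 2 <= (\sum_(n < N) k n) * \sum_(n < N) k n * y n ^+ 2.
Proof.
move=> k0.
pose F i j := k i * k j * (y i ^+ 2 + y j ^+ 2) / 2.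
have -> : (\sum_(n < N) k n) * (\sum_(n < N) k n * y n ^+ 2) =
  \sum_(i < N) \sum_(j < N) F i j.
  have -> : \sum_(i < N) \sum_(j < N) F i j =
      \sum_(i < N) \sum_(j < N) (k i * (k j * y j ^+ 2)) / 2 +
      \sum_(i < N) \sum_(j < N) (k i * (k j * y j ^+ 2)) / 2.
    rewrite [X in _ = _ + X]exchange_big -big_split /=; apply: eq_bigr => i _.
    by rewrite -big_split /=; apply: eq_bigr => j _; rewrite /F; field.
  rewrite -big_split /= mulr_suml; apply: eq_bigr => i _.
  by rewrite mulr_sumr -big_split /=; apply: eq_bigr => j _; field.
rewrite expr2 mulr_suml; apply: ler_sum => i _; rewrite mulr_sumr.
apply: ler_sum => j _; rewrite /F -subr_ge0.
have -> : k i * k j * (y i ^+ 2 + y j ^+ 2) / 2 - k i * y i * (k j * y j) =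
  k i * k j * ((y i - y j) ^+ 2 / 2) by field.
by rewrite mulr_ge0 ?divr_ge0 ?sqr_ge0// mulr_ge0.
Qed.

(* All finite sections of the matrix T have norm at most sqrt M on the l^2 space
   with weight w. *)
Definition section_bound w T (M : R) : Prop := forall f P N,
  \sum_(p < P) normc (\sum_(n < N) T p n * f n) ^+ 2 * w p ^+ 2 <=
  M * \sum_(n < N) normc (f n) ^+ 2 * w n ^+ 2.

(** The Schur test with the weights absorbed into the kernel: Cauchy-Schwarz along each row uses the
    row sums, and exchanging the summations then uses the column sums. *)
Lemma schur_test w T (k : nat -> nat -> R) (A B : R) :
  (forall n, 0 <= w n) -> (forall p n, 0 <= k p n) -> 0 <= A ->
  (forall p n, normc (T p n) * w p <= k p n * w n) ->
  (forall p N, \sum_(n < N) k p n <= A) -> (forall n P, \sum_(p < P) k p n <= B) ->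
  section_bound w T (A * B).
Proof.
move=> w0 k0 A0 Tk kA kB f P N.
pose y n := normc (f n) * w n.
apply: (@le_trans _ _ (\sum_(p < P) A * \sum_(n < N) k p n * y n ^+ 2)).
  apply: ler_sum => p _; rewrite -exprMn.
  apply: (@le_trans _ _ ((\sum_(n < N) k p n * y n) ^+ 2)).
    apply: lerXn2r; rewrite ?nnegrE ?mulr_ge0 ?normc_ge0//.
      by apply: sumr_ge0 => n _; rewrite mulr_ge0// mulr_ge0// normc_ge0.
    apply: (@le_trans _ _ ((\sum_(n < N) normc (T p n * f n)) * w p)).
      by rewrite ler_wpM2r// ler_normc_sum.
    rewrite mulr_suml; apply: ler_sum => n _.
    by rewrite normcM mulrAC /y mulrCA mulrC ler_wpM2l ?normc_ge0// mulrC.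
  apply: le_trans (sqr_wsum_le _ _ (k0 p)) _.
  by rewrite ler_wpM2r// sumr_ge0// => n _; rewrite mulr_ge0 ?sqr_ge0.
rewrite -mulr_sumr -mulrA ler_wpM2l// exchange_big mulr_sumr /=.
apply: ler_sum => n _; rewrite -mulr_suml /y exprMn ler_wpM2r//.
  by rewrite mulr_ge0 ?sqr_ge0.
exact: kB.
Qed.

Lemma section_bound_add w T T' M M' :
  section_bound w T M -> section_bound w T' M' ->
  section_bound w (fun p n => T p n + T' p n) (2 * (M + M')).
Proof.
move=> h h' f P N; rewrite -mulrA (mulrDl M).
apply: (le_trans _ (ler_wpM2l _ (lerD (h f P N) (h' f P N)))); last by [].
rewrite -big_split mulr_sumr /=; apply: ler_sum => p _.
rewrite -mulrDl mulrA ler_wpM2r ?sqr_ge0//.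
have -> : \sum_(n < N) (T p n + T' p n) * f n =
  \sum_(n < N) T p n * f n + \sum_(n < N) T' p n * f n.
  by rewrite -big_split; apply: eq_bigr => n _; rewrite mulrDl.
by have := normcD_sq (\sum_(n < N) T p n * f n) (\sum_(n < N) T' p n * f n)
  (@ltr01 R) (@ltr01 R); rewrite divr1 mulrDr.
Qed.

Lemma section_bound_eq w T T' M : (forall p n, T p n = T' p n) ->
  section_bound w T M -> section_bound w T' M.
Proof. by move=> TT h f P N; apply: le_trans (h f P N); under eq_bigr do under eq_bigr do rewrite -TT. Qed.

Definition contractive T : Prop := forall f P N,
  \sum_(p < P) normc (\sum_(n < N) T p n * f n) ^+ 2 <=
  \sum_(n < N) normc (f n) ^+ 2.

Definition adjoint T (n p : nat) : C := (T p n)^*%C.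

Lemma sqr_normcE (z : C) : (normc z ^+ 2)%:C = z * z^*%C.
Proof. by rewrite mulcJ. Qed.

(* With h = T^* g: |h|^2 = <g, T h> <= (|g|^2 + |T h|^2) / 2 <= (|g|^2 + |h|^2) / 2. *)
Lemma contractive_adjoint T : contractive T -> contractive (adjoint T).
Proof.
move=> cT g N P; pose h n := \sum_(p < P) adjoint T n p * g p.
have hT := cT h P N.
pose S := \sum_(n < N) normc (h n) ^+ 2; rewrite -/S in hT *.
pose G := \sum_(p < P) normc (g p) ^+ 2; rewrite -/G.
suff : S <= (G + \sum_(p < P) normc (\sum_(n < N) T p n * h n) ^+ 2) / 2 by lra.
have SE : S%:C = \sum_(p < P) g p * (\sum_(n < N) T p n * h n)^*%C.
  transitivity (\sum_(n < N) h n * (h n)^*%C).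
    by rewrite rmorph_sum; apply: eq_bigr => n _; exact: sqr_normcE.
  under eq_bigr do rewrite {1}/h mulr_suml.
  rewrite exchange_big /=; apply: eq_bigr => p _; rewrite rmorph_sum mulr_sumr /=.
  by apply: eq_bigr => n _; rewrite rmorphM /adjoint /=; ring.
have S0 : 0 <= S by apply: sumr_ge0 => n _; rewrite sqr_ge0.
have -> : S = normc S%:C by rewrite normc_real ger0_norm.
rewrite SE; apply: le_trans (ler_normc_sum _ _ _) _.
rewrite /G -big_split mulr_suml /=; apply: ler_sum => p _.
rewrite normcM normc_conj -subr_ge0.
move: (normc (g p)) (normc (\sum_(n < N) _)) => x y.
have -> : (x ^+ 2 + y ^+ 2) / 2 - x * y = (x - y) ^+ 2 / 2 by field.
by rewrite divr_ge0 ?sqr_ge0.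
Qed.

(** Exponential smallness outside a cone about the diagonal. The indices are raised by 1 so that
    their ratio makes sense at 0. *)
Definition conic T : Prop := exists K (t : R) c, [/\ 0 <= K, 0 < t < 1 &
  forall p n, (c * p.+1 < n.+1)%N || (c * n.+1 < p.+1)%N ->
    normc (T p n) <= K * t ^+ (n + p)].

Lemma conic_adjoint T : conic T -> conic (adjoint T).
Proof.
move=> [K [t [c [K0 t01 h]]]]; exists K, t, c; split=> // n p hnp.
by rewrite normc_conj addnC h// orbC.
Qed.

Section Dyadic.
Variables (w : nat -> R) (T : nat -> nat -> C).
Hypothesis w0 : forall n, 0 < w n.
Hypothesis wt_near : forall c, exists K : R, 0 < K /\ forall n p,
  (n.+1 <= c * p.+1)%N -> (p.+1 <= c * n.+1)%N -> w p <= K * w n.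
Hypothesis wt_exp : forall s : R, 1 < s -> exists K : R, 0 < K /\ forall n p,
  w p <= K * s ^+ (n + p) * w n.
Hypothesis cT : contractive T.

(** Blocks in base c rather than 2: with c at least the opening of the cone, an entry inside the
    cone joins equal or neighbouring blocks. *)
Let block c n := trunc_log c n.+1.
Let near c i n := (block c n <= i.+1)%N && (i <= (block c n).+1)%N.

Let near_sum c n P : \sum_(i < P) (near c i n)%:R <= 3 :> R.
Proof.
have one (b : nat -> nat) x : injective b -> \sum_(i < P) (b i == x)%:R <= 1 :> R.
  move=> bI; elim: P => [|Q IHQ]; first by rewrite big_ord0.
  rewrite big_ord_recr /=; case: eqP => [bP|_]; last by rewrite addr0.
  rewrite big1 ?add0r// => i _; case: eqP => // bi.
  by have := ltn_ord i; rewrite (bI _ Q (etrans bi (esym bP))) ltnn.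
apply: (@le_trans _ _ (\sum_(i < P) (i == block c n :> nat)%:R +
  \sum_(i < P) (i.+1 == block c n)%:R + \sum_(i < P) (i == (block c n).+1 :> nat)%:R)).
  rewrite -!big_split /=; apply: ler_sum => i _; rewrite -!natrD ler_nat /near.
  by move: (block c n) (nat_of_ord i) => x y; lia.
have -> : 3 = 1 + 1 + 1 :> R by ring.
by rewrite !lerD// ?(one id)// (one succn)//; exact: succn_inj.
Qed.

(** On the rows of block i the weight is nearly constant, and so it is on the columns near i; there
    the unweighted contraction applies. Each column is near at most three blocks, whence the factor
    3; [K ^+ 4] comes from two comparisons of weights, squared. *)
Let near_bound c : (1 < c)%N -> exists M : R, 0 <= M /\
  section_bound w (fun p n => if near c (block c p) n then T p n else 0) M.
Proof.
move=> c1; have c0 : (0 < c)%N by apply: leq_trans c1.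
(* Indices in neighbouring blocks have ratio at most c^2. *)
have [K [K0 hK]] := wt_near (c ^ 2).
have bl n : (c ^ block c n <= n.+1 < c ^ (block c n).+1)%N by exact: trunc_log_bounds.
pose b i := w (c ^ i).-1.
have bS i : (c ^ i).-1.+1 = (c ^ i)%N by rewrite prednK// expn_gt0 c0.
have wb p : w p <= K * b (block c p).
  have /andP[h1 h2] := bl p; apply: hK; rewrite bS.
    by rewrite (leq_trans h1)// leq_pmull// expn_gt0 c0.
  by apply: leq_trans (ltnW h2) _; rewrite expnS leq_mul2r expnS expn1 leq_pmulr ?orbT.
have bw i n : near c i n -> b i <= K * w n.
  move=> /andP[n1 n2]; have /andP[h1 h2] := bl n; apply: hK; rewrite bS.
    apply: leq_trans (ltnW h2) _; rewrite -expnD leq_exp2l//; lia.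
  apply: (@leq_trans (c * c ^ block c n)).
    by rewrite -expnS leq_exp2l.
  by apply: leq_mul => //; rewrite expnS expn1 leq_pmulr.
exists (K ^+ 4 * 3); split; first by rewrite mulr_ge0// exprn_ge0// ltW.
move=> f P N.
pose g i n := if near c i n then f n else 0.
(* Row p is dominated by the sum over all block numbers i of [F i p], of which only its own block is
   relevant. After the exchange each i carries a full sum over p, to which [cT] applies. *)
pose F i p := normc (\sum_(n < N) T p n * g i n) ^+ 2 * (K * b i) ^+ 2.
apply: (@le_trans _ _ (\sum_(p < P) \sum_(i < P) F i p)).
  apply: ler_sum => p _.
  have bP : (block c p < P)%N.
    have /andP[h1 _] := bl p; apply: leq_trans (ltn_ord p).
    by have := leq_trans (ltn_expl (block c p) c1) h1; rewrite ltnS.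
  rewrite (bigD1 (Ordinal bP)) //= -[leLHS]addr0; apply: lerD; last first.
    by apply: sumr_ge0 => i _; rewrite mulr_ge0 ?sqr_ge0.
  rewrite /F; under eq_bigr => n _.
    rewrite (_ : _ * f n = T p n * g (block c p) n); first over.
    by rewrite /g; case: ifP; rewrite ?mul0r ?mulr0.
  rewrite ler_wpM2l ?sqr_ge0//; apply: lerXn2r; rewrite ?nnegrE ?(ltW (w0 _))//.
  by apply: le_trans (wb _); rewrite ltW.
rewrite exchange_big /=.
apply: (@le_trans _ _ (\sum_(i < P) \sum_(n < N) normc (g i n) ^+ 2 * (K * b i) ^+ 2)).
  apply: ler_sum => i _; rewrite -!mulr_suml ler_wpM2r ?sqr_ge0//.
  exact: cT.
rewrite exchange_big mulr_sumr /=; apply: ler_sum => n _.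
apply: (@le_trans _ _ (\sum_(i < P) (near c i n)%:R * (K ^+ 4 * (normc (f n) ^+ 2 * w n ^+ 2)))).
  apply: ler_sum => i _; rewrite /g; case: ifP => [ni|_].
    2: by rewrite normc0 expr0n /= !mul0r.
  rewrite -[true%:R]/(1 : R) mul1r [leRHS]mulrCA ler_wpM2l ?sqr_ge0//.
  have -> : K ^+ 4 * w n ^+ 2 = (K * (K * w n)) ^+ 2 by ring.
  apply: lerXn2r; rewrite ?nnegrE ?mulr_ge0 ?(ltW (w0 _)) ?(ltW K0)//.
  by rewrite ler_wpM2l ?bw// ltW.
rewrite -mulr_suml [leRHS]mulrAC mulrC; apply: ler_wpM2l; last exact: near_sum.
by rewrite mulr_ge0 ?exprn_ge0 ?(ltW K0)// mulr_ge0 ?sqr_ge0.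
Qed.

(** The weights lose at most s^(n + p) while the entries gain t^(n + p); with t s < 1 the Schur test
    applies to a kernel of rank one. *)
Let far_bound c (K t : R) : (1 < c)%N -> 0 <= K -> 0 < t < 1 ->
  (forall p n, (c * p.+1 < n.+1)%N || (c * n.+1 < p.+1)%N ->
    normc (T p n) <= K * t ^+ (n + p)) ->
  exists M : R, 0 <= M /\
  section_bound w (fun p n => if near c (block c p) n then 0 else T p n) M.
Proof.
move=> c1 K0 /andP[t0 t1] hT.
(* This s exceeds 1 and gives t s = 2 t / (1 + t) < 1. *)
pose s := 2 / (1 + t); have d0 : 0 < 1 + t by rewrite addr_gt0.
have s1 : 1 < s by rewrite /s ltr_pdivlMr// mul1r; lra.
have s0 : 0 < s by rewrite (lt_trans _ s1).
pose r := t * s; have r0 : 0 <= r by rewrite mulr_ge0 ?ltW.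
have r1 : r < 1 by rewrite /r /s mulrA ltr_pdivrMr// mul1r; lra.
have [L [L0 hL]] := wt_exp s1.
pose k p n := K * L * r ^+ n * r ^+ p.
have k0 p n : 0 <= k p n by rewrite !mulr_ge0 ?exprn_ge0// ltW.
pose A := K * L / (1 - r).
have A0 : 0 <= A by rewrite divr_ge0 ?mulr_ge0 ?subr_ge0 ?(ltW L0) ?(ltW r1).
have sumk p N : \sum_(n < N) K * L * r ^+ n * r ^+ p <= A.
  rewrite -mulr_suml -mulr_sumr -[leRHS]mulr1.
  apply: ler_pM; rewrite ?exprn_ge0 ?exprn_ile1 ?(ltW r1)//.
    by rewrite !mulr_ge0 ?(ltW L0)// sumr_ge0// => n _; rewrite exprn_ge0.
  by rewrite ler_wpM2l ?mulr_ge0 ?(ltW L0)// sum_expr_le// r0.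
exists (A * A); split; first by rewrite mulr_ge0.
apply: (schur_test (k := k)) => // [n|p n|n P]; first exact: ltW.
  case: ifP => hnear; first by rewrite normc0 mul0r mulr_ge0// ltW.
  apply: (@le_trans _ _ (K * t ^+ (n + p) * (L * s ^+ (n + p) * w n))).
    apply: ler_pM; rewrite ?normc_ge0 ?(ltW (w0 _))// hT//.
    have bl m : (c ^ block c m <= m.+1 < c ^ (block c m).+1)%N by exact: trunc_log_bounds.
    have /andP[p1 p2] := bl p; have /andP[n1 n2] := bl n.
    (* Block numbers differing by at least 2 leave a full block in between, so the indices have
       ratio above c and the entry lies outside the cone. *)
    move: hnear; rewrite /near => /negbT; rewrite negb_and -!ltnNge => /orP[h|h].
      apply/orP; left; apply: leq_trans n1; apply: (@leq_trans (c * c ^ (block c p).+1)).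
        by rewrite ltn_pmul2l// (leq_trans _ c1).
      by rewrite -expnS leq_exp2l.
    apply/orP; right; apply: leq_trans p1; apply: (@leq_trans (c * c ^ (block c n).+1)).
      by rewrite ltn_pmul2l// (leq_trans _ c1).
    by rewrite -expnS leq_exp2l.
  by rewrite /k /r le_eqVlt; apply/orP; left; apply/eqP; rewrite !exprMn !exprD; ring.
by rewrite /k; under eq_bigr do rewrite mulrAC; exact: sumk.
Qed.

Lemma conic_section_bound : conic T -> exists M : R, 0 <= M /\ section_bound w T M.
Proof.
move=> [K [t [c [K0 t01 hT]]]].
(* Widening the cone keeps the tail estimate and makes its opening a legitimate base for the
   blocks. *)
have c1 : (1 < c + 2)%N by rewrite addnC.
have [M1 [M10 h1]] := near_bound c1.
have [|M2 [M20 h2]] := @far_bound (c + 2)%N K t c1 K0 t01.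
  by move=> p n h; apply: hT; lia.
exists (2 * (M1 + M2)); split; first by rewrite mulr_ge0// addr_ge0.
apply: section_bound_eq (section_bound_add h1 h2) => p n.
by case: ifP; rewrite ?addr0 ?add0r.
Qed.

End Dyadic.
End FiniteSections.

(** * Operators on weighted Hardy spaces *)

Section BoundedOperators.
Variable R : realType.
Local Notation C := R[i].
Implicit Types (H K L : normedModType C).

(** The norm of a complex space has values in [R[i]]; its real part gives access to real order and
    limits. *)
Definition rnorm H (x : H) : R := complex.Re `|x|.

Lemma rnormE H (x : H) : `|x| = (rnorm x)%:C.
Proof. by rewrite RRe_real ?normr_real. Qed.

Lemma rnorm_ge0 H (x : H) : 0 <= rnorm x.
Proof. by rewrite -ler0c -rnormE. Qed.

Lemma rnormD H (x y : H) : rnorm (x + y) <= rnorm x + rnorm y.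
Proof. by rewrite -lecR rmorphD /= -!rnormE ler_normD. Qed.

Lemma rnormZ H (c : C) (x : H) : rnorm (c *: x) = normc c * rnorm x.
Proof. by apply: complexI; rewrite rmorphM /= -!rnormE normrZ normcE_real. Qed.

Lemma rnormN H (x : H) : rnorm (- x) = rnorm x.
Proof. by rewrite /rnorm normrN. Qed.

Lemma rnorm0 H : rnorm (0 : H) = 0.
Proof. by rewrite /rnorm normr0. Qed.

Lemma rnorm_eq0 H (x : H) : rnorm x <= 0 -> x = 0.
Proof.
move=> x0; apply: normr0_eq0; rewrite rnormE.
by have /eqP -> : rnorm x == 0 by rewrite eq_le x0 rnorm_ge0.
Qed.

Lemma rnormC (z : C^o) : rnorm z = normc z.
Proof. by apply: complexI; rewrite -[LHS]rnormE; exact: normcE_real. Qed.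

Lemma bounded_opP H K (T : H -> K) : bounded_op T <->
  linear T /\ exists M : R, 0 <= M /\ forall x, rnorm (T x) <= M * rnorm x.
Proof.
split=> -[lT [M hM]]; split=> //.
  exists `|M|; split=> // x; have := hM x.
  rewrite !rnormE -rmorphM lecR => /le_trans; apply.
  by rewrite ler_wpM2r ?rnorm_ge0// ler_norm.
by exists M => x; have [_ h] := hM; rewrite !rnormE -rmorphM lecR.
Qed.

Lemma linear_map0 H K (T : H -> K) : linear T -> T 0 = 0.
Proof. by move=> lT; have := lT (-1) 0 0; rewrite scaler0 addr0 scaleN1r addNr. Qed.

Lemma linear_mapZ H K (T : H -> K) c x : linear T -> T (c *: x) = c *: T x.
Proof. by move=> lT; have := lT c x 0; rewrite !addr0 (linear_map0 lT) addr0. Qed.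

Lemma linear_mapD H K (T : H -> K) x y : linear T -> T (x + y) = T x + T y.
Proof. by move=> lT; have := lT 1 x y; rewrite !scale1r. Qed.

Lemma linear_mapB H K (T : H -> K) x y : linear T -> T (x - y) = T x - T y.
Proof. by move=> lT; rewrite addrC -scaleN1r lT scaleN1r addrC. Qed.

Lemma linear_map_sum H K (T : H -> K) (I : Type) (r : seq I) (F : I -> H) : linear T ->
  T (\sum_(i <- r) F i) = \sum_(i <- r) T (F i).
Proof.
by move=> lT; elim/big_rec2: _ => [|i x y _ <-]; rewrite ?linear_map0// linear_mapD.
Qed.

Lemma bounded_id H : bounded_op (@id H).
Proof. by apply/bounded_opP; split=> //; exists 1; split=> // x; rewrite mul1r. Qed.

Lemma bounded_comp H K L (T : K -> L) (S : H -> K) :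
  bounded_op T -> bounded_op S -> bounded_op (T \o S).
Proof.
move=> /bounded_opP[lT [M [M0 hM]]] /bounded_opP[lS [N [N0 hN]]].
apply/bounded_opP; split=> [c x y|] /=; first by rewrite lS lT.
exists (M * N); split=> [|x /=]; first exact: mulr_ge0.
by apply: le_trans (hM _) _; rewrite -mulrA ler_wpM2l.
Qed.

Lemma bounded_add H K (T S : H -> K) :
  bounded_op T -> bounded_op S -> bounded_op (fun x => T x + S x).
Proof.
move=> /bounded_opP[lT [M [M0 hM]]] /bounded_opP[lS [N [N0 hN]]].
apply/bounded_opP; split=> [c x y|].
  by rewrite lS lT scalerDr addrACA.
exists (M + N); split=> [|x]; first exact: addr_ge0.
by apply: le_trans (rnormD _ _) _; rewrite mulrDl lerD.
Qed.

Lemma bounded_scale H K (T : H -> K) c : bounded_op T -> bounded_op (fun x => c *: T x).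
Proof.
move=> /bounded_opP[lT [M [M0 hM]]]; apply/bounded_opP; split=> [d x y|].
  by rewrite lT scalerDr !scalerA mulrC.
exists (normc c * M); split=> [|x]; first by rewrite mulr_ge0 ?normc_ge0.
by rewrite rnormZ -mulrA ler_wpM2l ?normc_ge0.
Qed.

Lemma bounded_sum H K (I : Type) (r : seq I) (T : I -> H -> K) :
  (forall i, bounded_op (T i)) -> bounded_op (fun x => \sum_(i <- r) T i x).
Proof.
move=> hT; elim: r => [|i r IHr].
  apply/bounded_opP; split=> [c x y|]; first by rewrite !big_nil scaler0 addr0.
  by exists 0; split=> // x; rewrite big_nil rnorm0 mul0r.
have -> : (fun x => \sum_(j <- i :: r) T j x) = (fun x => T i x + \sum_(j <- r) T j x).
  by apply/funext => x; rewrite big_cons.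
exact: bounded_add.
Qed.

End BoundedOperators.

Section HardySpace.
Variables (R : realType) (beta : weight R).
Local Notation C := R[i].
Local Notation H2 := (H2 beta).
Implicit Types f g : H2.

Let b0 k : 0 < beta k := wt_gt0 beta k.

Lemma coefD f g k : (f + g) k = f k + g k. Proof. by []. Qed.
Lemma coefB f g k : (f - g) k = f k - g k. Proof. by []. Qed.
Lemma coefZ c f k : (c *: f) k = c * f k. Proof. by []. Qed.

Lemma coef_inj f g : (forall k, f k = g k) -> f = g.
Proof. by move=> fg; apply/val_inj/funext. Qed.

Lemma coef_sum (I : Type) (r : seq I) (F : I -> H2) k :
  (\sum_(i <- r) F i) k = \sum_(i <- r) F i k.
Proof. by elim/big_rec2: _ => // i x y _ <-. Qed.

Definition sqterm (f : nat -> C) k : R := normc (f k) ^+ 2 * beta k ^+ 2.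

Lemma sqterm_ge0 (f : nat -> C) k : 0 <= sqterm f k.
Proof. by rewrite mulr_ge0 ?sqr_ge0. Qed.

Lemma seriesO (u : nat -> R) n : series u n = \sum_(k < n) u k.
Proof. by rewrite seriesEord. Qed.

Lemma summable_bound (u : nat -> R) B : (forall k, 0 <= u k) ->
  (forall n, \sum_(k < n) u k <= B) -> cvgn (series u).
Proof.
move=> u0 uB; apply: nondecreasing_is_cvgn.
  by apply/nondecreasing_seqP => n; rewrite /series /= big_nat_recr//= lerDl.
by exists B => _ [n _ <-]; rewrite seriesO uB.
Qed.

Lemma H2_mem (f : nat -> C) B : (forall n, \sum_(k < n) sqterm f k <= B) ->
  f \in H2_pred beta.
Proof.
by move=> fB; rewrite inE /=; apply: summable_bound fB; apply: sqterm_ge0.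
Qed.

(* Locked: unifying two instances by unfolding would be very slow. *)
Definition mkH2 (f : nat -> C) : H2 := locked (insubd (0 : H2) f).

Lemma mkH2E (f : nat -> C) B k : (forall n, \sum_(k < n) sqterm f k <= B) ->
  mkH2 f k = f k.
Proof. by move=> /H2_mem fP; rewrite /mkH2 -lock -[LHS]/(val _ k) insubdK. Qed.

Let cv f : cvgn (series (sqterm f)).
Proof. by have := coefP f; rewrite inE. Qed.

Lemma sqr_rnorm f : rnorm f ^+ 2 = limn (series (sqterm f)).
Proof.
have S0 : 0 <= limn (series (sqterm f)).
  by apply: limr_ge; [exact: cv|apply: nearW => n; apply: sumr_ge0 => k _; exact: sqterm_ge0].
have dE : H2_dot f f = (limn (series (sqterm f)))%:C.
  apply: (cvg_lim (@norm_hausdorff C C^o)).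
  have -> : series (fun k => (beta k ^+ 2)%:C * (f k * (f k)^*%C) : C^o) =
    fun n => (series (sqterm f) n)%:C.
    apply/funext => n; rewrite /series /= rmorph_sum /=.
    by apply: eq_bigr => k _; rewrite mulcJ -rmorphM mulrC.
  exact/cvg_real_complex/cv.
apply: complexI; rewrite rmorphXn /= -rnormE H2_normP dE.
by rewrite sqrtCK.
Qed.

Lemma rnorm_partial f n : \sum_(k < n) sqterm f k <= rnorm f ^+ 2.
Proof.
rewrite sqr_rnorm -seriesO; apply: nondecreasing_cvgn_le; last exact: cv.
by apply/nondecreasing_seqP => k; rewrite /series /= big_nat_recr//= lerDl sqterm_ge0.
Qed.

Lemma rnorm_le f (B : R) : 0 <= B ->
  (forall n, \sum_(k < n) sqterm f k <= B ^+ 2) -> rnorm f <= B.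
Proof.
move=> B0 fB; rewrite -(@ler_pXn2r _ 2) ?nnegrE ?rnorm_ge0// sqr_rnorm.
by apply: limr_le; [exact: cv|apply: nearW => n; rewrite seriesO fB].
Qed.

Lemma coef_le f k : normc (f k) <= rnorm f / beta k.
Proof.
rewrite ler_pdivlMr// -(@ler_pXn2r _ 2) ?nnegrE ?rnorm_ge0 ?mulr_ge0 ?normc_ge0 ?(ltW (b0 _))//.
rewrite exprMn; apply: le_trans (rnorm_partial f k.+1).
by rewrite big_ord_recr /= lerDr sumr_ge0// => i _; exact: sqterm_ge0.
Qed.

Definition hdelta n : H2 := mkH2 (delta R n).

Lemma hdeltaE n k : hdelta n k = delta R n k.
Proof.
apply: (@mkH2E _ (beta n ^+ 2)) => N; elim: N => [|N IHN]; first by rewrite big_ord0 sqr_ge0.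
rewrite big_ord_recr /= {2}/sqterm /delta; case: eqP => [Nn|_]; last first.
  by rewrite normc0 expr0n mul0r addr0.
rewrite -Nn normc1 expr1n mul1r gerDr big1 // => i _; rewrite /sqterm.
have := ltn_ord i; rewrite /delta => /ltn_eqF ->.
by rewrite normc0 expr0n mul0r.
Qed.

Definition trunc f N : H2 := \sum_(n < N) f n *: hdelta n.

Lemma truncE f N k : trunc f N k = if (k < N)%N then f k else 0.
Proof.
rewrite /trunc coef_sum; under eq_bigr do rewrite coefZ hdeltaE /delta.
have [kN|Nk] := ltnP k N.
  rewrite (bigD1 (Ordinal kN))//= eqxx mulr1 big1 ?addr0// => i.
  by rewrite -val_eqE /= eq_sym => /negbTE ->; rewrite mulr0.
by rewrite big1// => i _; rewrite gtn_eqF ?mulr0// (leq_trans (ltn_ord i)).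
Qed.

Lemma trunc_cvg f : rnorm (f - trunc f N) @[N --> \oo] --> (0 : R).
Proof.
have e2 : (fun N => rnorm (f - trunc f N) ^+ 2) @ \oo --> (0 : R).
  have e0 : limn (series (sqterm f)) - series (sqterm f) N @[N --> \oo] --> (0 : R).
    by rewrite -(subrr (limn (series (sqterm f)))); apply: cvgB; [exact: cvg_cst|exact: cv].
  apply: (squeeze_cvgr _ (cvg_cst 0) e0); apply: nearW => N; rewrite sqr_ge0 /=.
  rewrite sqr_rnorm; apply: limr_le; first exact: cv.
  apply: nearW => n; rewrite lerBrDr.
  apply: (@le_trans _ _ (series (sqterm f) (maxn n N))).
    rewrite !seriesO (big_ord_widen _ _ (leq_maxl n N)) (big_ord_widen _ _ (leq_maxr n N)).
    rewrite [X in X + _]big_mkcond [X in _ + X]big_mkcond -big_split /=.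
    apply: ler_sum => k _.
    have -> : sqterm (f - trunc f N) k = if (k < N)%N then 0 else sqterm f k.
      rewrite /sqterm coefB truncE; case: ifP => _; rewrite ?subr0//.
      by rewrite subrr normc0 expr0n mul0r.
    by have := sqterm_ge0 f k; do 2 case: ifP => _; rewrite ?addr0 ?add0r.
  by rewrite seriesO -sqr_rnorm rnorm_partial.
have : Num.sqrt (rnorm (f - trunc f N) ^+ 2) @[N --> \oo] --> Num.sqrt (0 : R).
  by apply: continuous_cvg e2; exact: sqrt_continuous.
by rewrite sqrtr0; under eq_cvg do rewrite sqrtr_sqr ger0_norm ?rnorm_ge0//.
Qed.

(** Polynomials are dense; through this the relations between the operators below reduce to their
    action on monomials. *)
Lemma bounded_ext (K : normedModType C) (T T' : H2 -> K) :
  bounded_op T -> bounded_op T' -> (forall n, T (hdelta n) = T' (hdelta n)) ->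
  T =1 T'.
Proof.
move=> bT bT' TT f; apply/eqP; rewrite -subr_eq0; apply/eqP.
have [lT _] := bT; have [lT' _] := bT'.
have := bounded_add bT (bounded_scale (-1) bT') => /bounded_opP[lS [M [M0 hM]]].
apply: rnorm_eq0.
have e0 : M * rnorm (f - trunc f N) @[N --> \oo] --> (0 : R).
  by rewrite -(mulr0 M); apply: cvgMr; exact: trunc_cvg.
rewrite -(cvg_lim (@Rhausdorff R) e0); apply: limr_ge; first by apply/cvg_ex; exists 0.
apply: nearW => N; apply: le_trans (hM _); rewrite scaleN1r.
rewrite (linear_mapB _ _ lT) (linear_mapB _ _ lT') /trunc (linear_map_sum _ _ lT) (linear_map_sum _ _ lT').
rewrite (_ : \sum_(i < N) T _ = \sum_(i < N) T' (f i *: hdelta i)) ?subrKA ?opprB ?addrA ?subrK//.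
by apply: eq_bigr => i _; rewrite !linear_mapZ// TT.
Qed.

End HardySpace.

Lemma cvg_bigsum (K : numFieldType) (V : normedModType K) (I : Type) (r : seq I)
    (F : I -> nat -> V) (l : I -> V) :
  (forall i, F i n @[n --> \oo] --> l i) ->
  \sum_(i <- r) F i n @[n --> \oo] --> \sum_(i <- r) l i.
Proof.
move=> Fl; elim: r => [|i r IHr].
  by rewrite big_nil; under eq_cvg do rewrite big_nil; exact: cvg_cst.
by rewrite big_cons; under eq_cvg do rewrite big_cons; exact: cvgD.
Qed.

(** * Operators defined by infinite matrices *)

Section MatrixOperators.
Variables (R : realType) (beta : weight R).
Local Notation C := R[i].
Local Notation H2 := (H2 beta).
Implicit Types (f : H2) (T : nat -> nat -> C).

Let b0 k : 0 < beta k := wt_gt0 beta k.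

(** Both the limit and [mkH2] have default values; a section bound on T guarantees that neither
    default is taken. *)
Definition mat_op T f : H2 :=
  mkH2 beta (fun p => limn (fun N => \sum_(n < N) T p n * f n : C^o)).

Section Bounded.
Variables (T : nat -> nat -> C) (M : R).
Hypothesis M0 : 0 <= M.
Hypothesis TM : section_bound beta T M.

(* Test the section bound on conj (T p n) / beta n ^ 2. *)
Let row_summable p : cvgn (series (fun n => normc (T p n) ^+ 2 / beta n ^+ 2)).
Proof.
have q0 n : 0 <= normc (T p n) ^+ 2 / beta n ^+ 2 by rewrite divr_ge0 ?sqr_ge0.
apply: (summable_bound (B := M / beta p ^+ 2)) => // N.
pose g n : C := (T p n)^*%C * ((beta n ^- 2)%:C).
pose Q := \sum_(n < N) normc (T p n) ^+ 2 / beta n ^+ 2; rewrite -/Q.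
have Q0 : 0 <= Q by apply: sumr_ge0 => n _; exact: q0.
have := TM g p.+1 N; rewrite big_ord_recr /=.
have -> : \sum_(n < N) T p n * g n = Q%:C.
  rewrite rmorph_sum; apply: eq_bigr => n _.
  by rewrite /g mulrA mulcJ [RHS]rmorphM.
have -> : \sum_(n < N) normc (g n) ^+ 2 * beta n ^+ 2 = Q.
  apply: eq_bigr => n _; rewrite normcM normc_conj normc_real.
  rewrite ger0_norm ?invr_ge0 ?sqr_ge0// exprMn.
  by field; rewrite gt_eqF.
rewrite normc_real ger0_norm// ler_pdivlMr ?exprn_gt0// => h.
have {}h : Q ^+ 2 * beta p ^+ 2 <= M * Q.
  by apply: le_trans h; rewrite lerDr sumr_ge0// => i _; rewrite mulr_ge0 ?sqr_ge0.
have [->|Qn0] := eqVneq Q 0; first by rewrite mul0r.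
have Qp : 0 < Q by rewrite lt_def Qn0.
by rewrite -(ler_pM2l Qp) mulrA -expr2 [leRHS]mulrC.
Qed.

Lemma mat_op_summable f p : cvgn (series (fun n => normc (T p n * f n))).
Proof.
have cf : cvgn (series (sqterm beta f)) by have := coefP f; rewrite inE.
apply: series_le_cvg (is_cvg_seriesD (@row_summable p) cf) => n /=; rewrite ?normc_ge0//.
  by rewrite addr_ge0 ?divr_ge0 ?sqr_ge0 ?sqterm_ge0.
rewrite -[leRHS]/(normc (T p n) ^+ 2 / beta n ^+ 2 + sqterm beta f n).
rewrite normcM /sqterm -exprVn -!exprMn.
have -> : normc (T p n) * normc (f n) =
  (normc (T p n) * (beta n)^-1) * (normc (f n) * beta n) by field; rewrite gt_eqF.
rewrite -subr_ge0; move: (normc (T p n) * _) (normc (f n) * _) => x y.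
have -> : x ^+ 2 + y ^+ 2 - x * y = (x - y) ^+ 2 / 2 + (x ^+ 2 + y ^+ 2) / 2 by field.
by rewrite addr_ge0 ?divr_ge0 ?sqr_ge0// addr_ge0 ?sqr_ge0.
Qed.

Let lim_coef f p := limn (fun N => \sum_(n < N) T p n * f n : C^o).

Let lim_coef_cvg f p :
  (\sum_(n < N) T p n * f n : C^o) @[N --> \oo] --> (lim_coef f p : C^o).
Proof.
have [l hl] := csummable (@mat_op_summable f p).
by rewrite /lim_coef (cvg_lim (@norm_hausdorff C C^o) hl).
Qed.

Let lim_coef_bound f P : \sum_(p < P) sqterm beta (lim_coef f) p <= M * rnorm f ^+ 2.
Proof.
(* With P fixed, the section bound passes to the limit in N; the bound so obtained is uniform in
   P. *)
have h : \sum_(p < P) normc (\sum_(n < N) T p n * f n) ^+ 2 * beta p ^+ 2 @[N --> \oo]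
    --> \sum_(p < P) sqterm beta (lim_coef f) p.
  apply: cvg_bigsum => p; apply: cvgMl; rewrite !expr2.
  have hp := cvg_normc (@lim_coef_cvg f p); exact: cvgM.
rewrite -(cvg_lim (@Rhausdorff R) h); apply: limr_le; first by apply/cvg_ex; eexists; exact: h.
apply: nearW => N; apply: le_trans (TM f P N) _.
by rewrite ler_wpM2l// rnorm_partial.
Qed.

Lemma mat_op_cvg f p :
  (\sum_(n < N) T p n * f n : C^o) @[N --> \oo] --> (mat_op T f p : C^o).
Proof. by rewrite (mkH2E _ (@lim_coef_bound f)); exact: lim_coef_cvg. Qed.

Lemma rnorm_mat_op f : rnorm (mat_op T f) <= Num.sqrt M * rnorm f.
Proof.
apply: rnorm_le => [|n]; first by rewrite mulr_ge0 ?sqrtr_ge0 ?rnorm_ge0.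
rewrite exprMn sqr_sqrtr//; apply: le_trans (@lim_coef_bound f n).
by rewrite le_eqVlt; apply/orP; left; apply/eqP; apply: eq_bigr => p _;
   rewrite /sqterm (mkH2E _ (@lim_coef_bound f)).
Qed.

Lemma mat_op_bounded : bounded_op (mat_op T).
Proof.
apply/bounded_opP; split; last first.
  by exists (Num.sqrt M); split=> [|f]; [exact: sqrtr_ge0|exact: rnorm_mat_op].
move=> c f g; apply: coef_inj => p; rewrite coefD coefZ.
apply: ccvg_unique (@mat_op_cvg _ p) _.
have -> : (fun N => \sum_(n < N) T p n * (c *: f + g) n : C^o) =
  (fun N => c * (\sum_(n < N) T p n * f n) + \sum_(n < N) T p n * g n : C^o).
  apply/funext => N; rewrite mulr_sumr -big_split /=; apply: eq_bigr => n _.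
  by rewrite [X in T p n * X](_ : _ = c * f n + g n) // mulrDr mulrCA.
by apply: cvgD; [apply: cvgMr|]; exact: mat_op_cvg.
Qed.

Lemma mat_op_delta n p : mat_op T (hdelta beta n) p = T p n.
Proof.
apply: ccvg_unique (@mat_op_cvg _ p) _.
apply: cvg_near_cst; near=> N.
have nN : (n < N)%N by near: N; exact: nbhs_infty_gt.
rewrite (bigD1 (Ordinal nN))//= hdeltaE /delta eqxx mulr1 big1 ?addr0// => i.
by rewrite -val_eqE /= hdeltaE /delta => /negbTE ->; rewrite mulr0.
Unshelve. all: by end_near. Qed.

End Bounded.
End MatrixOperators.

(** * The Wold decomposition of a Blaschke product *)

Section PeriodicTakenakaMalmquist.
Variable R : realType.
Local Notation C := R[i].

(** Bessel's inequality: pairing the resolution of the identity [TM_rows] with f writes |f|^2 as the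
    left side plus a sum of squares. *)
Lemma TM_contractive (s : nat -> C) : (forall k, normc (s k) < 1) -> contractive (TM s).
Proof.
move=> s1 f P N.
pose S (g : nat -> C) := \sum_(n < N) g n * f n.
have SE g : (normc (S g) ^+ 2)%:C =
    \sum_(n < N) \sum_(n' < N) g n * (g n')^*%C * (f n * (f n')^*%C).
  rewrite sqr_normcE /S rmorph_sum mulr_suml /=; apply: eq_bigr => n _.
  by rewrite mulr_sumr; apply: eq_bigr => n' _; rewrite rmorphM /=; ring.
suff e : \sum_(p < P) normc (S (TM s p)) ^+ 2 +
    \sum_(i < N) normc (S (PHI s P (delta R i))) ^+ 2 = \sum_(n < N) normc (f n) ^+ 2.
  by rewrite -e lerDl sumr_ge0// => i _; rewrite sqr_ge0.
apply: complexI; rewrite rmorphD /= !rmorph_sum /=.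
under eq_bigr do rewrite SE; under [X in _ + X]eq_bigr do rewrite SE.
rewrite exchange_big [X in _ + X]exchange_big -big_split /=; apply: eq_bigr => n _.
rewrite exchange_big [X in _ + X]exchange_big -big_split /=.
rewrite (bigD1 n)//= -!mulr_suml -mulrDl TM_rows// eqxx mul1r sqr_normcE.
rewrite big1 ?addr0// => n' nn'; rewrite -!mulr_suml -mulrDl TM_rows//.
by rewrite -val_eqE eq_sym /= in nn'; rewrite (negbTE nn') mul0r.
Qed.

Lemma sum_residues (V : nmodType) (F : nat -> V) m P :
  \sum_(q < P * m) F q = \sum_(j < m) \sum_(k < P) F (k * m + j)%N.
Proof.
rewrite exchange_big /=; elim: P => [|P IHP]; first by rewrite !big_ord0.
by rewrite big_ord_recr mulSnr big_split_ord /= IHP.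
Qed.

Lemma expr_small (r e : R) : 0 < r < 1 -> 0 < e -> exists c, r ^+ c <= e.
Proof.
move=> /andP[r0 r1] e0.
have : r ^+ n @[n --> \oo] --> (0 : R) by apply: cvg_expr; rewrite gtr0_norm.
move=> /cvgrPdist_le /(_ _ e0)[c _ hc]; exists c; have /= := hc c (leqnn c).
by rewrite sub0r normrN ger0_norm// exprn_ge0// ltW.
Qed.

(** With r the square root of q, half of the decay q^k = r^k r^k is kept. The other half, once k >=
    c n and r^c <= r / T, pays for T^n and leaves r^n. *)
Lemma decay_far (q T : R) : 0 < q < 1 -> 1 <= T -> exists c r,
  0 < r < 1 /\ forall k n, (c * n <= k)%N -> q ^+ k * T ^+ n <= r ^+ (n + k).
Proof.
move=> /andP[q0 q1] T1; have T0 : 0 < T by apply: lt_le_trans T1.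
pose r := Num.sqrt q.
have r0 : 0 < r by rewrite sqrtr_gt0.
have r1 : r < 1 by rewrite -sqrtr1 ltr_sqrt.
have [c hc] := @expr_small r (r / T) (introT andP (conj r0 r1)) (divr_gt0 r0 T0).
exists c, r; split=> [|k n cnk]; first by rewrite r0.
have -> : q ^+ k = r ^+ k * r ^+ k by rewrite -exprMn -expr2 sqr_sqrtr// ltW.
rewrite exprD mulrC mulrA ler_wpM2r ?exprn_ge0 ?(ltW r0)//.
apply: (@le_trans _ _ (T ^+ n * (r ^+ c) ^+ n)).
  by rewrite ler_wpM2l ?exprn_ge0 ?(ltW T0)// -exprM ler_wiXn2l ?(ltW r0) ?(ltW r1).
rewrite -exprMn; apply: lerXn2r; rewrite ?nnegrE ?mulr_ge0 ?exprn_ge0 ?(ltW T0) ?(ltW r0)//.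
by rewrite mulrC -ler_pdivlMr.
Qed.

Lemma expi_conj (t : R) : expi t * (expi t)^*%C = 1.
Proof. by rewrite mulcJ /= sqr_sqrtr ?addr_ge0 ?sqr_ge0// cos2Dsin2. Qed.

Lemma normc_expi (t : R) : normc (expi t) = 1.
Proof. by rewrite /= cos2Dsin2 sqrtr1. Qed.

Lemma normc_family_bound (m : nat) (a : 'I_m -> C) (c : R) : 0 < c ->
  (forall j, normc (a j) < c) -> exists al, 0 <= al < c /\ forall j, normc (a j) <= al.
Proof.
move=> c0 ac; exists (\big[Num.max/0]_j normc (a j)); split; last first.
  by move=> j; apply: le_bigmax.
by rewrite bigmax_ge_id /=; apply/bigmax_ltP.
Qed.

Variables (m : nat) (hm : (0 < m)%N) (theta : R) (a : 'I_m -> C).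
Hypothesis ha : forall j, normc (a j) < 1.

Definition periodic (p : nat) : C := a (Ordinal (ltn_pmod p hm)).

Lemma periodicD p : periodic (m + p)%N = periodic p.
Proof. by congr a; apply: val_inj; rewrite /= modnDl. Qed.

(** The Taylor coefficients of the Blaschke product, as [blaschke_eval] confirms. *)
Definition blaschke_coef (n : nat) : C := expi theta * PHI periodic m (delta R 0) n.

(* With B the Blaschke product and e_j = TM periodic j: the n-th coefficient of
   e_j B^k. *)
Definition wold (j k n : nat) : C := expi theta ^+ k * TM periodic (k * m + j) n.

(** Peeling the first m factors off the Takenaka-Malmquist function is division by B up to the
    unimodular constant, and by periodicity the remaining sequence of zeros is the original one. *)
Lemma wold_S j k n :
  wold j k.+1 n = \sum_(i < n.+1) wold j k i * blaschke_coef (n - i).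
Proof.
rewrite /wold mulSn -addnA /TM PHI_add.
have -> : (fun i => periodic (m + i)) = periodic by apply/funext => i; rewrite periodicD.
rewrite periodicD (toeplitzE _ _ (PHI_toeplitz _ _)) mulr_sumr; apply: eq_bigr => i _.
rewrite /blaschke_coef exprSr; ring.
Qed.

(** Up to unimodular factors these are some of the rows of the full Takenaka-Malmquist matrix. *)
Lemma wold_contractive j : (j < m)%N -> contractive (wold j).
Proof.
move=> jm f P N; have h := @TM_contractive periodic (fun k => ha _) f (P * m) N.
apply: le_trans h; rewrite (sum_residues (fun q => normc (\sum_(n < N) TM periodic q n * f n) ^+ 2)) (bigD1 (Ordinal jm))//= -[leLHS]addr0.
apply: lerD; last by do 2 apply: sumr_ge0 => ? _; rewrite sqr_ge0.
apply: ler_sum => k _; under eq_bigr do rewrite /wold -mulrA.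
by rewrite -mulr_sumr normcM normcX normc_expi expr1n mul1r.
Qed.

(** Above the cone (n large) [TM_growth] gives decay in n, below it (k large) [TM_decay] gives decay
    in k. In each case [decay_far] absorbs the growth in the other index. *)
Lemma wold_conic j : (j < m)%N -> conic (wold j).
Proof.
move=> jm; have [al [/andP[al0 al1] aal]] := normc_family_bound ltr01 ha.
have [q [T [q01 T1 hq]]] := @TM_decay R periodic al (fun k => aal _) al1.
have [t [L [t01 L1 ht]]] := @TM_growth R periodic al (fun k => aal _) al1.
have Lm1 : 1 <= L ^+ m by exact: exprn_ege1.
have L0 : 0 <= L by apply: le_trans L1.
have Lm0 : 0 <= L ^+ m by apply: exprn_ge0.
have /andP[q0 q1] := q01.
have [c1 [r1 [/andP[r10 r11] h1]]] := decay_far q01 T1.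
have [c2 [r2 [/andP[r20 r21] h2]]] := decay_far t01 Lm1.
exists (L ^+ m), (Num.max r1 r2), (maxn c1 c2); split=> //.
  by rewrite lt_max r10 gt_max r11.
move=> k n hkn.
have wE : normc (wold j k n) = normc (TM periodic (k * m + j) n).
  by rewrite /wold normcM normcX normc_expi expr1n mul1r.
rewrite wE; case/orP: hkn => hkn.
  apply: le_trans (ht _ _) _.
  (* The residue j costs at most L^m, because j < m and L >= 1. *)
  apply: (@le_trans _ _ (L ^+ m * (t ^+ n * (L ^+ m) ^+ k))).
    have -> : L ^+ m * (t ^+ n * (L ^+ m) ^+ k) = L ^+ (k * m + m) * t ^+ n.
      by rewrite exprD [(k * m)%N]mulnC exprM; ring.
    rewrite ler_wpM2r ?exprn_ge0//; first by case/andP: t01 => /ltW.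
    by rewrite ler_weXn2l// leq_add2l ltnW.
  rewrite ler_wpM2l//; apply: le_trans (h2 _ _ _) _.
    by rewrite -ltnS; apply: leq_ltn_trans hkn; rewrite leq_mul ?leq_maxr.
  rewrite addnC; apply: lerXn2r; rewrite ?nnegrE ?le_max ?(ltW r20) ?lexx ?orbT//.
apply: le_trans (hq _ _) _; rewrite -[leLHS]mul1r; apply: ler_pM => //.
  by rewrite mulr_ge0 ?exprn_ge0 ?(ltW q0)// (le_trans _ T1).
apply: (@le_trans _ _ (q ^+ k * T ^+ n)).
  rewrite ler_wpM2r ?exprn_ge0 ?(le_trans _ T1)// ler_wiXn2l ?(ltW q0) ?(ltW q1)//.
  by rewrite (leq_trans (leq_pmulr k hm))// leq_addr.
apply: le_trans (h1 _ _ _) _; first by rewrite -ltnS; apply: leq_ltn_trans hkn; rewrite leq_mul ?leq_maxl.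
by apply: lerXn2r; rewrite ?nnegrE ?le_max ?(ltW r10) ?lexx.
Qed.

Lemma wold_cols i j p q : (i < m)%N -> (j < m)%N ->
  (\sum_(n < N) wold i p n * (wold j q n)^*%C : C^o) @[N --> \oo] -->
  (((i == j) && (p == q))%:R : C^o).
Proof.
move=> im jm; have [al [/andP[al0 al1] aal]] := normc_family_bound ltr01 ha.
have h := @TM_cols R periodic al (p * m + i) (q * m + j) (fun k => aal _) al1.
have e : (p * m + i == q * m + j)%N = (i == j) && (p == q).
  apply/eqP/andP => [pq|[/eqP-> /eqP->]]//.
  have := congr1 (fun x => x %% m)%N pq; rewrite !modnMDl !modn_small// => ij.
  by move: pq; rewrite ij => /addIn/eqP; rewrite eqn_pmul2r// => ->.
pose d := expi theta ^+ p * (expi theta ^+ q)^*%C.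
have -> : ((i == j) && (p == q))%:R = d * ((i == j) && (p == q))%:R.
  case: andP => [[_ /eqP pq]|_]; last by rewrite mulr0.
  by rewrite /d pq rmorphXn /= -exprMn expi_conj expr1n mulr1.
have -> : (fun N => \sum_(n < N) wold i p n * (wold j q n)^*%C : C^o) =
    (fun N => d * (\sum_(n < N) TM periodic (p * m + i) n * (TM periodic (q * m + j) n)^*%C) : C^o).
  apply/funext => N; rewrite mulr_sumr; apply: eq_bigr => n _.
  by rewrite /wold /d rmorphM /=; ring.
by apply: cvgMr; rewrite e in h.
Qed.

(** Summing k < P over all residues gives the partial sum of [TM_parseval] at P m, a subsequence;
    the unimodular factors cancel. *)
Lemma wold_rows n n' :
  (\sum_(j < m) \sum_(k < P) (wold j k n')^*%C * wold j k n : C^o) @[P --> \oo] -->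
  ((n == n')%:R : C^o).
Proof.
have [al [/andP[al0 al1] aal]] := normc_family_bound ltr01 ha.
have h := @TM_parseval R periodic al n n' (fun k => aal _) al1.
have hP : (P * m)%N @[P --> \oo] --> \oo.
  exact: cvg_mulnr.
have -> : (fun P => \sum_(j < m) \sum_(k < P) (wold j k n')^*%C * wold j k n : C^o) =
   (fun P => \sum_(p < P * m) TM periodic p n * (TM periodic p n')^*%C : C^o).
  apply/funext => P; rewrite (sum_residues (fun p => TM periodic p n * (TM periodic p n')^*%C)).
  apply: eq_bigr => j _; apply: eq_bigr => k _.
  rewrite /wold rmorphM rmorphXn /= mulrCA mulrAC -mulrA mulrA -exprMn expi_conj.
  by rewrite expr1n mul1r mulrC.
exact: cvg_comp hP h.
Qed.

End PeriodicTakenakaMalmquist.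

Section DirectSum.
Variables (R : realType) (m : nat) (H : normedModType R[i]).

Definition dinj (j : 'I_m) (x : H) : dsum m H := fun i => if i == j then x else 0.

Lemma dsum_sumE (I : Type) (r : seq I) (F : I -> dsum m H) j :
  (\sum_(i <- r) F i) j = \sum_(i <- r) F i j.
Proof. by elim/big_rec2: _ => // i x y _ <-. Qed.

Lemma dsum_dinj (f : dsum m H) : f = \sum_j dinj j (f j).
Proof.
apply/funext => i; rewrite dsum_sumE (bigD1 i)//= /dinj eqxx big1 ?addr0// => j.
by rewrite eq_sym => /negbTE ->.
Qed.

Lemma dsum_combE (c : 'I_m -> R[i]) x j : (\sum_i c i *: dinj i x) j = c j *: x.
Proof.
rewrite dsum_sumE (bigD1 j)//= big1 ?addr0 => [|i ij].
  by rewrite -[LHS]/(c j *: dinj j x j) /dinj eqxx.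
by rewrite -[LHS]/(c i *: dinj i x j) /dinj eq_sym (negbTE ij) scaler0.
Qed.

Lemma rnorm_dsum (f : dsum m H) : rnorm f ^+ 2 = \sum_j rnorm (f j) ^+ 2.
Proof.
apply: complexI; rewrite rmorphXn /= -rnormE dsum_normP sqrtCK rmorph_sum.
by apply: eq_bigr => j _ /=; rewrite rnormE rmorphXn.
Qed.

Lemma dinj_bounded j : bounded_op (dinj j).
Proof.
apply/bounded_opP; split=> [c x y|].
  apply/funext => i; rewrite -[RHS]/(c *: dinj j x i + dinj j y i) /dinj.
  by case: eqP; rewrite ?scaler0 ?addr0.
exists 1; split=> // x; rewrite mul1r -(@ler_pXn2r _ 2) ?nnegrE ?rnorm_ge0//.
rewrite rnorm_dsum (bigD1 j)//= /dinj eqxx big1 ?addr0// => i /negbTE ->.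
by rewrite rnorm0 expr0n.
Qed.

Lemma dproj_bounded (j : 'I_m) : bounded_op (fun f : dsum m H => f j).
Proof.
apply/bounded_opP; split=> [//|]; exists 1; split=> // f.
rewrite mul1r -(@ler_pXn2r _ 2) ?nnegrE ?rnorm_ge0// rnorm_dsum (bigD1 j)//= lerDl.
by apply: sumr_ge0 => i _; rewrite sqr_ge0.
Qed.

End DirectSum.

(** * The operators that realize the similarity *)

Section Similarity.
Variables (R : realType) (beta : weight R).
Hypothesis hbeta : polynomial_growth beta.
Local Notation C := R[i].
Local Notation H2 := (H2 beta).
Variables (m : nat) (hm : (0 < m)%N) (theta : R) (a : 'I_m -> C).
Hypothesis ha : forall j, normc (a j) < 1.

Local Notation wold := (wold hm theta a).

Lemma wold_section_bound (j : 'I_m) :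
  exists M : R, 0 <= M /\ section_bound beta (wold j) M.
Proof.
apply: (conic_section_bound (wt_gt0 beta) (wt_near hbeta) (wt_exp hbeta)).
  exact: wold_contractive.
exact: wold_conic.
Qed.

Lemma wold_adj_section_bound (j : 'I_m) :
  exists M : R, 0 <= M /\ section_bound beta (adjoint (wold j)) M.
Proof.
apply: (conic_section_bound (wt_gt0 beta) (wt_near hbeta) (wt_exp hbeta)).
  by apply: contractive_adjoint; exact: wold_contractive.
by apply: conic_adjoint; exact: wold_conic.
Qed.

Lemma bshiftE (f : H2) k : bshift beta f k = f k.+1.
Proof. by []. Qed.

Lemma bshift_bounded : bounded_op (bshift beta).
Proof.
have [K [K0 hK]] := wt_geometric hbeta (ltr1n R 2).
apply/bounded_opP; split=> [c f g|]; first exact: coef_inj.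
exists (K * 2); split=> [|f]; first by rewrite mulr_ge0 ?(ltW K0).
apply: rnorm_le => [|n]; first by rewrite !mulr_ge0 ?(ltW K0) ?rnorm_ge0.
apply: (@le_trans _ _ (\sum_(k < n) (K * 2) ^+ 2 * sqterm beta f k.+1)).
  apply: ler_sum => k _; rewrite -[leLHS]/(normc (f k.+1) ^+ 2 * beta k ^+ 2).
  rewrite [leRHS]mulrCA ler_wpM2l ?sqr_ge0// -exprMn.
  apply: lerXn2r; rewrite ?nnegrE ?mulr_ge0 ?(ltW (wt_gt0 _ _)) ?(ltW K0)//.
  by have [_] := hK k 1%N; rewrite addn1 expr1.
rewrite -mulr_sumr [leRHS]exprMn ler_wpM2l ?sqr_ge0//.
apply: le_trans (rnorm_partial f n.+1).
by rewrite big_ord_recl lerDr sqterm_ge0.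
Qed.

Definition wold_op (j : 'I_m) : H2 -> H2 := mat_op (wold j).
(** Not the Hilbert adjoint in [H2 beta] but the operator of the conjugate transpose matrix, the
    adjoint for the unweighted pairing. *)
Definition wold_adj (j : 'I_m) : H2 -> H2 := mat_op (adjoint (wold j)).

Lemma wold_op_bounded j : bounded_op (wold_op j).
Proof. by have [M [M0 h]] := wold_section_bound j; apply: mat_op_bounded h. Qed.

Lemma wold_adj_bounded j : bounded_op (wold_adj j).
Proof. by have [M [M0 h]] := wold_adj_section_bound j; apply: mat_op_bounded h. Qed.

Lemma wold_op_delta j n p : wold_op j (hdelta beta n) p = wold j p n.
Proof. by have [M [M0 h]] := wold_section_bound j; exact: mat_op_delta h _ _. Qed.

Lemma wold_adj_delta j n p : wold_adj j (hdelta beta n) p = (wold j n p)^*%C.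
Proof. by have [M [M0 h]] := wold_adj_section_bound j; exact: mat_op_delta h _ _. Qed.

(** Orthonormality of the e_j B^k, read on monomials, where the product of the two matrices is the
    Gram matrix of [wold_cols]. *)
Lemma wold_op_adj i j f : wold_op i (wold_adj j f) = if i == j then f else 0.
Proof.
have bI : bounded_op (fun f : H2 => if i == j then f else 0).
  case: eqP => _; first exact: bounded_id.
  apply/bounded_opP; split=> [c x y|]; first by rewrite scaler0 addr0.
  by exists 0; split=> // x; rewrite rnorm0 mul0r.
apply: (bounded_ext (bounded_comp (wold_op_bounded i) (wold_adj_bounded j)) bI).
move=> q; apply: coef_inj => p /=.
have [M [M0 h]] := wold_section_bound i.
apply: ccvg_unique (mat_op_cvg M0 h (f := _) (p := p)) _.
under eq_cvg do under eq_bigr do rewrite wold_adj_delta.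
have -> : (if i == j then hdelta beta q else 0) p = ((i == j) && (p == q))%:R.
  by case: eqP => _; rewrite ?hdeltaE.
have := wold_cols hm theta ha (ltn_ord i) (ltn_ord j) (p := p) (q := q); rewrite val_eqE; exact.
Qed.

Lemma sum_wold_adj_op f : \sum_j wold_adj j (wold_op j f) = f.
Proof.
have bS : bounded_op (fun f : H2 => \sum_j wold_adj j (wold_op j f)).
  by apply: bounded_sum => j; apply: bounded_comp; [exact: wold_adj_bounded|exact: wold_op_bounded].
apply: (bounded_ext bS (bounded_id _)) => n; apply: coef_inj => n'.
rewrite coef_sum hdeltaE /delta eq_sym.
have h0 := wold_rows hm theta ha (n := n) (n' := n').
symmetry; apply: (@ccvg_unique _ _ _ _ h0).
have hj (j : 'I_m) : (\sum_(k < P) (wold j k n')^*%C * wold j k n : C^o) @[P --> \oo] -->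
    (wold_adj j (wold_op j (hdelta beta n)) n' : C^o).
  have [M [M0 h]] := wold_adj_section_bound j.
  have := mat_op_cvg M0 h (f := wold_op j (hdelta beta n)) (p := n').
  by under eq_cvg do under eq_bigr do rewrite wold_op_delta.
exact: (@cvg_bigsum _ C^o _ _ _ _ hj).
Qed.

(* This is B(S): see hol_calc_blaschke. *)
Definition blaschke_op (f : H2) : H2 := \sum_j wold_adj j (bshift beta (wold_op j f)).

Lemma blaschke_op_bounded : bounded_op blaschke_op.
Proof.
apply: bounded_sum => j; apply: (bounded_comp (wold_adj_bounded j)).
exact: bounded_comp bshift_bounded (wold_op_bounded j).
Qed.

Lemma wold_op_blaschke j f : wold_op j (blaschke_op f) = bshift beta (wold_op j f).
Proof.
have [lT _] := wold_op_bounded j.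
have -> : wold_op j (blaschke_op f) =
    \sum_i wold_op j (wold_adj i (bshift beta (wold_op i f))) by apply: linear_map_sum.
rewrite (bigD1 j) //= big1 => [|i ij]; rewrite wold_op_adj ?eqxx ?addr0//.
by rewrite eq_sym (negbTE ij).
Qed.

Lemma wold_op_inj f g : (forall j, wold_op j f = wold_op j g) -> f = g.
Proof.
move=> fg.
rewrite -(sum_wold_adj_op f).
rewrite -(sum_wold_adj_op g).
apply: eq_bigr => j _.
have -> := fg j; reflexivity.
Qed.

(** The transposed Toeplitz matrix of B. The operators [wold_op j] jointly separate vectors, and
    after applying them the identity becomes the recursion [wold_S]. *)
Lemma blaschke_op_delta n : blaschke_op (hdelta beta n) =
  \sum_(i < n.+1) blaschke_coef hm theta a (n - i) *: hdelta beta i.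
Proof.
apply: wold_op_inj => j; rewrite wold_op_blaschke.
have [lT _] := wold_op_bounded j.
transitivity (\sum_(i < n.+1)
    wold_op j (blaschke_coef hm theta a (n - i) *: hdelta beta i)); last first.
  by apply: esym; apply: linear_map_sum.
apply: coef_inj => k; rewrite coef_sum.
rewrite bshiftE [LHS]wold_op_delta wold_S.
by apply: eq_bigr => i _; rewrite linear_mapZ// coefZ wold_op_delta mulrC.
Qed.

End Similarity.

(** * Eigenvectors and bundles *)

Lemma scaler_subK (K : fieldType) (V : lmodType K) (h : K) (x y : V) : h != 0 ->
  h^-1 *: x - y = h^-1 *: (x - h *: y).
Proof. by move=> h0; rewrite scalerBr scalerA mulVf// scale1r. Qed.

Section BoundedTransport.
Variable R : realType.
Local Notation C := R[i].
Implicit Types (H K : normedModType C).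

Lemma cvg_rnorm H (T : Type) (F : set_system T) (FF : Filter F) (f : T -> H) (l : H) :
  rnorm (f x - l) @[x --> F] --> (0 : R) -> f x @[x --> F] --> l.
Proof.
move=> /cvgrPdist_lt h; apply/cvgrPdist_lt => e e0.
have [e1 ee] : exists e1, e = e1%:C by apply/complex_realP; rewrite gtr0_real.
move: e0; rewrite ee ltcR => e0.
apply: filterS (h _ e0) => x; rewrite sub0r normrN ger0_norm ?rnorm_ge0//.
by rewrite rnormE ltcR -rnormN opprB.
Qed.

Lemma rnorm_cvg H (T : Type) (F : set_system T) (FF : Filter F) (f : T -> H) (l : H) :
  f x @[x --> F] --> l -> rnorm (f x - l) @[x --> F] --> (0 : R).
Proof.
move=> /cvgrPdist_lt h; apply/cvgrPdist_lt => e e0.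
have ec : 0 < e%:C :> C by rewrite ltcR.
apply: filterS (h _ ec) => x; rewrite sub0r normrN ger0_norm ?rnorm_ge0//.
by rewrite rnormE ltcR -rnormN opprB.
Qed.

Lemma bounded_cvg H K (S : H -> K) (T : Type) (F : set_system T) (FF : Filter F)
    (f : T -> H) (l : H) :
  bounded_op S -> f x @[x --> F] --> l -> S (f x) @[x --> F] --> S l.
Proof.
move=> /bounded_opP[lS [M [M0 hM]]] /rnorm_cvg h; apply: cvg_rnorm.
have h0 : M * rnorm (f x - l) @[x --> F] --> (0 : R).
  by rewrite -(mulr0 M); exact: cvgMr.
apply: (squeeze_cvgr _ (cvg_cst 0) h0); near=> x.
by rewrite rnorm_ge0 -(linear_mapB _ _ lS) hM.
Unshelve. all: by end_near. Qed.

Lemma bounded_derivable H K (S : H -> K) (f : C^o -> H) (w : C^o) :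
  bounded_op S -> derivable f w 1 -> derivable (fun z => S (f z)) w 1.
Proof.
move=> bS /cvg_ex[l hl]; have [lS _] := bS; apply/cvg_ex; exists (S l).
have := bounded_cvg (dnbhs_filter (0 : C^o)) bS hl.
by under eq_cvg do rewrite (linear_mapZ _ _ lS) (linear_mapB _ _ lS).
Qed.

Lemma unit_disk_near (w0 : C) : unit_disk w0 -> \forall w \near (w0 : C^o), unit_disk w.
Proof.
rewrite /unit_disk /= => w01; have d0 : 0 < 1 - `|w0| by rewrite subr_gt0.
apply: filterS (nbhsx_ballx (w0 : C^o) _ d0) => w; rewrite -ball_normE /= => hw.
rewrite -(subrK w0 w); apply: le_lt_trans (ler_normD _ _) _.
by rewrite -ltrBrDr distrC.
Qed.

(** A holomorphic frame of the target, pulled back by the bounded map [Y], is one for the source. *)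
Lemma similar_transport H K (E : C -> set H) (E' : C -> set K) (X : H -> K) (Y : K -> H) :
  bounded_op X -> bounded_op Y -> cancel X Y -> cancel Y X ->
  (forall w, unit_disk w -> X @` E w = E' w) -> hol_bundle E' -> similar_bundles E E'.
Proof.
move=> bX bY XK YK XE hE'; split=> //; last by exists X, Y.
have [n hn] := hE'; exists n => w0 w0D; have [e he] := hn w0 w0D.
have [lX _] := bX; have [lY _] := bY.
exists (fun i w => Y (e i w)).
apply: filterS2 (unit_disk_near w0D) he => w wD [e1 e2 e3]; split.
- by move=> i; apply: bounded_derivable.
- have YE c : Y (\sum_i c i *: e i w) = \sum_i c i *: Y (e i w).
    by rewrite (linear_map_sum _ _ lY); apply: eq_bigr => i _; rewrite linear_mapZ.
  apply/seteqP; split=> x /=.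
    move=> Ex; have : E' w (X x) by rewrite -XE//; exists x.
    by rewrite e2 => -[c _ cx]; exists c => //; rewrite -YE cx XK.
  move=> [c _ <-]; rewrite -YE.
  have : E' w (\sum_i c i *: e i w) by rewrite e2; exists c.
  by rewrite -XE// => -[y Ey <-]; rewrite XK.
- move=> c hc; apply: e3; rewrite -[LHS]YK (linear_map_sum _ _ lY).
  under eq_bigr do rewrite linear_mapZ//.
  by rewrite hc linear_map0.
Qed.

End BoundedTransport.

(** * Holomorphic eigenvectors of the backward shift *)

Section KernelVectors.
Variables (R : realType) (beta : weight R).
Hypothesis hbeta : polynomial_growth beta.
Local Notation C := R[i].
Local Notation H2 := (H2 beta).

(** The weights grow more slowly than s^k for an s > 1 with t s < 1. One K serves all sequences, so
    the norm is linear in A; the remainder estimate of [kvec_derivable] relies on this. *)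
Lemma geometric_sqterm (t : R) : 0 <= t < 1 -> exists K : R, 0 <= K /\
  forall (f : nat -> C) A, 0 <= A -> (forall n, normc (f n) <= A * t ^+ n) ->
  forall N, \sum_(k < N) sqterm beta f k <= (A * K) ^+ 2.
Proof.
move=> /andP[t0 t1]; pose s := 2 / (1 + t); have d0 : 0 < 1 + t by rewrite ltr_pwDl.
have s1 : 1 < s by rewrite /s ltr_pdivlMr// mul1r; lra.
have s0 : 0 < s by rewrite (lt_trans _ s1).
pose r := t * s; have r0 : 0 <= r by rewrite mulr_ge0 ?(ltW s0).
have r1 : r < 1 by rewrite /r /s mulrA ltr_pdivrMr// mul1r; lra.
have [K [K0 hK]] := wt_geometric hbeta s1.
have r2 : r ^+ 2 < 1 by rewrite expr_lt1.
pose Q := (1 - r ^+ 2)^-1; have Q0 : 0 <= Q by rewrite invr_ge0 subr_ge0 ltW.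
exists (K * Num.sqrt Q); split=> [|f A A0 hf N]; first by rewrite mulr_ge0 ?sqrtr_ge0 ?(ltW K0).
rewrite mulrA exprMn sqr_sqrtr//.
apply: (@le_trans _ _ (\sum_(k < N) (A * K) ^+ 2 * (r ^+ 2) ^+ k)).
  apply: ler_sum => k _; rewrite /sqterm -exprM mulnC exprM -!exprMn.
  apply: lerXn2r; rewrite ?nnegrE ?mulr_ge0 ?normc_ge0 ?exprn_ge0 ?(ltW K0) ?(ltW (wt_gt0 _ _))//.
  have -> : A * K * r ^+ k = (A * t ^+ k) * (K * s ^+ k) by rewrite /r exprMn; ring.
  apply: ler_pM; rewrite ?normc_ge0 ?(ltW (wt_gt0 _ _))//.
  by have [+ _] := hK 0%N k; rewrite wt0 mulr1.
by rewrite -mulr_sumr ler_wpM2l ?sqr_ge0// sum_expr_le// sqr_ge0.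
Qed.

Definition kvec (w : C) : H2 := mkH2 beta (fun n => w ^+ n).

Lemma geometric_mkH2 (t A : R) (f : nat -> C) k : 0 <= t < 1 -> 0 <= A ->
  (forall n, normc (f n) <= A * t ^+ n) -> mkH2 beta f k = f k.
Proof.
by move=> t01 A0 hf; have [K [_ hK]] := geometric_sqterm t01; exact: mkH2E (hK f A A0 hf).
Qed.

Lemma normc_unit_disk (w : C) : unit_disk w <-> normc w < 1.
Proof. by rewrite /unit_disk /= normcE_real -[1]/(1%:C) ltcR. Qed.

Lemma kvecE w k : normc w < 1 -> kvec w k = w ^+ k.
Proof.
move=> w1; apply: (@geometric_mkH2 (normc w) 1); rewrite ?normc_ge0// => n.
by rewrite normcX mul1r.
Qed.

Lemma bshift_kvec w : normc w < 1 -> bshift beta (kvec w) = w *: kvec w.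
Proof. by move=> w1; apply: coef_inj => k; rewrite bshiftE coefZ !kvecE// exprS. Qed.

Lemma bshift_eigen w (f : H2) : normc w < 1 -> bshift beta f = w *: f ->
  f = f 0%N *: kvec w.
Proof.
move=> w1 fw; apply: coef_inj => k; rewrite coefZ kvecE//.
elim: k => [|k IHk]; first by rewrite expr0 mulr1.
by rewrite -bshiftE fw coefZ IHk exprS; ring.
Qed.

(** The candidate derivative has coefficients n w^(n - 1). The Taylor remainder is bounded
    coefficientwise by |h|^2 times a geometric sequence, hence in norm. *)
Lemma kvec_derivable (w : C) : normc w < 1 -> derivable (kvec : C^o -> H2) w 1.
Proof.
move=> w1; have w0 := normc_ge0 w.
pose r := (1 + normc w) / 2; pose t := (1 + r) / 2.
have wr : normc w < r by rewrite /r; lra.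
have r1 : r < 1 by rewrite /r; lra.
have rt : r < t by rewrite /t; lra.
have t1 : t < 1 by rewrite /t; lra.
have r0 : 0 <= r by lra.
have t0 : 0 <= t by lra.
(* This c solves r c + 1 = t c, which closes both inductions below. *)
pose c := (t - r)^-1; have c0 : 0 <= c by rewrite invr_ge0 subr_ge0 ltW.
have ctr : c * (t - r) = 1 by rewrite mulVf// gt_eqF// subr_gt0.
have rtn n : r ^+ n <= t ^+ n by apply: lerXn2r; rewrite ?nnegrE// ltW.
pose e n : C := n%:R * w ^+ n.-1.
have eS n : e n.+1 = w * e n + w ^+ n.
  by case: n => [|n]; rewrite /e /= ?expr0 ?exprS -?natr1; ring.
have eb n : normc (e n) <= c * t ^+ n.
  elim: n => [|n IHn]; first by rewrite /e mul0r normc0 mulr1.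
  rewrite eS; apply: le_trans (le_normcD _ _) _; rewrite normcM normcX.
  apply: (@le_trans _ _ (r * (c * t ^+ n) + t ^+ n)).
    apply: lerD; first by apply: ler_pM; rewrite ?normc_ge0// ltW.
    by apply: le_trans (rtn n); apply: lerXn2r; rewrite ?nnegrE// ltW.
  rewrite le_eqVlt; apply/orP; left; apply/eqP; rewrite [t ^+ n.+1]exprS.
  by rewrite -[X in _ + X](mul1r) -ctr; ring.
(* The remainder d_n satisfies d_(n+1) = (w + h) d_n + h^2 e_n, the recursion of [e] with a source
   term; hence the second factor c. *)
have db (h : C) n : normc (w + h) <= r ->
    normc ((w + h) ^+ n - w ^+ n - h * e n) <= normc h ^+ 2 * c ^+ 2 * t ^+ n.
  move=> hr; elim: n => [|n IHn].
    by rewrite /e mul0r mulr0 !expr0 subrr subr0 normc0 mulr1 mulr_ge0 ?sqr_ge0.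
  have -> : (w + h) ^+ n.+1 - w ^+ n.+1 - h * e n.+1 =
    (w + h) * ((w + h) ^+ n - w ^+ n - h * e n) + h ^+ 2 * e n by rewrite eS !exprS; ring.
  apply: le_trans (le_normcD _ _) _; rewrite normcM [X in _ + X]normcM normcX.
  apply: (@le_trans _ _ (r * (normc h ^+ 2 * c ^+ 2 * t ^+ n) + normc h ^+ 2 * (c * t ^+ n))).
    by apply: lerD; [apply: ler_pM; rewrite ?normc_ge0|rewrite ler_wpM2l ?sqr_ge0].
  rewrite le_eqVlt; apply/orP; left; apply/eqP; rewrite [t ^+ n.+1]exprS.
  have -> : normc h ^+ 2 * (c * t ^+ n) = c * (t - r) * (normc h ^+ 2 * (c * t ^+ n)).
    by rewrite ctr mul1r.
  ring.
have t01 : 0 <= t < 1 by rewrite t0.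
have [K [K0 hK]] := geometric_sqterm t01.
have [D DE] : exists D : H2, forall k, D k = e k.
  by exists (mkH2 beta e) => k; apply: (geometric_mkH2 _ t01 c0).
have rem (h : C) : normc (w + h) <= r ->
    rnorm (kvec (w + h) - kvec w - h *: D) <= normc h ^+ 2 * c ^+ 2 * K.
  move=> hr; apply: rnorm_le => [|N]; first by rewrite mulr_ge0// mulr_ge0 ?sqr_ge0.
  apply: hK => [|n]; first by rewrite mulr_ge0 ?sqr_ge0.
  have := db h n hr; rewrite -(kvecE n (le_lt_trans hr r1)) -(kvecE n w1) -DE.
  by move: (kvec (w + h)) (kvec w) => u v; rewrite !coefB coefZ.
apply/cvg_ex; exists D; apply: cvg_rnorm.
have h0 : c ^+ 2 * K * rnorm (h : C^o) @[h --> (0 : C^o)^'] --> (0 : R).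
  rewrite -(mulr0 (c ^+ 2 * K)); apply: cvgMr.
  apply: cvg_within_filter.
  have := rnorm_cvg (nbhs_filter (0 : C^o)) (@cvg_id _ (nbhs (0 : C^o))).
  by rewrite (_ : (fun x => rnorm (x - 0)) = @rnorm R C^o)//; apply/funext => x; rewrite subr0.
apply: (squeeze_cvgr _ (cvg_cst 0) h0).
have d0 : 0 < (r - normc w)%:C :> C by rewrite ltcR subr_gt0.
near=> h; rewrite rnorm_ge0 /=.
have hn0 : h != 0 by near: h; exact: nbhs_dnbhs_neq.
have hr : normc (w + h) <= r.
  apply: le_trans (le_normcD _ _) _; rewrite -lerBrDl -lecR -normcE_real ltW//.
  near: h; apply: nbhs_dnbhs; apply: filterS (nbhsx_ballx (0 : C^o) _ d0) => h.
  by rewrite -ball_normE /= sub0r normrN.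
have hw : h *: (1 : C^o) + (w : C^o) = ((w : C) + (h : C) : C) by rewrite addrC; congr (_ + _); exact: mulr1.
rewrite hw scaler_subK//.
rewrite rnormZ normcV.
suff : rnorm (kvec ((w : C) + (h : C)) - kvec w - h *: D) <= normc h ^+ 2 * c ^+ 2 * K.
  move=> hle; rewrite rnormC.
  have nh0 : 0 < normc h.
    by rewrite lt_def normc_ge0 andbT; apply: contra hn0 => /eqP/eq0_normc->.
  by rewrite mulrC ler_pdivrMr//; apply: le_trans hle _; rewrite le_eqVlt;
     apply/orP; left; apply/eqP; ring.
exact: rem.
Unshelve. all: by end_near. Qed.

Lemma dsum_ker_hol_bundle m : hol_bundle (dsum_bundle m (ker_bundle (bshift beta))).
Proof.
exists m => w0 w0D; exists (fun i w => dinj i (kvec w)).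
apply: filterS (unit_disk_near w0D) => w /normc_unit_disk w1; split.
- move=> i; exact: (bounded_derivable (f := kvec) (dinj_bounded H2 i) (kvec_derivable w1)).
- apply/seteqP; split=> f /=.
    move=> hf; exists (fun j => f j 0%N) => //; rewrite [RHS]dsum_dinj.
    apply: eq_bigr => j _; have [lj _] := dinj_bounded H2 j.
    by rewrite -linear_mapZ// -bshift_eigen//; apply/eqP; rewrite -subr_eq0; apply/eqP; exact: hf.
  move=> [c _ <-] j; rewrite dsum_combE /ker_bundle /=.
  have -> : bshift beta (c j *: kvec w) = c j *: bshift beta (kvec w) by exact: coef_inj.
  by rewrite bshift_kvec// !scalerA mulrC subrr.
move=> c hc j; have : c j *: kvec w = 0 by rewrite -dsum_combE hc.
move=> /(congr1 (fun f : H2 => f 0%N)); rewrite coefZ kvecE// expr0 mulr1; exact.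
Qed.

Lemma blaschke_op_similar m (hm : (0 < m)%N) (theta : R) (a : 'I_m -> C) :
  (forall j, normc (a j) < 1) ->
  similar_bundles (ker_bundle (blaschke_op hm theta a : H2 -> H2))
    (dsum_bundle m (ker_bundle (bshift beta))).
Proof.
move=> ha.
pose X (f : H2) : dsum m H2 := fun j => wold_op hm theta a j f.
pose Y (g : dsum m H2) : H2 := \sum_j wold_adj hm theta a j (g j).
have XE f : X f = \sum_j dinj j (wold_op hm theta a j f) by rewrite [LHS]dsum_dinj.
have XK : cancel X Y by move=> f; exact: sum_wold_adj_op.
have YK : cancel Y X.
  move=> g; apply/funext => i; rewrite /X /Y.
  have [li _] := wold_op_bounded hbeta hm theta ha i.
  rewrite (linear_map_sum _ _ li) (bigD1 i)//= big1 => [|j ji]; rewrite wold_op_adj// ?eqxx ?addr0//.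
  by rewrite eq_sym (negbTE ji).
apply: (similar_transport _ _ XK YK).
- have -> : X = (fun f => \sum_j dinj j (wold_op hm theta a j f)) by apply/funext.
  apply: bounded_sum => j.
  exact: bounded_comp (dinj_bounded _ j) (wold_op_bounded hbeta hm theta ha j).
- apply: bounded_sum => j.
  exact: bounded_comp (wold_adj_bounded hbeta hm theta ha j) (dproj_bounded _ j).
- move=> w wD; apply/seteqP; split=> [_ [f hf <-] j|g hg].
    have [lj _] := wold_op_bounded hbeta hm theta ha j.
    rewrite /ker_bundle /= /X -wold_op_blaschke// -linear_mapZ// -linear_mapB//.
    by rewrite (_ : _ - _ = 0)// linear_map0.
  exists (Y g); last exact: YK.
  suff e : blaschke_op hm theta a (Y g) = w *: Y g by rewrite /ker_bundle /= e subrr.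
  apply: (@wold_op_inj _ _ hbeta _ hm theta _ ha) => j.
  have [lj _] := wold_op_bounded hbeta hm theta ha j.
  rewrite wold_op_blaschke// linear_mapZ//.
  have -> : wold_op hm theta a j (Y g) = g j by rewrite -[LHS]/(X (Y g) j) YK.
  by apply/eqP; rewrite -subr_eq0; apply/eqP; exact: hg.
- exact: dsum_ker_hol_bundle.
Qed.

End KernelVectors.

(** * Integrals over the circle *)

Section CircleIntegrals.
Variable R : realType.
Local Notation C := R[i].
Local Notation mu := (@lebesgue_measure R).

Section RealIntegrals.
Variables (a b : R).
Let D : set R := `[a, b]%classic.

Lemma integrable_continuous (f : R -> R) : continuous f ->
  mu.-integrable D (EFin \o f).
Proof.
move=> cf; apply: continuous_compact_integrable; first exact: segment_compact.
exact: continuous_subspaceT.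
Qed.

Lemma Rintegral_cvg (f_ : nat -> R -> R) (f : R -> R) (K : R) :
  (forall n, mu.-integrable D (EFin \o f_ n)) ->
  (forall n t, `|f_ n t| <= K) -> (forall t, f_ n t @[n --> \oo] --> f t) ->
  mu.-integrable D (EFin \o f) /\
  \int[mu]_(t in D) f_ n t @[n --> \oo] --> \int[mu]_(t in D) f t.
Proof.
move=> if_ fK ff.
have mD : measurable D by exact: measurable_itv.
have fE t : (f_ n t)%:E @[n --> \oo] --> (f t)%:E.
  by apply: cvg_EFin; [exact: nearW|exact: ff].
have mf : measurable_fun D (EFin \o f).
  apply: (@emeasurable_fun_cvg _ _ _ _ (fun n => EFin \o f_ n)) => [n|t _]; last exact: fE.
  exact: measurable_int (if_ n).
have iK : mu.-integrable D (EFin \o cst K) by apply: integrable_continuous; exact: cst_continuous.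
have [|||||h1 _ h2] := @dominated_convergence _ _ _ mu D mD
  (fun n => EFin \o f_ n) (EFin \o f) (EFin \o cst K).
- by move=> n; exact: measurable_int (if_ n).
- exact: mf.
- by apply: aeW => x _; exact: fE.
- exact: iK.
- by apply: aeW => x n _ /=; rewrite lee_fin.
split=> //; apply: fine_cvg; rewrite fineK; first exact: h2.
exact: integrable_fin_num.
Qed.

Lemma Rintegral_cos (c : R) : c != 0 -> a < b ->
  \int[mu]_(t in `[a, b]) cos (c * t) = (sin (c * b) - sin (c * a)) / c.
Proof.
move=> c0 ab; pose F t := sin (c * t) / c.
have dF (x : R) : is_derive x 1 F (cos (c * x)).
  have h1 : is_derive x 1 (c \*: (@id R)) (c *: 1) by apply: is_deriveZ.
  have h2 := is_derive1_comp (is_derive_sin (c * x)) h1.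
  have := is_deriveZ c^-1 h2; rewrite /F.
  rewrite (_ : c^-1 \*: _ = fun t => sin (c * t) / c); last first.
    by apply/funext => t; rewrite [RHS]mulrC.
  move=> /is_derive_eq; apply; rewrite -[LHS]/(c^-1 * (cos (c * x) * (c * 1))); by field.
have cF : continuous F.
  by move=> x; apply/differentiable_continuous/derivable1_diffP; exact: ex_derive.
have cc : continuous (fun t => cos (c * t)).
  move=> x; apply: continuous_comp; last exact: continuous_cos.
  exact: mulrl_continuous.
rewrite /Rintegral (@continuous_FTC2 _ _ F)//.
- by rewrite /= -mulrBl.
- exact: continuous_subspaceT.
- split; first by move=> x _; exact: ex_derive.
    by apply: cvg_at_right_filter; exact: cF.
  by apply: cvg_at_left_filter; exact: cF.
- by move=> x _; rewrite derive1E; exact: derive_val.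
Qed.

Lemma Rintegral_sin (c : R) : c != 0 -> a < b ->
  \int[mu]_(t in `[a, b]) sin (c * t) = (cos (c * a) - cos (c * b)) / c.
Proof.
move=> c0 ab; pose F t := - cos (c * t) / c.
have dF (x : R) : is_derive x 1 F (sin (c * x)).
  have h1 : is_derive x 1 (c \*: (@id R)) (c *: 1) by apply: is_deriveZ.
  have h2 := is_derive1_comp (is_derive_cos (c * x)) h1.
  have := is_deriveZ (- c^-1) h2; rewrite /F.
  rewrite (_ : - c^-1 \*: _ = fun t => - cos (c * t) / c); last first.
    by apply/funext => t; rewrite [RHS]mulNr -[RHS]mulrN [RHS]mulrC.
  move=> /is_derive_eq; apply.
  rewrite -[LHS]/(- c^-1 * (- sin (c * x) * (c * 1))); by field.
have cF : continuous F.
  by move=> x; apply/differentiable_continuous/derivable1_diffP; exact: ex_derive.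
have cc : continuous (fun t => sin (c * t)).
  move=> x; apply: continuous_comp; last exact: continuous_sin.
  exact: mulrl_continuous.
rewrite /Rintegral (@continuous_FTC2 _ _ F)//.
- by rewrite /= /F; field.
- exact: continuous_subspaceT.
- split; first by move=> x _; exact: ex_derive.
    by apply: cvg_at_right_filter; exact: cF.
  by apply: cvg_at_left_filter; exact: cF.
- by move=> x _; rewrite derive1E; exact: derive_val.
Qed.

End RealIntegrals.

Let D : set R := `[0, 2 * pi]%classic.

(** Proved along with each value below, since the computations add and rescale integrals. *)
Definition cintegrable (F : R -> C) : Prop :=
  mu.-integrable D (EFin \o (fun t => complex.Re (F t))) /\
  mu.-integrable D (EFin \o (fun t => complex.Im (F t))).

Local Notation cint := (cintegral 0 (2 * pi)).

Let mD : measurable D. Proof. exact: measurable_itv. Qed.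

Lemma cintegrable_add F G : cintegrable F -> cintegrable G ->
  cintegrable (fun t => F t + G t) /\ cint (fun t => F t + G t) = cint F + cint G.
Proof.
move=> [F1 F2] [G1 G2].
have ReE t : complex.Re (F t + G t) = complex.Re (F t) + complex.Re (G t).
  by case: (F t) => ? ?; case: (G t).
have ImE t : complex.Im (F t + G t) = complex.Im (F t) + complex.Im (G t).
  by case: (F t) => ? ?; case: (G t).
split; last first.
  rewrite /cintegral; under eq_Rintegral do rewrite ReE.
  by under [X in _ +i* X]eq_Rintegral do rewrite ImE; rewrite !RintegralD.
split.
  have -> : EFin \o (fun t => complex.Re (F t + G t)) =
    (EFin \o (fun t => complex.Re (F t))) \+ (EFin \o (fun t => complex.Re (G t))).
    by apply/funext => t /=; rewrite ReE EFinD.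
  exact: integrableD.
have -> : EFin \o (fun t => complex.Im (F t + G t)) =
  (EFin \o (fun t => complex.Im (F t))) \+ (EFin \o (fun t => complex.Im (G t))).
  by apply/funext => t /=; rewrite ImE EFinD.
exact: integrableD.
Qed.

Lemma cintegrable_scale c F : cintegrable F ->
  cintegrable (fun t => c * F t) /\ cint (fun t => c * F t) = c * cint F.
Proof.
move=> [F1 F2]; case: c => x y.
have ReE t : complex.Re ((x +i* y) * F t) = x * complex.Re (F t) + - y * complex.Im (F t).
  by case: (F t) => ? ? /=; rewrite mulNr.
have ImE t : complex.Im ((x +i* y) * F t) = x * complex.Im (F t) + y * complex.Re (F t).
  by case: (F t) => ? ? /=.
have iZ c f : mu.-integrable D (EFin \o f) -> mu.-integrable D (EFin \o (fun t => c * f t)).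
  move=> h; have -> : EFin \o (fun t => c * f t) = (fun t => c%:E * (EFin \o f) t)%E.
    by apply/funext => t /=; rewrite EFinM.
  exact: integrableZl.
split; last first.
  rewrite /cintegral; under eq_Rintegral do rewrite ReE.
  under [X in _ +i* X]eq_Rintegral do rewrite ImE.
  by rewrite !RintegralD ?RintegralZl//; try exact: iZ; rewrite /= mulNr.
split.
  have -> : EFin \o (fun t => complex.Re ((x +i* y) * F t)) =
    (EFin \o (fun t => x * complex.Re (F t))) \+ (EFin \o (fun t => - y * complex.Im (F t))).
    by apply/funext => t /=; rewrite ReE EFinD.
  by apply: integrableD => //; exact: iZ.
have -> : EFin \o (fun t => complex.Im ((x +i* y) * F t)) =
  (EFin \o (fun t => x * complex.Im (F t))) \+ (EFin \o (fun t => y * complex.Re (F t))).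
  by apply/funext => t /=; rewrite ImE EFinD.
by apply: integrableD => //; exact: iZ.
Qed.

Lemma cintegrable0 : cintegrable (fun=> 0) /\ cint (fun=> 0 : C) = 0.
Proof.
have i0 : cintegrable (fun=> 0) by split; apply: integrable_continuous; exact: cst_continuous.
have [_ e] := cintegrable_scale 0 i0; split=> //; rewrite -[RHS](mul0r (cint (fun=> 0))) -e.
by congr (cint _); apply/funext => t; rewrite mul0r.
Qed.

Lemma cintegrable_sum (I : Type) (r : seq I) (F : I -> R -> C) :
  (forall i, cintegrable (F i)) ->
  cintegrable (fun t => \sum_(i <- r) F i t) /\
  cint (fun t => \sum_(i <- r) F i t) = \sum_(i <- r) cint (F i).
Proof.
move=> hF; elim: r => [|i r [IH1 IH2]].
  rewrite big_nil; under eq_fun do rewrite big_nil; exact: cintegrable0.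
rewrite big_cons; under eq_fun do rewrite big_cons.
by rewrite -IH2; exact: cintegrable_add.
Qed.

Lemma cintegral_cvg (F_ : nat -> R -> C) F K : (forall n, cintegrable (F_ n)) ->
  (forall n t, normc (F_ n t) <= K) ->
  (forall t, (F_ n t : C^o) @[n --> \oo] --> (F t : C^o)) ->
  cintegrable F /\ (cint (F_ n) : C^o) @[n --> \oo] --> (cint F : C^o).
Proof.
move=> iF FK FF.
have ReN (z : C) : `|complex.Re z| <= normc z.
  by rewrite -lecR -normcE_real; exact: normc_ge_Re.
have ImN (z : C) : `|complex.Im z| <= normc z.
  case: z => x y /=; rewrite -sqrtr_sqr; apply: ler_wsqrtr; by rewrite lerDr sqr_ge0.
have ReC t : complex.Re (F_ n t) @[n --> \oo] --> complex.Re (F t).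
  have /ccvgP h := FF t; apply/cvgrPdist_le => e e0.
  move/cvgrPdist_le : h => /(_ _ e0); apply: filterS => n.
  rewrite sub0r normrN ger0_norm ?normc_ge0// normc_distC; apply: le_trans.
  by apply: le_trans (ReN _); case: (F t) => ? ?; case: (F_ n t).
have ImC t : complex.Im (F_ n t) @[n --> \oo] --> complex.Im (F t).
  have /ccvgP h := FF t; apply/cvgrPdist_le => e e0.
  move/cvgrPdist_le : h => /(_ _ e0); apply: filterS => n.
  rewrite sub0r normrN ger0_norm ?normc_ge0// normc_distC; apply: le_trans.
  by apply: le_trans (ImN _); case: (F t) => ? ?; case: (F_ n t).
have [i1 c1] := Rintegral_cvg (fun n => (iF n).1)
  (fun n t => le_trans (ReN _) (FK n t)) ReC.
have [i2 c2] := Rintegral_cvg (fun n => (iF n).2)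
  (fun n t => le_trans (ImN _) (FK n t)) ImC.
split=> //; rewrite [X in _ --> X]complexE /=.
have -> : (fun n => cint (F_ n) : C^o) = (fun n =>
    ((complex.Re (cint (F_ n)))%:C : C^o) + 'i%C * ((complex.Im (cint (F_ n)))%:C : C^o)).
  by apply/funext => n; rewrite [LHS]complexE.
apply: cvgD; first exact: cvg_real_complex.
by apply: cvgMr; exact: cvg_real_complex.
Qed.

Lemma expiD (x y : R) : expi (x + y) = expi x * expi y.
Proof. by rewrite /expi cosD sinD; congr (_ +i* _); rewrite addrC [cos x * _]mulrC [sin x * _]mulrC. Qed.

Lemma expi0 : expi 0 = 1 :> C.
Proof. by rewrite /expi cos0 sin0. Qed.

Lemma expi_natM (n : nat) (x : R) : expi (n%:R * x) = expi x ^+ n.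
Proof.
elim: n => [|n IHn]; first by rewrite mul0r expi0.
by rewrite -natr1 mulrDl mul1r expiD IHn exprSr.
Qed.

Lemma expiN (x : R) : expi (- x) = (expi x)^-1.
Proof.
have e : expi x * expi (- x) = 1 by rewrite -expiD subrr expi0.
have x0 : expi x != 0 by apply: contra_eq_neq e => ->; rewrite mul0r eq_sym oner_eq0.
by apply: (mulfI x0); rewrite e divff.
Qed.

Lemma expi_2pi : expi (2 * pi) = 1 :> C.
Proof. by rewrite /expi mulr_natl cos2pi sin2pi. Qed.

Lemma cintegral_expi (k l : nat) :
  cintegrable (fun t => expi t ^+ k * (expi t)^-1 ^+ l) /\
  cint (fun t : R => expi t ^+ k * (expi t)^-1 ^+ l) = (2 * pi)%:C * (k == l)%:R.
Proof.
pose c : R := k%:R - l%:R.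
have -> : (fun t : R => expi t ^+ k * (expi t)^-1 ^+ l) = (fun t => expi (c * t)).
  apply/funext => t; rewrite /c mulrBl expiD -mulrN !expi_natM expiN.
  by [].
have cc : continuous (fun t : R => cos (c * t)).
  by move=> x; apply: continuous_comp; [exact: mulrl_continuous|exact: continuous_cos].
have cs : continuous (fun t : R => sin (c * t)).
  by move=> x; apply: continuous_comp; [exact: mulrl_continuous|exact: continuous_sin].
split; first by split; exact: integrable_continuous.
have pi2 : 0 < 2 * pi :> R by rewrite mulr_gt0// pi_gt0.
have [kl|kl] := eqVneq k l.
  rewrite mulr1 /cintegral /= /c kl subrr.
  under eq_Rintegral do rewrite mul0r cos0.
  under [X in _ +i* X]eq_Rintegral do rewrite mul0r sin0.
  rewrite !Rintegral_cst//= lebesgue_measure_itv/= lte_fin pi2 mul1r mul0r.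
  by rewrite -EFinB /= subr0.
have c0 : c != 0 by rewrite subr_eq0 eqr_nat.
(* c is a difference of integers, so the primitives take equal values at both endpoints. *)
have e : expi (c * (2 * pi)) = 1 :> C.
  by rewrite /c mulrBl expiD -mulrN expi_natM expi_2pi expr1n expi_natM expiN expi_2pi invr1 expr1n mulr1.
case: e => e1 e2.
rewrite mulr0 /cintegral /= Rintegral_cos// Rintegral_sin//.
by rewrite e1 e2 !mulr0 cos0 sin0 !subrr !mul0r.
Qed.

End CircleIntegrals.

(** * Power series of a Blaschke product *)

Section BlaschkeSeries.
Variable R : realType.
Local Notation C := R[i].

(* Telescoping: with g = f / (1 - abar z), sum_(n <= N) f_n z^n and
   sum_(n <= N) (phi f)_n z^n are (1 - abar z) and (a - z) times
   sum_(n <= N) g_n z^n, up to a term tending to 0. *)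
Lemma phi_eval (a z : C) (f : nat -> C) (A t : R) (l : C) : 0 <= A ->
  normc a < t -> normc z * t < 1 -> (forall n, normc (f n) <= A * t ^+ n) ->
  (\sum_(n < N) f n * z ^+ n : C^o) @[N --> \oo] --> (l : C^o) ->
  (\sum_(n < N) phi a f n * z ^+ n : C^o) @[N --> \oo] -->
    ((a - z) / (1 - a^*%C * z) * l : C^o).
Proof.
move=> A0 at1 zt hf hl.
have a0 := normc_ge0 a; have z0 := normc_ge0 z.
have t0 : 0 <= t by rewrite (le_trans a0)// ltW.
have az : normc (a^*%C * z) < 1.
  rewrite normcM normc_conj; apply: le_lt_trans zt.
  by rewrite mulrC ler_wpM2l// ltW.
have d0 : 1 - a^*%C * z != 0.
  apply: contraTneq az => /eqP; rewrite subr_eq0 => /eqP <-.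
  by rewrite normc1 ltxx.
have gb := geo_bound A0 (lexx _) at1 hf.
set B := A * _ in gb.
have B0 : 0 <= B by rewrite mulr_ge0// divr_ge0// subr_ge0 ltW.
pose G N := \sum_(n < N.+1) geo a f n * z ^+ n.
pose e N := z ^+ N.+1 * geo a f N.
have fE N : \sum_(n < N.+1) f n * z ^+ n = (1 - a^*%C * z) * G N + a^*%C * e N.
  rewrite /G /e; elim: N => [|N IHN].
    by rewrite !big_ord_recl !big_ord0 /= expr0 expr1; ring.
  rewrite big_ord_recr IHN [in RHS]big_ord_recr /= !exprS; ring.
have phiE N : \sum_(n < N.+1) phi a f n * z ^+ n = (a - z) * G N + e N.
  rewrite /G /e; elim: N => [|N IHN].
    by rewrite !big_ord_recl !big_ord0 /phi /= expr0 expr1; ring.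
  rewrite big_ord_recr IHN [in RHS]big_ord_recr /phi /= !exprS; ring.
have e0 : (e N : C^o) @[N --> \oo] --> (0 : C^o).
  apply: (@ccvg_le _ _ _ (fun N => normc z * B * (normc z * t) ^+ N)); last first.
    by apply: cvg_cgeometric; rewrite mulr_ge0.
  move=> N; rewrite subr0 /e normcM normcX exprS exprMn.
  have -> : normc z * B * (normc z ^+ N * t ^+ N) = normc z * normc z ^+ N * (B * t ^+ N) by ring.
  by rewrite ler_wpM2l// mulr_ge0// exprn_ge0.
have hl1 : (\sum_(n < N.+1) f n * z ^+ n : C^o) @[N --> \oo] --> (l : C^o).
  by rewrite -cvg_shiftS in hl.
rewrite -cvg_shiftS /=.
have -> : (fun N => \sum_(n < N.+1) phi a f n * z ^+ n : C^o) = (fun N =>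
    (a - z) / (1 - a^*%C * z) * (\sum_(n < N.+1) f n * z ^+ n)
    + (1 - (a - z) / (1 - a^*%C * z) * a^*%C) * e N : C^o).
  by apply/funext => N; rewrite phiE fE; field.
rewrite -[(a - z) / (1 - a^*%C * z) * l]addr0; apply: cvgD; first by apply: cvgMr.
exact: ccvgMr0.
Qed.

Lemma PHI_eval (s : nat -> C) (al t : R) (z : C) P : (forall k, normc (s k) <= al) ->
  al < 1 -> al < t -> normc z * t < 1 ->
  (\sum_(n < N) PHI s P (delta R 0) n * z ^+ n : C^o) @[N --> \oo] -->
    (\prod_(k < P) ((s k - z) / (1 - (s k)^*%C * z)) : C^o).
Proof.
move=> + al1 alt zt; elim: P s => [|P IHP] s sal.
  rewrite big_ord0 -cvg_shiftS /=.
  have -> : (fun N => \sum_(n < N.+1) delta R 0 n * z ^+ n : C^o) = cst 1.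
    apply/funext => N; rewrite big_ord_recl /delta /= mul1r expr0 big1 ?addr0// => i _.
    by rewrite mul0r.
  exact: cvg_cst.
have al0 : 0 <= al by apply: le_trans (sal 0%N); apply: normc_ge0.
have t0 : 0 <= t by rewrite (le_trans al0)// ltW.
rewrite big_ord_recl /=.
have d0b n : normc (delta R 0 n) <= 1 * t ^+ n.
  rewrite mul1r /delta; case: eqP => [->|_]; first by rewrite normc1 expr0.
  by rewrite normc0 exprn_ge0.
have hb := @PHI_bound R (fun k => s k.+1) P _ _ al t ler01 (fun k => sal k.+1) al1 alt d0b.
apply: phi_eval hb _ => //.
- by rewrite mulr_ge0// exprn_ge0// addr_ge0// invr_ge0 subr_ge0 ltW.
- exact: le_lt_trans (sal _) alt.
- by apply: IHP => k; apply: sal.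
Qed.

Variables (m : nat) (hm : (0 < m)%N) (theta : R) (a : 'I_m -> C).
Hypothesis ha : forall j, normc (a j) < 1.

Local Notation b := (blaschke_coef hm theta a).

Section Radius.
Variable r : R.
Hypothesis r0 : 0 < r.
Hypothesis har : forall j, normc (a j) * r < 1.

(** r may exceed 1 but stays below the poles. So the zeros are bounded by some al < 1/r, and t is
    the midpoint of al and 1/r. *)
Let radius : exists al t : R, [/\ 0 <= al, al < 1, al < t, r * t < 1 &
  forall j, normc (a j) <= al].
Proof.
have c0 : 0 < Num.min 1 r^-1 by rewrite lt_min ltr01 invr_gt0.
have [j|al [/andP[al0 al1] aal]] := @normc_family_bound R m a _ c0.
  by rewrite lt_min ha /= -[r^-1]mul1r ltr_pdivlMr// har.
move: al1; rewrite lt_min => /andP[al1 alr].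
have rr : r * r^-1 = 1 by rewrite divff// gt_eqF.
exists al, ((al + r^-1) / 2); split=> //; first by lra.
rewrite -[ltRHS]rr ltr_pM2l//; lra.
Qed.

Lemma blaschke_eval (z : C) : normc z <= r ->
  (\sum_(n < N) b n * z ^+ n : C^o) @[N --> \oo] --> (blaschke theta a z : C^o).
Proof.
move=> zr; have [al [t [al0 al1 alt rt aal]]] := radius.
have zt : normc z * t < 1.
  by apply: le_lt_trans rt; rewrite ler_wpM2r// (le_trans al0)// ltW.
have := @PHI_eval (periodic hm a) al t z m (fun k => aal _) al1 alt zt.
move=> /(@cvgMr C nat \oo _ _ (expi theta) _).
rewrite /blaschke.
have -> : \prod_(k < m) ((periodic hm a k - z) / (1 - (periodic hm a k)^*%C * z)) =
          \prod_(j < m) ((a j - z) / (1 - (a j)^*%C * z)).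
  apply: eq_bigr => k _; rewrite /periodic.
  by have -> : Ordinal (ltn_pmod k hm) = k by apply: val_inj; rewrite /= modn_small.
have -> : (fun N => \sum_(n < N) b n * z ^+ n : C^o) = (fun N =>
    expi theta * (\sum_(n < N) PHI (periodic hm a) m (delta R 0) n * z ^+ n) : C^o).
  by apply/funext => N; rewrite mulr_sumr; apply: eq_bigr => n _; rewrite /blaschke_coef mulrA.
exact.
Qed.

(** Uniformity in z and N provides the dominating constant for integration term by term. *)
Lemma blaschke_partial_bound : exists K : R, 0 <= K /\ forall (z : C) N,
  normc z <= r -> normc (\sum_(n < N) b n * z ^+ n) <= K.
Proof.
have [al [t [al0 al1 alt rt aal]]] := radius.
have t0 : 0 <= t by rewrite (le_trans al0)// ltW.
have d0b n : normc (delta R 0 n) <= 1 * t ^+ n.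
  rewrite mul1r /delta; case: eqP => [->|_]; first by rewrite normc1 expr0.
  by rewrite normc0 exprn_ge0.
have hb := @PHI_bound R (periodic hm a) m _ _ al t ler01 (fun k => aal _) al1 alt d0b.
set L := 1 * _ in hb.
have L0 : 0 <= L by rewrite /L mul1r exprn_ge0// addr_ge0// invr_ge0 subr_ge0 ltW.
exists (L / (1 - r * t)); split=> [|z N zr].
  by rewrite divr_ge0// subr_ge0 ltW.
apply: le_trans (ler_normc_sum _ _ _) _.
apply: (@le_trans _ _ (\sum_(n < N) L * (r * t) ^+ n)).
  apply: ler_sum => n _; rewrite /blaschke_coef !normcM normc_expi mul1r normcX.
  rewrite exprMn mulrCA mulrC; apply: ler_pM; rewrite ?exprn_ge0 ?normc_ge0//.
  by apply: lerXn2r; rewrite ?nnegrE ?normc_ge0// ltW.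
by rewrite -mulr_sumr ler_wpM2l// sum_expr_le// mulr_ge0// ltW.
Qed.

Local Notation zeta t := (r%:C * expi t).

Let zetaN t : normc (zeta t) = r.
Proof. by rewrite normcM normc_real normc_expi mulr1 gtr0_norm. Qed.

(** Proved by integrating the power series term by term on the circle, where orthogonality of the
    exponentials keeps one coefficient. *)
Lemma cauchy_coef l :
  cintegrable (fun t => blaschke theta a (zeta t) * (zeta t)^-1 ^+ l.+1 * ('i%C * zeta t)) /\
  cintegral 0 (2 * pi)
    (fun t => blaschke theta a (zeta t) * (zeta t)^-1 ^+ l.+1 * ('i%C * zeta t)) =
  2 * pi%:C * 'i%C * b l.
Proof.
have rc0 : r%:C != 0 :> C by rewrite eq_complex /= gt_eqF.
have ex0 t : expi t != 0 :> C.
  by apply: contra_eq_neq (normc_expi t) => ->; rewrite normc0 eq_sym oner_eq0.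
pose F k t : C := b k * ('i%C * r%:C ^+ k * r%:C^-1 ^+ l) * (expi t ^+ k * (expi t)^-1 ^+ l).
have FE k t : F k t = b k * zeta t ^+ k * ((zeta t)^-1 ^+ l.+1 * ('i%C * zeta t)).
  rewrite /F !exprS invfM !exprMn.
  have alg (x y p q i u v : C) :
    x * y * (p * q) * (i * (u * v)) = x * u * (y * v) * (i * p * q) by ring.
  rewrite (alg r%:C^-1 (expi t)^-1) mulVf// mulVf//; ring.
have iF k : cintegrable (F k) /\ cintegral 0 (2 * pi) (F k) =
    b k * ('i%C * r%:C ^+ k * r%:C^-1 ^+ l) * ((2 * pi)%:C * (k == l)%:R).
  have [h1 h2] := cintegral_expi R k l.
  by have [h3 h4] := cintegrable_scale (b k * ('i%C * r%:C ^+ k * r%:C^-1 ^+ l)) h1;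
     rewrite -h2.
have [K [K0 hK]] := blaschke_partial_bound.
have i1 : normc ('i%C : C) = 1 by rewrite /= expr0n expr1n add0r sqrtr1.
have [] := @cintegral_cvg R (fun N t => \sum_(k < N) F k t)
  (fun t => blaschke theta a (zeta t) * (zeta t)^-1 ^+ l.+1 * ('i%C * zeta t))
  (K * (r^-1 ^+ l.+1 * r)).
- by move=> N; have [] := cintegrable_sum (index_enum 'I_N) (fun k : 'I_N => (iF k).1).
- move=> N t; under eq_bigr do rewrite FE.
  rewrite -mulr_suml normcM; apply: ler_pM; rewrite ?normc_ge0 ?hK ?zetaN//.
  by rewrite normcM normcX normcV [X in _ * X]normcM zetaN i1 mul1r.
- move=> t; under eq_fun do under eq_bigr do rewrite FE.
  under eq_fun do rewrite -mulr_suml.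
  rewrite -[_ * _ * ('i%C * _)]mulrA; apply: cvgMl; apply: blaschke_eval.
  by rewrite zetaN.
move=> ci cl; split=> //; apply: ccvg_unique cl _.
(* The integrals of the partial sums are constant once N exceeds l. *)
apply: cvg_near_cst; near=> N.
have lN : (l < N)%N by near: N; exact: nbhs_infty_gt.
have [_ ->] := cintegrable_sum (index_enum 'I_N) (fun k : 'I_N => (iF k).1).
rewrite (bigD1 (Ordinal lN))//= big1 ?addr0 => [|k].
  have [_ ->] := iF l; rewrite eqxx mulr1 rmorphM /= rmorph_nat.
  have -> : b l * ('i%C * r%:C ^+ l * r%:C^-1 ^+ l) = b l * 'i%C * (r%:C * r%:C^-1) ^+ l.
    by rewrite exprMn; ring.
  by rewrite divff// expr1n; ring.
rewrite -val_eqE /= => /negbTE kl; have [_ ->] := iF k.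
by rewrite kl !mulr0.
Unshelve. all: by end_near. Qed.

End Radius.
End BlaschkeSeries.

(** * The resolvent of the backward shift *)

Section Resolvent.
Variables (R : realType) (beta : weight R).
Hypothesis hbeta : polynomial_growth beta.
Local Notation C := R[i].
Local Notation H2 := (H2 beta).
Local Notation S := (bshift beta).

Lemma is_resolvent_unique (H : normedModType C) (T : H -> H) z G G' :
  is_resolvent T z G -> is_resolvent T z G' -> G =1 G'.
Proof. by move=> [_ h1 _] [_ _ h2] x; rewrite -{1}(h2 x) h1. Qed.

Lemma resolventP (H : normedModType C) (T : H -> H) z :
  ~ spectrum T z -> is_resolvent T z (resolvent T z).
Proof. by move=> /contrapT h; exact: (xgetPex (fun=> 0) h). Qed.

Lemma bshift_delta0 : S (hdelta beta 0) = 0.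
Proof. by apply: coef_inj => k; rewrite bshiftE hdeltaE. Qed.

Lemma bshift_deltaS n : S (hdelta beta n.+1) = hdelta beta n.
Proof. by apply: coef_inj => k; rewrite bshiftE !hdeltaE /delta eqSS. Qed.

Definition resolvent_mat (z : C) (p n : nat) : C :=
  if (p <= n)%N then z^-1 ^+ (n - p).+1 else 0.

(** The Neumann series of the resolvent at a monomial, finite because the backward shift is
    nilpotent on polynomials of bounded degree. *)
Definition resolvent_delta (z : C) (i : nat) : H2 :=
  \sum_(l < i.+1) z^-1 ^+ l.+1 *: hdelta beta (i - l).

Lemma resolvent_delta0 z : resolvent_delta z 0 = z^-1 *: hdelta beta 0.
Proof. by rewrite /resolvent_delta big_ord_recl big_ord0 addr0 expr1. Qed.

Lemma resolvent_deltaS z i :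
  resolvent_delta z i.+1 = z^-1 *: (hdelta beta i.+1 + resolvent_delta z i).
Proof.
rewrite /resolvent_delta big_ord_recl /= expr1 subn0 scalerDr; congr (_ + _).
by rewrite scaler_sumr; apply: eq_bigr => l _; rewrite scalerA -exprS.
Qed.

Lemma resolvent_delta_coef z i p : resolvent_delta z i p = resolvent_mat z p i.
Proof.
rewrite /resolvent_mat; elim: i => [|i IHi].
  rewrite resolvent_delta0 coefZ hdeltaE /delta leqn0.
  by case: eqP => [->|_]; rewrite ?mulr0 ?mulr1 ?subnn ?expr1.
rewrite resolvent_deltaS coefZ coefD hdeltaE IHi /delta.
have [->|pi] := eqVneq p i.+1; first by rewrite ltnn addr0 leqnn subnn mulr1 expr1.
rewrite add0r; have [pl|pl] := leqP p i.
  by rewrite leqW// subSn// exprS.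
by rewrite mulr0 leqNgt ltn_neqAle eq_sym pi pl.
Qed.

Lemma resolvent_deltaP z i : z != 0 ->
  z *: resolvent_delta z i - S (resolvent_delta z i) = hdelta beta i.
Proof.
move=> z0; have [lS _] := bshift_bounded hbeta; elim: i => [|i IHi].
  by rewrite resolvent_delta0 (linear_mapZ _ _ lS) bshift_delta0 scaler0 subr0 scalerA divff// scale1r.
rewrite resolvent_deltaS (linear_mapZ _ _ lS) (linear_mapD _ _ lS) bshift_deltaS scalerA divff// scale1r.
rewrite -IHi; set d := resolvent_delta z i.
have -> : z *: d - S d + S d = z *: d by rewrite subrK.
by rewrite scalerA mulVf// scale1r addrK.
Qed.

(** The monomial is z - S applied to an explicit polynomial, so the left inverse property determines
    the value. *)
Lemma is_resolvent_delta z G i : z != 0 -> is_resolvent S z G ->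
  G (hdelta beta i) = resolvent_delta z i.
Proof. by move=> z0 [_ h _]; rewrite -(resolvent_deltaP i z0) h. Qed.

(** For s between 1 and r, the weights cost s^(n - p) and the entries gain r^(p - n), so the Schur
    kernel is geometric in n - p. A bound uniform in z is what dominated convergence on the circle
    requires. *)
Lemma resolvent_mat_bound (r : R) : 1 < r -> exists M : R, 0 <= M /\
  forall z : C, r <= normc z -> section_bound beta (resolvent_mat z) M.
Proof.
move=> r1; have r0 : 0 < r by apply: lt_trans r1.
pose s := (1 + r) / 2; have s1 : 1 < s by rewrite /s; lra.
have s0 : 0 < s by apply: lt_trans s1.
have [K [K0 hK]] := wt_geometric hbeta s1.
pose t := s / r; have t0 : 0 <= t by rewrite divr_ge0 ?ltW.
have t1 : t < 1 by rewrite ltr_pdivrMr// mul1r /s; lra.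
have t01 : 0 <= t < 1 by rewrite t0.
pose k p n := if (p <= n)%N then K * t ^+ (n - p) else 0.
have k0 p n : 0 <= k p n by rewrite /k; case: ifP => // _; rewrite mulr_ge0 ?exprn_ge0 ?(ltW K0).
pose A := K / (1 - t); have A0 : 0 <= A by rewrite divr_ge0 ?subr_ge0 ?(ltW K0) ?(ltW t1).
have rowE p N : \sum_(n < N) k p n = \sum_(i < N - p) K * t ^+ i.
  elim: N => [|N IHN]; first by rewrite !big_ord0.
  rewrite big_ord_recr IHN /k /=; case: leqP => pN; first by rewrite subSn// big_ord_recr.
  have -> : (N.+1 - p = 0)%N by lia.
  have -> : (N - p = 0)%N by lia.
  by rewrite big_ord0 addr0.
have rows p N : \sum_(n < N) k p n <= A.
  by rewrite rowE -mulr_sumr ler_wpM2l ?(ltW K0)// sum_expr_le.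
have cols n P : \sum_(p < P) k p n <= A.
  have colE : \sum_(p < n.+1) k p n = \sum_(i < n.+1) K * t ^+ i.
    rewrite (reindex_inj rev_ord_inj); apply: eq_bigr => i _ /=.
    by rewrite /k subSS leq_subr subKn// -ltnS.
  apply: (@le_trans _ _ (\sum_(p < n.+1) k p n)); last first.
    by rewrite colE -mulr_sumr ler_wpM2l ?(ltW K0)// sum_expr_le.
  elim: P => [|P IHP]; first by rewrite big_ord0 sumr_ge0.
  have [Pn|Pn] := ltnP P n.+1.
    rewrite (big_ord_widen _ (k^~ n) Pn) [leLHS]big_mkcond.
    by apply: ler_sum => i _; case: ifP.
  by rewrite big_ord_recr /= {2}/k leqNgt Pn addr0.
exists (A * A); split=> [|z rz]; first exact: mulr_ge0.
have z0 : 0 < normc z by apply: lt_le_trans rz.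
apply: (schur_test (k := k)) => // [n|p n]; first by rewrite ltW ?wt_gt0.
rewrite /resolvent_mat /k; case: leqP => pn; last by rewrite normc0 !mul0r.
have [_ hb] := hK p (n - p)%N; rewrite subnKC// in hb.
apply: (@le_trans _ _ (r^-1 ^+ (n - p) * (K * s ^+ (n - p) * beta n))); last first.
  rewrite le_eqVlt; apply/orP; left; apply/eqP.
  have -> : t ^+ (n - p) = s ^+ (n - p) * r^-1 ^+ (n - p) by rewrite -exprMn.
  by move: (r^-1 ^+ _) (s ^+ _) => u v; ring.
apply: ler_pM; rewrite ?normc_ge0 ?(ltW (wt_gt0 _ _))//.
rewrite normcX normcV exprS.
have zr : (normc z)^-1 <= r^-1 by rewrite lef_pV2 ?posrE.
rewrite -[leRHS]mul1r; apply: ler_pM; rewrite ?exprn_ge0 ?invr_ge0 ?normc_ge0//.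
  by rewrite invf_le1// (le_trans _ rz)// ltW.
by apply: lerXn2r; rewrite ?nnegrE ?invr_ge0 ?normc_ge0 ?(ltW r0).
Qed.

Lemma is_resolvent_mat_op z M : z != 0 -> 0 <= M ->
  section_bound beta (resolvent_mat z) M -> is_resolvent S z (mat_op (resolvent_mat z)).
Proof.
move=> z0 M0 hM; have bS := bshift_bounded hbeta; have [lS _] := bS.
have bG := mat_op_bounded M0 hM; have [lG _] := bG.
have Gd i : mat_op (resolvent_mat z) (hdelta beta i) = resolvent_delta z i.
  by apply: coef_inj => p; rewrite (mat_op_delta M0 hM) resolvent_delta_coef.
split=> // x.
  have bL : bounded_op (fun x => mat_op (resolvent_mat z) (z *: x - S x)).
    apply: (bounded_comp bG (S := fun x => z *: x - S x)).
    rewrite (_ : (fun x => _) = fun x => z *: x + -1 *: S x).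
      exact: bounded_add (bounded_scale z (bounded_id _)) (bounded_scale (-1) bS).
    by apply/funext => y; rewrite scaleN1r.
  apply: (bounded_ext bL (bounded_id _)) => -[|n].
    by rewrite bshift_delta0 subr0 (linear_mapZ _ _ lG) Gd resolvent_delta0 scalerA divff// scale1r.
  rewrite bshift_deltaS (linear_mapB _ _ lG) (linear_mapZ _ _ lG) !Gd resolvent_deltaS.
  by rewrite scalerA divff// scale1r addrK.
have bL : bounded_op (fun x => z *: mat_op (resolvent_mat z) x - S (mat_op (resolvent_mat z) x)).
  rewrite (_ : (fun x => _) = fun x => z *: mat_op (resolvent_mat z) x
      + -1 *: (S \o mat_op (resolvent_mat z)) x).
    exact: bounded_add (bounded_scale z bG) (bounded_scale (-1) (bounded_comp bS bG)).
  by apply/funext => y; rewrite scaleN1r.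
by apply: (bounded_ext bL (bounded_id _)) => n; rewrite Gd resolvent_deltaP.
Qed.

End Resolvent.

(** * The holomorphic functional calculus *)

Lemma cvg_bigprod (K : numFieldType) (I : Type) (r : seq I) (T : Type)
    (F : set_system T) (FF : Filter F) (f : I -> T -> K^o) (l : I -> K^o) :
  (forall i, f i x @[x --> F] --> l i) ->
  (\prod_(i <- r) f i x : K^o) @[x --> F] --> (\prod_(i <- r) l i : K^o).
Proof.
move=> fl; elim: r => [|i r IHr].
  by rewrite big_nil; under eq_cvg do rewrite big_nil; exact: cvg_cst.
by rewrite big_cons; under eq_cvg do rewrite big_cons; exact: cvgM.
Qed.

Lemma derivable_bigprod (K : numFieldType) (I : Type) (r : seq I)
    (f : I -> K^o -> K^o) (z : K^o) :
  (forall i, derivable (f i) z 1) -> derivable (fun w => \prod_(i <- r) f i w : K^o) z 1.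
Proof.
move=> df; elim: r => [|i r IHr].
  have -> : (fun w => \prod_(i <- [::]) f i w : K^o) = cst 1.
    by apply/funext => w; rewrite big_nil.
  exact: derivable_cst.
have -> : (fun w => \prod_(j <- i :: r) f j w : K^o) =
    f i * (fun w => \prod_(j <- r) f j w : K^o).
  by apply/funext => w; rewrite big_cons.
exact: derivableM.
Qed.

Section HolomorphicCalculus.
Variables (R : realType) (beta : weight R).
Hypothesis hbeta : polynomial_growth beta.
Local Notation C := R[i].
Local Notation H2 := (H2 beta).
Local Notation S := (bshift beta).
Variables (m : nat) (hm : (0 < m)%N) (theta : R) (a : 'I_m -> C).
Hypothesis ha : forall j, normc (a j) < 1.

Local Notation B := (blaschke theta a).
Local Notation A0 := (blaschke_op hm theta a : H2 -> H2).

Lemma blaschke_mul_den (z : C) : (forall j, 1 - (a j)^*%C * z != 0) ->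
  B z * \prod_j (1 - (a j)^*%C * z) = expi theta * \prod_j (a j - z).
Proof.
move=> d0; rewrite /blaschke -mulrA -big_split /=; congr (_ * _).
by apply: eq_bigr => j _; rewrite divfK.
Qed.

Lemma blaschke_den_neq0 (z : C) : (forall j, normc (a j) * normc z < 1) ->
  forall j, 1 - (a j)^*%C * z != 0.
Proof.
move=> az j; apply: contraTneq (az j) => /eqP; rewrite subr_eq0 => /eqP e.
by rewrite -(normc_conj (a j)) -normcM -e normc1 ltxx.
Qed.

Lemma blaschke_derivable (z : C) : (forall j, normc (a j) * normc z < 1) ->
  derivable (B : C^o -> C^o) z 1.
Proof.
move=> az; have d0 := blaschke_den_neq0 az.
have dfac j : derivable (fun w : C^o => (a j - w) / (1 - (a j)^*%C * w) : C^o) z 1.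
  apply: derivableM.
    by apply: derivableB; [exact: derivable_cst|exact: derivable_id].
  apply: derivableV; first exact: d0.
  apply: derivableB; first exact: derivable_cst.
  by apply: derivableM; [exact: derivable_cst|exact: derivable_id].
have h := derivable_bigprod dfac (r := index_enum 'I_m).
have -> : (B : C^o -> C^o) = (cst (expi theta) : C^o -> C^o) *
    (fun w => \prod_j ((a j - w) / (1 - (a j)^*%C * w)) : C^o) by apply/funext.
by apply: derivableM; [exact: derivable_cst|exact: h].
Qed.

(* B blows up at the pole of least modulus. *)
Lemma blaschke_derivable_radius (r rho : R) : 0 < r -> r < rho ->
  (forall z : C^o, `|z| < rho%:C -> derivable (B : C^o -> C^o) z 1) ->
  forall j, normc (a j) * r < 1.
Proof.
move=> r0 rr dB.
have [j0 hj0] : exists j0, forall j, normc (a j) <= normc (a j0).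
  case: (@arg_maxP _ _ _ (Ordinal hm) xpredT (fun j => normc (a j)) isT) => j0 _ h.
  by exists j0 => j; exact: h.
suff h0 : normc (a j0) * r < 1.
  by move=> j; apply: le_lt_trans h0; rewrite ler_wpM2r// ltW.
rewrite ltNge; apply/negP => h1.
have aj0 : a j0 != 0.
  by apply: contraTneq h1 => ->; rewrite normc0 mul0r -ltNge ltr01.
have aj0c : (a j0)^*%C != 0 by rewrite conjc_eq0.
have na0 : 0 < normc (a j0).
  by rewrite lt_def normc_ge0 andbT; apply: contra aj0 => /eqP/eq0_normc->.
pose z0 : C := (a j0)^*%C^-1.
have nz0 : normc z0 = (normc (a j0))^-1 by rewrite normcV normc_conj.
(* The pole has modulus at most r < rho, so [B] would be continuous there. *)
have cB : {for z0, continuous (B : C^o -> C^o)}.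
  apply: differentiable_continuous; apply/derivable1_diffP; apply: dB.
  rewrite normcE_real ltcR nz0; apply: le_lt_trans rr.
  by rewrite invf_ple ?posrE// -[r^-1]mul1r ler_pdivrMr.
(* These points approach the pole along its radius. They are regular because no pole has smaller
   modulus, and [n.+2] keeps the factor positive. *)
pose zn (n : nat) : C := (1 - n.+2%:R^-1)%:C * z0.
have zn_cvg : (zn n : C^o) @[n --> \oo] --> (z0 : C^o).
  rewrite -[z0 in X in _ --> X]mul1r; apply: cvgMl.
  apply: (@cvg_real_complex R (fun n => 1 - n.+2%:R^-1) 1).
  rewrite -[1 in X in _ --> X]subr0; apply: cvgB; first exact: cvg_cst.
  have := @cvg_harmonic R; rewrite -cvg_shiftS; exact.
have znN n j : normc (a j) * normc (zn n) < 1.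
  have e0 : 0 <= 1 - n.+2%:R^-1 :> R by rewrite subr_ge0 invf_le1 ?ler1n.
  rewrite /zn normcM normc_real ger0_norm// nz0.
  apply: (@le_lt_trans _ _ (1 - n.+2%:R^-1)).
    by rewrite mulrCA ler_piMr// ler_pdivrMr// mul1r.
  by rewrite ltrBlDr ltrDl invr_gt0.
clearbody zn.
have Bcvg : (B (zn n) : C^o) @[n --> \oo] --> (B z0 : C^o) by exact: cvg_comp zn_cvg cB.
have Dcvg : (\prod_j (1 - (a j)^*%C * zn n) : C^o) @[n --> \oo] -->
    (\prod_j (1 - (a j)^*%C * z0) : C^o).
  apply: cvg_bigprod => j; apply: cvgB; first exact: cvg_cst.
  apply: cvgMr; exact: zn_cvg.
have Ncvg : (\prod_j (a j - zn n) : C^o) @[n --> \oo] --> (\prod_j (a j - z0) : C^o).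
  by apply: cvg_bigprod => j; apply: cvgB; [exact: cvg_cst|exact: zn_cvg].
(* Division by zero gives [B z0] a default value, so that value is no contradiction in itself. The
   contradiction comes from the limit of [B] times its denominator, which would force the numerator
   to vanish at the pole. *)
have D0 : \prod_j (1 - (a j)^*%C * z0) = 0.
  by rewrite (bigD1 j0)//= /z0 divff// subrr mul0r.
have e n : B (zn n) * \prod_j (1 - (a j)^*%C * zn n) = expi theta * \prod_j (a j - zn n).
  by rewrite blaschke_mul_den//; exact: blaschke_den_neq0.
have : (B (zn n) * \prod_j (1 - (a j)^*%C * zn n) : C^o) @[n --> \oo] -->
    (B z0 * \prod_j (1 - (a j)^*%C * z0) : C^o) by exact: cvgM Bcvg Dcvg.
rewrite (funext e : (fun n => B (zn n) * _) = _).
move=> h.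
have E : B z0 * \prod_j (1 - (a j)^*%C * z0) = expi theta * \prod_j (a j - z0).
  by apply: ccvg_unique h _; apply: cvgMr; exact: Ncvg.
move/eqP: E; rewrite D0 mulr0 eq_sym mulf_eq0 => /orP[/eqP t0|].
  by have := normc_expi theta; rewrite t0 normc0 => /eqP; rewrite eq_sym oner_eq0.
move=> /prodf_eq0[j _]; rewrite subr_eq0 => /eqP aj.
(* A zero of [B] has modulus below 1, the pole has modulus above 1. *)
have := ha j; rewrite aj nz0 => /ltW; rewrite leNgt invf_gt1 ?ha//.
Qed.

Lemma coef_bounded p : bounded_op (fun f : H2 => f p : C^o).
Proof.
apply/bounded_opP; split=> [//|]; exists (beta p)^-1; split=> [|f].
  by rewrite invr_ge0 ltW ?wt_gt0.
by rewrite rnormC mulrC; exact: coef_le.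
Qed.

Section OnCircle.
Variable r : R.
Hypothesis r0 : 0 < r.
Hypothesis har : forall j, normc (a j) * r < 1.
Local Notation zeta t := (r%:C * expi t).
Hypothesis hres : forall t, is_resolvent S (zeta t) (resolvent S (zeta t)).
Variable ph : H2 -> C^o.
Hypothesis bph : bounded_op ph.

Let zetaN t : normc (zeta t) = r.
Proof. by rewrite normcM normc_real normc_expi mulr1 gtr0_norm. Qed.

Let zeta0 t : zeta t != 0.
Proof. by apply: contraTneq r0 => e; rewrite -(zetaN t) e normc0 ltxx. Qed.

Let F (x : H2) (t : R) : C :=
  B (zeta t) * ph (resolvent S (zeta t) x) * ('i%C * zeta t).

(** On a monomial the resolvent is a finite sum of negative powers of z, so each term is the Cauchy
    integral of one Taylor coefficient; reversing the summation matches [blaschke_op_delta]. *)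
Lemma hol_calc_delta i : cintegrable (F (hdelta beta i)) /\
  cintegral 0 (2 * pi) (F (hdelta beta i)) = 2 * pi%:C * 'i%C * ph (A0 (hdelta beta i)).
Proof.
have [lph _] := bph.
pose G (l : nat) t := ph (hdelta beta (i - l)) *
  (B (zeta t) * (zeta t)^-1 ^+ l.+1 * ('i%C * zeta t)).
have -> : F (hdelta beta i) = fun t => \sum_(l < i.+1) G l t.
  apply/funext => t; rewrite /F (is_resolvent_delta hbeta _ (zeta0 t) (hres t)).
  rewrite /resolvent_delta (linear_map_sum _ _ lph) mulr_sumr mulr_suml.
  apply: eq_bigr => l _; rewrite (linear_mapZ _ _ lph) /G.
  rewrite -[_ *: _]/((zeta t)^-1 ^+ l.+1 * ph (hdelta beta (i - l))).
  move: ((zeta t)^-1 ^+ _) (B _) (ph _) ('i%C * _) => u v w x; ring.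
have iG l := cintegrable_scale (ph (hdelta beta (i - l))) (cauchy_coef hm theta ha r0 har l).1.
have [h1 ->] := cintegrable_sum (index_enum 'I_i.+1) (fun l : 'I_i.+1 => (iG l).1).
split=> //; rewrite blaschke_op_delta// (linear_map_sum _ _ lph) mulr_sumr.
rewrite (reindex_inj rev_ord_inj); apply: eq_bigr => l _ /=.
rewrite (iG _).2 (cauchy_coef hm theta ha r0 har _).2 subSS subKn ?(linear_mapZ _ _ lph) -1?ltnS//.
rewrite -[_ *: _]/(blaschke_coef hm theta a (i - l) * ph (hdelta beta l)); ring.
Qed.

Lemma hol_calc_trunc x N : cintegrable (F (trunc x N)) /\
  cintegral 0 (2 * pi) (F (trunc x N)) = 2 * pi%:C * 'i%C * ph (A0 (trunc x N)).
Proof.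
have [lph _] := bph; have [lA _] := blaschke_op_bounded hbeta hm theta ha.
have -> : F (trunc x N) = fun t => \sum_(i < N) x i * F (hdelta beta i) t.
  apply/funext => t; have [[lG _] _ _] := hres t.
  rewrite /F /trunc (linear_map_sum _ _ lG) (linear_map_sum _ _ lph) mulr_sumr mulr_suml.
  apply: eq_bigr => i _; rewrite (linear_mapZ _ _ lG) (linear_mapZ _ _ lph).
  rewrite -[_ *: _]/(x i * ph _).
  move: (B _) (ph _) ('i%C * _) (x i) => u v w y; ring.
have iF (i : 'I_N) := cintegrable_scale (x i) (hol_calc_delta i).1.
have [h1 ->] := cintegrable_sum (index_enum 'I_N) (fun i => (iF i).1).
split=> //; rewrite /trunc (linear_map_sum _ _ lA) (linear_map_sum _ _ lph) mulr_sumr.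
apply: eq_bigr => i _; rewrite (iF i).2 (hol_calc_delta i).2 (linear_mapZ _ _ lA) (linear_mapZ _ _ lph).
rewrite -[_ *: _]/(x i * ph _); move: (ph _) => y; ring.
Qed.

(** From polynomials to x: the bounds on the resolvent, on [ph] and on [B] along the circle dominate
    the integrands of all truncations. *)
Lemma hol_calc_circle x (M : R) : 0 <= M ->
  (forall t y, rnorm (resolvent S (zeta t) y) <= M * rnorm y) ->
  cintegral 0 (2 * pi) (F x) = 2 * pi%:C * 'i%C * ph (A0 x).
Proof.
move=> M0 hM; have [lph [P [P0 hP]]] := (bounded_opP ph).1 bph.
have [K [K0 hK]] := blaschke_partial_bound hm theta ha r0 har.
have BK t : normc (B (zeta t)) <= K.
  have zr : normc (zeta t) <= r by rewrite zetaN.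
  have h := cvg_normc (blaschke_eval (theta := theta) hm ha r0 har zr).
  rewrite -(cvg_lim (@Rhausdorff R) h); apply: limr_le; first by apply/cvg_ex; eexists; exact: h.
  by apply: nearW => N; apply: hK; rewrite zetaN.
have tN N : rnorm (trunc x N) <= rnorm x.
  apply: rnorm_le => [|n]; first exact: rnorm_ge0.
  apply: le_trans (rnorm_partial x n); apply: ler_sum => k _.
  by rewrite /sqterm truncE; case: ifP => // _; rewrite normc0 expr0n mul0r mulr_ge0 ?sqr_ge0.
have tcvg : trunc x N @[N --> \oo] --> x.
  apply: cvg_rnorm; have := trunc_cvg x.
  by under eq_cvg do rewrite -rnormN opprB.
have i1 : normc ('i%C : C) = 1 by rewrite /= expr0n expr1n add0r sqrtr1.
have [||] := @cintegral_cvg R (fun N => F (trunc x N)) (F x)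
  (K * (P * (M * rnorm x)) * r) (fun N => (hol_calc_trunc x N).1).
- move=> N t; rewrite /F normcM; apply: ler_pM; rewrite ?normc_ge0//; last first.
    by rewrite normcM i1 mul1r zetaN.
  rewrite normcM; apply: ler_pM; rewrite ?normc_ge0//.
  rewrite -rnormC; apply: le_trans (hP _) _; rewrite ler_wpM2l//.
  by apply: le_trans (hM _ _) _; rewrite ler_wpM2l.
- move=> t; have [bG _ _] := hres t.
  apply: cvgMl; apply: cvgMr; apply: (bounded_cvg _ bph); exact: (bounded_cvg _ bG).
move=> _ h; apply: ccvg_unique h _.
under eq_cvg do rewrite (hol_calc_trunc x _).2.
apply: cvgMr; apply: (bounded_cvg _ bph).
exact: (bounded_cvg _ (blaschke_op_bounded hbeta hm theta ha)).
Qed.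

End OnCircle.

Lemma two_pi_i_neq0 : 2 * pi%:C * 'i%C != 0 :> C.
Proof.
have p0 : pi%:C != 0 :> C by rewrite eq_complex /= gt_eqF ?pi_gt0.
have i0 : 'i%C != 0 :> C by rewrite eq_complex /= oner_eq0 andbF.
by rewrite mulf_neq0// mulf_neq0// pnatr_eq0.
Qed.

Lemma is_hol_calc_blaschke : is_hol_calc S B A0.
Proof.
have [al [/andP[al0 al1] aal]] := normc_family_bound ltr01 ha.
(* rho exceeds 1 and al rho < 1, so the disk of radius rho contains the closed unit disk but no
   pole; r is the midpoint of 1 and rho. *)
pose rho : R := 2 / (1 + al); pose r : R := (1 + rho) / 2.
have d0 : 0 < 1 + al by rewrite ltr_pwDl.
have rho1 : 1 < rho by rewrite ltr_pdivlMr// mul1r; lra.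
have alrho : al * rho < 1 by rewrite mulrA ltr_pdivrMr// mul1r; lra.
have r1 : 1 < r by rewrite /r; lra.
have rrho : r < rho by rewrite /r; lra.
have r0 : 0 < r by apply: lt_trans r1.
have har j : normc (a j) * r < 1.
  apply: le_lt_trans alrho; apply: ler_pM; rewrite ?normc_ge0 ?(ltW r0) ?(ltW rrho)//.
have [M [M0 hM]] := resolvent_mat_bound hbeta r1.
have hres z : r <= normc z -> is_resolvent S z (mat_op (resolvent_mat z)).
  move=> rz; apply: (is_resolvent_mat_op hbeta _ M0 (hM z rz)).
  by apply: contraTneq rz => ->; rewrite normc0 -ltNge.
have hnsp z : r <= normc z -> ~ spectrum S z.
  by move=> rz; apply; exists (mat_op (resolvent_mat z)); exact: hres.
split; first exact: blaschke_op_bounded.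
exists r, rho; split.
- by rewrite r0.
- move=> z hz /=; rewrite normcE_real ltcR ltNge; apply/negP => rz.
  exact: hnsp rz hz.
- move=> z; rewrite normcE_real ltcR => zrho; apply: blaschke_derivable => j.
  apply: le_lt_trans alrho; apply: ler_pM; rewrite ?normc_ge0 ?(ltW zrho)//.
move=> ph x bph.
have zetaN t : normc (r%:C * expi t) = r.
  by rewrite normcM normc_real normc_expi mulr1 gtr0_norm.
have hz t : r <= normc (r%:C * expi t) by rewrite zetaN.
have hr t : is_resolvent S (r%:C * expi t) (resolvent S (r%:C * expi t)).
  exact: resolventP (hnsp _ (hz t)).
have hM' t y : rnorm (resolvent S (r%:C * expi t) y) <= Num.sqrt M * rnorm y.
  rewrite (is_resolvent_unique (hr t) (hres _ (hz t))).
  exact: rnorm_mat_op M0 (hM _ (hz t)) y.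
rewrite /circle_integral (hol_calc_circle r0 har hr bph x (sqrtr_ge0 M) hM').
by rewrite mulrA mulVf ?mul1r// two_pi_i_neq0.
Qed.

(** A competing A comes with its own radii, from which [blaschke_derivable_radius] excludes the
    poles. Coordinate functionals at monomials then give integrals that [hol_calc_delta] evaluates
    on any such circle. *)
Lemma is_hol_calc_unique A : is_hol_calc S B A -> A =1 A0.
Proof.
move=> [bA [r [rho [/andP[r0 rr] sp dB hA]]]].
have har := blaschke_derivable_radius r0 rr dB.
have hr t : is_resolvent S (r%:C * expi t) (resolvent S (r%:C * expi t)).
  apply: resolventP => /sp /=; rewrite normcE_real ltcR.
  by rewrite normcM normc_real normc_expi mulr1 gtr0_norm// ltxx.
apply: (bounded_ext bA (blaschke_op_bounded hbeta hm theta ha)) => i.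
apply: coef_inj => p; rewrite (hA _ (hdelta beta i) (coef_bounded p)) /circle_integral.
rewrite (hol_calc_delta r0 har hr (coef_bounded p) i).2.
by rewrite mulrA mulVf ?mul1r// two_pi_i_neq0.
Qed.

Lemma hol_calc_blaschke : hol_calc S B = A0.
Proof.
apply/funext; apply: is_hol_calc_unique.
have : exists A, is_hol_calc S B A by exists A0; exact: is_hol_calc_blaschke.
exact: (xgetPex (fun=> 0)).
Qed.

End HolomorphicCalculus.

Theorem corollary3p9 (R : realType) (beta : weight R)
    (hbeta : polynomial_growth beta)
    (m : nat) (hm : (0 < m)%N) (theta : R) (a : 'I_m -> R[i])
    (ha : forall j : 'I_m, `|a j| < 1) :
  similar_bundles
    (ker_bundle (hol_calc (bshift beta) (blaschke theta a)))
    (dsum_bundle m (ker_bundle (bshift beta))).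
Proof.
have ha' j : normc (a j) < 1 by have := ha j; rewrite normcE_real -[1]/(1%:C) ltcR.
by rewrite (hol_calc_blaschke hbeta hm theta ha'); exact: blaschke_op_similar.
Qed.
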